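(* Let $\mathcal{A}:\mathbf{A}^{op}\to\mathbf{Set}$ be an astroidal set. Then the following are equivalent: (1) there exists a cyclic operad $\mathcal{C}$ (over $\mathbf{Set}$) such that $\mathcal{A}\cong n_a(\mathcal{C})$; (2) $\mathcal{A}$ satisfies the Segal condition; (3) $\mathcal{A}$ satisfies the strict inner Kan condition.
   Context: **Unrooted trees.** An unrooted tree is a finite simply connected graph together with a subset $I$ of its outermost (univalent) vertices, the ''input vertices''; these are not drawn, so the edges ending at them are legs (leaves), and ''vertex'' means a vertex not in $I$. Let $\eta$ be the tree with a single edge and no vertices. A corolla is a tree with exactly one vertex; for a vertex $v$ of $T$, $C_v$ denotes the corolla given by $v$ and its adjacent edges, a sub-tree of $T$. An inner edge is an edge joining two vertices; an outer vertex is a vertex attached to at most one inner edge. **The category $\mathbf{A}$.** Objects are unrooted trees; morphisms are compositions of the following maps (and isomorphisms of trees). For an inner edge $c$ of $T$ with end vertices $x,y$, $T/c$ is obtained by contracting $c$ (deleting $x,y,c$ and adding a vertex $xy$ adjacent to all other edges of $x$ and $y$), and $\delta^c:T/c\to T$ is the inner coface map. For an outer vertex $u$ of $T$, $T/u$ is $T$ with $u$ and all its leaves deleted, and $\delta^u:T/u\to T$ is the outer coface map; for a corolla the outer cofaces are the inclusions of $\eta$ as one of its legs. For an edge $c$ of $T$, $T_c$ is obtained by subdividing $c$ with exactly one vertex, and $\sigma^c:T_c\to T$ is the codegeneracy map. These maps satisfy the usual relations; equivalently they are regarded as the maps they induce between the cyclic operads $\mathbf{A}(T)$ described below. **Astroidal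 sets.** An astroidal set (cyclic dendroidal set) is a functor $X:\mathbf{A}^{op}\to\mathbf{Set}$; morphisms are natural transformations, and $\mathrm{Hom}$ denotes the set of these. $\mathbf{A}[T]=\mathbf{A}(-,T)$ is the representable. For a coface map $\alpha:S\to T$ the face $\partial_\alpha\mathbf{A}[T]$ is the image of $\mathbf{A}[S]\to\mathbf{A}[T]$; for an inner edge $k$ of $T$ the inner horn $\Lambda^k[T]\subseteq\mathbf{A}[T]$ is the union of all faces $\partial_\alpha\mathbf{A}[T]$ for coface maps $\alpha\neq\delta^k$. **Strict inner Kan condition.** For every tree $T$ and inner horn $\Lambda^k[T]$, every map $\Lambda^k[T]\to X$ has a unique extension along $\Lambda^k[T]\subseteq\mathbf{A}[T]$ to a map $\mathbf{A}[T]\to X$. **Segal condition.** For a tree $T$ with at least one vertex, the Segal core $Sc[T]\subseteq\mathbf{A}[T]$ is the union over the vertices $v$ of $T$ of the images of $\mathbf{A}[C_v]\to\mathbf{A}[T]$. $X$ satisfies the Segal condition if for every such $T$ the canonical comparison (restriction) between $\mathrm{Hom}(\mathbf{A}[T],X)$ and $\mathrm{Hom}(Sc[T],X)$ is a bijection. **Cyclic operads (over $\mathbf{Set}$).** A (coloured, symmetric) cyclic operad $\mathcal{C}$ consists of: a set of colours $ob(\mathcal{C})$; for each finite list (profile) $\underline c=(c_1,\dots,c_n)$ of colours a set $\mathcal{C}(\underline c)$; a right action of the symmetric groups, i.e. bijections $\mathcal{C}(c_1,\dots,c_n)\to\mathcal{C}(c_{\sigma(1)},\dots,c_{\sigma(n)})$;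 and, whenever the last entry $c_m$ of $\underline c$ equals the $i$-th entry $d_i$ of $\underline d$, a composition $\circ_i:\mathcal{C}(\underline c)\times\mathcal{C}(\underline d)\to\mathcal{C}(d_1,\dots,d_{i-1},c_1,\dots,c_{m-1},d_{i+1},\dots,d_n)$. Composition is associative: $(\alpha\circ_i\beta)\circ_j\gamma=\alpha\circ_{i+j-1}(\beta\circ_j\gamma)$; unital: each colour $c$ has an identity $\eta_c\in\mathcal{C}(c,c)$ with $\theta\circ_1\eta_{c_n}=\theta=\eta_{c_i}\circ_i\theta$ for $\theta\in\mathcal{C}(c_1,\dots,c_n)$; and equivariant: it commutes with the symmetric group actions on both factors. Morphisms are maps on colours together with maps on operations preserving identities, symmetric group actions and compositions. This gives the category $\mathbf{CycOpd}$. **Nerve.** Each unrooted tree $T$ determines a cyclic operad $\mathbf{A}(T)$ with the edges of $T$ as colours, freely generated by the vertices of $T$ (a vertex with adjacent edges $c_1,\dots,c_n$ giving a generator in $\mathbf{A}(T)(c_1,\dots,c_n)$), functorially in $T\in\mathbf{A}$. The nerve of $\mathcal{C}$ is the astroidal set $n_a(\mathcal{C})_T=\mathbf{CycOpd}(\mathbf{A}(T),\mathcal{C})$. *)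

(* Defs.v *)
From HB Require Import structures.
From mathcomp Require Import all_boot fingroup perm.
From mathcomp Require Import generic_quotient boolp.
Set Implicit Arguments.
Unset Strict Implicit.
Unset Printing Implicit Defensive.
Local Open Scope quotient_scope.

(** * Cyclic operads over sets

    Sets are types, and the classical axioms of [boolp] (propositional and
    functional extensionality, choice) are used throughout. *)

(* [permute s c] is (c_{s(0)}, ..., c_{s(n-1)}) when [size c = n]. *)
Definition permute (T : Type) (n : nat) (s : 'S_n) (c : seq T) : seq T :=
  pmap (fun i : 'I_n => onth c (s i)) (enum 'I_n).

(* [comp c x d1 d2] is the composition [\circ_i] with [i = (size d1).+1]: it
   grafts the last entry of the first factor, of profile (c, x), onto the i-th
   entry of the second factor, of profile (d1, x, d2). *)
Record cycData := CycData {
  col : Type;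
  op : seq col -> Type;
  act : forall (n : nat) (s : 'S_n) (c : seq col),
    size c = n -> op c -> op (permute s c);
  idop : forall x : col, op [:: x; x];
  comp : forall (c : seq col) (x : col) (d1 d2 : seq col),
    op (rcons c x) -> op (d1 ++ x :: d2) -> op (d1 ++ c ++ d2)
}.

Arguments op : clear implicits.
Arguments op {_} _ : rename.
Arguments act {D n} s {c} _ _ : rename.
Arguments idop {D} x : rename.
Arguments comp {D c x} d1 d2 _ _ : rename.

(* Transport along an equality of profiles. *)
Definition cst (D : cycData) (p q : seq (col D)) (e : p = q) (x : op p) : op q :=
  eq_rect p (fun r => op r) x q e.

Definition opRel (D : cycData) := forall c : seq (col D), op c -> op c -> Prop.

(* The axioms of a cyclic operad, with equality of operations replaced by a
   relation [R]; equality gives cyclic operads, and the least congruence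
   satisfying the axioms gives free cyclic operads.  Since profiles that the
   axioms identify are in general only provably equal, both sides are compared
   after transport; the transport proofs are universally quantified, which is
   harmless because they exist and equality proofs are irrelevant.

   Equivariance is with respect to all re-listings of the entries of both
   factors.  As composition is only given at the last entry of the first
   factor, a re-listing of both factors either keeps the composed entry last in
   the first factor ([law_equiv]) or makes it last in the second one, so that
   the two factors trade places ([law_exchange]).  The latter is what makes the
   composite of two adjacent vertices of an unrooted tree along their common
   edge independent of the order of the two vertices.  In both axioms the entries
   are labelled by distinct natural numbers, [f] giving the colour of an entry
   and [a] being the label shared by the two entries that get composed; the
   effect of a permutation is read off from the labels. *)
Record cycLaws (D : cycData) (R : opRel D) : Prop := CycLaws {
  law_act1 : forall (n : nat) (c : seq (col D)) (h : size c = n)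
      (e : permute (1%g : 'S_n) c = c) (x : op c),
    R _ (cst e (act 1%g h x)) x;
  law_actM : forall (n : nat) (s t : 'S_n) (c : seq (col D)) (h : size c = n)
      (h' : size (permute s c) = n)
      (e : permute t (permute s c) = permute (t * s)%g c) (x : op c),
    R _ (cst e (act t h' (act s h x))) (act (t * s)%g h x);
  law_unitr : forall (c : seq (col D)) (x : col D)
      (e : [::] ++ c ++ [:: x] = rcons c x) (u : op (rcons c x)),
    R _ (cst e (comp [::] [:: x] u (idop x))) u;
  law_unitl : forall (x : col D) (d1 d2 : seq (col D)) (u : op (d1 ++ x :: d2)),
    R _ (comp (c := [:: x]) d1 d2 (idop x) u) u;
  law_assoc : forall (c : seq (col D)) (x : col D) (d1 d2 : seq (col D))
      (y : col D) (g1 g2 : seq (col D))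
      (u : op (rcons c x)) (v : op (d1 ++ x :: rcons d2 y))
      (w : op (g1 ++ y :: g2))
      (e1 : d1 ++ c ++ rcons d2 y = rcons (d1 ++ c ++ d2) y)
      (e2 : d1 ++ x :: rcons d2 y = rcons (d1 ++ x :: d2) y)
      (e3 : g1 ++ (d1 ++ x :: d2) ++ g2 = (g1 ++ d1) ++ x :: (d2 ++ g2))
      (e4 : (g1 ++ d1) ++ c ++ (d2 ++ g2) = g1 ++ (d1 ++ c ++ d2) ++ g2),
    R _ (comp g1 g2 (cst e1 (comp d1 (rcons d2 y) u v)) w)
        (cst e4 (comp (g1 ++ d1) (d2 ++ g2) u
                   (cst e3 (comp g1 g2 (cst e2 v) w))));
  law_equiv : forall (f : nat -> col D) (a : nat) (l d1 d2 l' d1' d2' : seq nat)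
      (n1 n2 n3 : nat) (s : 'S_n1) (t : 'S_n2) (r : 'S_n3),
    uniq (a :: d1 ++ l ++ d2) ->
    permute s (rcons l a) = rcons l' a ->
    permute t (d1 ++ a :: d2) = d1' ++ a :: d2' ->
    permute r (d1 ++ l ++ d2) = d1' ++ l' ++ d2' ->
    forall (u : op (rcons (map f l) (f a))) (v : op (map f d1 ++ f a :: map f d2))
      (h1 : size (rcons (map f l) (f a)) = n1)
      (h2 : size (map f d1 ++ f a :: map f d2) = n2)
      (h3 : size (map f d1 ++ map f l ++ map f d2) = n3)
      (e1 : permute s (rcons (map f l) (f a)) = rcons (map f l') (f a))
      (e2 : permute t (map f d1 ++ f a :: map f d2) =
            map f d1' ++ f a :: map f d2')
      (e3 : permute r (map f d1 ++ map f l ++ map f d2) =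
            map f d1' ++ map f l' ++ map f d2'),
    R _ (comp (map f d1') (map f d2') (cst e1 (act s h1 u)) (cst e2 (act t h2 v)))
        (cst e3 (act r h3 (comp (map f d1) (map f d2) u v)));
  law_exchange : forall (f : nat -> col D) (a : nat)
      (l d1 d2 d' l1' l2' : seq nat)
      (n1 n2 n3 : nat) (s : 'S_n1) (t : 'S_n2) (r : 'S_n3),
    uniq (a :: d1 ++ l ++ d2) ->
    permute s (rcons l a) = l1' ++ a :: l2' ->
    permute t (d1 ++ a :: d2) = rcons d' a ->
    permute r (d1 ++ l ++ d2) = l1' ++ d' ++ l2' ->
    forall (u : op (rcons (map f l) (f a))) (v : op (map f d1 ++ f a :: map f d2))
      (h1 : size (rcons (map f l) (f a)) = n1)
      (h2 : size (map f d1 ++ f a :: map f d2) = n2)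
      (h3 : size (map f d1 ++ map f l ++ map f d2) = n3)
      (e1 : permute s (rcons (map f l) (f a)) =
            map f l1' ++ f a :: map f l2')
      (e2 : permute t (map f d1 ++ f a :: map f d2) = rcons (map f d') (f a))
      (e3 : permute r (map f d1 ++ map f l ++ map f d2) =
            map f l1' ++ map f d' ++ map f l2'),
    R _ (comp (map f l1') (map f l2') (cst e2 (act t h2 v)) (cst e1 (act s h1 u)))
        (cst e3 (act r h3 (comp (map f d1) (map f d2) u v)))
}.

Record cycOperad := CycOperad {
  cdata :> cycData;
  claws : cycLaws (D := cdata) (fun _ x y => x = y)
}.

Record cycMor (C D : cycOperad) := CycMor {
  fcol : col C -> col D;
  fop : forall c : seq (col C), op c -> op (map fcol c);
  fop_id : forall x : col C, fop (idop x) = idop (fcol x);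
  fop_act : forall (n : nat) (s : 'S_n) (c : seq (col C)) (h : size c = n)
      (h' : size (map fcol c) = n)
      (e : map fcol (permute s c) = permute s (map fcol c)) (x : op c),
    cst e (fop (act s h x)) = act s h' (fop x);
  fop_comp : forall (c : seq (col C)) (x : col C) (d1 d2 : seq (col C))
      (u : op (rcons c x)) (v : op (d1 ++ x :: d2))
      (e1 : map fcol (rcons c x) = rcons (map fcol c) (fcol x))
      (e2 : map fcol (d1 ++ x :: d2) = map fcol d1 ++ fcol x :: map fcol d2)
      (e3 : map fcol (d1 ++ c ++ d2) =
            map fcol d1 ++ map fcol c ++ map fcol d2),
    cst e3 (fop (comp d1 d2 u v)) =
    comp (map fcol d1) (map fcol d2) (cst e1 (fop u)) (cst e2 (fop v))
}.

Arguments fop {C D} _ {c} _.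
Arguments fop_id {C D} _ x.
Arguments fop_act {C D} _ {n s c} h h' e x.
Arguments fop_comp {C D} _ {c x d1 d2} u v e1 e2 e3.

Lemma cst_id (D : cycData) (p : seq (col D)) (e : p = p) (x : op p) :
  cst e x = x.
Proof. by rewrite (Prop_irrelevance e erefl). Qed.

Lemma cst_trans (D : cycData) (p q r : seq (col D)) (e : p = q) (e' : q = r)
    (x : op p) :
  cst e' (cst e x) = cst (etrans e e') x.
Proof. by case: r / e'; case: q / e. Qed.

Lemma cst_irr (D : cycData) (p q : seq (col D)) (e e' : p = q) (x : op p) :
  cst e x = cst e' x.
Proof. by rewrite (Prop_irrelevance e e'). Qed.

Lemma fop_cst (C D : cycOperad) (f : cycMor C D) (p q : seq (col C))
    (e : p = q) (x : op p) :
  fop f (cst e x) = cst (congr1 (map (fcol f)) e) (fop f x).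
Proof. by case: q / e. Qed.

Lemma cycMor_eq (C D : cycOperad) (f g : cycMor C D) :
  (forall x, fcol f x = fcol g x) ->
  (forall c (x : op c) (e : map (fcol f) c = map (fcol g) c),
     cst e (fop f x) = fop g x) ->
  f = g.
Proof.
case: f g => [f0 f1 a1 a2 a3] [g0 g1 b1 b2 b3] /= E0.
have {}E0 : f0 = g0 by apply: funext.
case: g0 / E0 g1 b1 b2 b3 => g1 b1 b2 b3 E1.
have {}E1 : f1 = g1.
  by apply: functional_extensionality_dep => c; apply: funext => x;
     rewrite -(E1 _ _ erefl).
case: g1 / E1 b1 b2 b3 => b1 b2 b3.
by rewrite (Prop_irrelevance a1 b1) (Prop_irrelevance a2 b2) (Prop_irrelevance a3 b3).
Qed.

Lemma act_cst (D : cycData) n (s : 'S_n) (p q : seq (col D)) (e : p = q)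
    (h : size q = n) (h' : size p = n) (x : op p) :
  act s h (cst e x) = cst (congr1 (permute s) e) (act s h' x).
Proof. by case: q / e h => h; rewrite /= (Prop_irrelevance h h'). Qed.

Lemma map_permute (T U : Type) (f : T -> U) n (s : 'S_n) (c : seq T) :
  map f (permute s c) = permute s (map f c).
Proof.
have onth_map k : onth (map f c) k = omap f (onth c k).
  by elim: c k => [|x c IHc] [|k] //=.
rewrite /permute; elim: (enum _) => //= i r IH; rewrite onth_map.
by case: (onth c (s i)) => //= x; rewrite IH.
Qed.

Lemma comp_cst (D : cycData) (c c' : seq (col D)) (x : col D)
    (d1 d2 d1' d2' : seq (col D)) (u : op (rcons c x)) (v : op (d1 ++ x :: d2))
    (ec : c = c') (ed1 : d1 = d1') (ed2 : d2 = d2')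
    (e1 : rcons c x = rcons c' x) (e2 : d1 ++ x :: d2 = d1' ++ x :: d2')
    (e3 : d1 ++ c ++ d2 = d1' ++ c' ++ d2') :
  cst e3 (comp d1 d2 u v) = comp d1' d2' (cst e1 u) (cst e2 v).
Proof.
case: _ / ec e1 e3 => e1; case: _ / ed1 e2; case: _ / ed2 => e2 e3.
by rewrite !cst_id.
Qed.

Arguments comp_cst {D c c' x d1 d2 d1' d2'} u v ec ed1 ed2 e1 e2 e3.

Section IdMor.
Variable C : cycOperad.

Definition idmor_op (c : seq (col C)) (x : op c) : op (map id c) :=
  cst (esym (map_id c)) x.

Lemma idmor_id (x : col C) : idmor_op (idop x) = idop x.
Proof. exact: cst_id. Qed.

Lemma idmor_act (n : nat) (s : 'S_n) (c : seq (col C)) (h : size c = n)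
    (h' : size (map id c) = n)
    (e : map id (permute s c) = permute s (map id c)) (x : op c) :
  cst e (idmor_op (act s h x)) = act s h' (idmor_op x).
Proof. by rewrite /idmor_op (act_cst _ _ _ h) cst_trans; apply: cst_irr. Qed.

Lemma idmor_comp (c : seq (col C)) (x : col C) (d1 d2 : seq (col C))
    (u : op (rcons c x)) (v : op (d1 ++ x :: d2))
    (e1 : map id (rcons c x) = rcons (map id c) x)
    (e2 : map id (d1 ++ x :: d2) = map id d1 ++ x :: map id d2)
    (e3 : map id (d1 ++ c ++ d2) = map id d1 ++ map id c ++ map id d2) :
  cst e3 (idmor_op (comp d1 d2 u v)) =
  comp (map id d1) (map id d2) (cst e1 (idmor_op u)) (cst e2 (idmor_op v)).
Proof. by rewrite /idmor_op !cst_trans; apply: comp_cst; rewrite map_id. Qed.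

Definition idMor : cycMor C C := CycMor idmor_id idmor_act idmor_comp.

End IdMor.

Section CompMor.
Variables (C D E : cycOperad) (g : cycMor D E) (f : cycMor C D).

Definition compmor_op (c : seq (col C)) (x : op c) :
    op (map (fcol g \o fcol f) c) :=
  cst (esym (map_comp (fcol g) (fcol f) c)) (fop g (fop f x)).

Lemma compmor_id (x : col C) :
  compmor_op (idop x) = idop ((fcol g \o fcol f) x).
Proof. by rewrite /compmor_op cst_id (fop_id f) /= (fop_id g). Qed.

Lemma compmor_act (n : nat) (s : 'S_n) (c : seq (col C)) (h : size c = n)
    (h' : size (map (fcol g \o fcol f) c) = n)
    (e : map (fcol g \o fcol f) (permute s c) =
         permute s (map (fcol g \o fcol f) c)) (x : op c) :
  cst e (compmor_op (act s h x)) = act s h' (compmor_op x).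
Proof.
have h1 : size (map (fcol f) c) = n by rewrite size_map.
have h2 : size (map (fcol g) (map (fcol f) c)) = n by rewrite !size_map.
rewrite /compmor_op (act_cst _ _ _ h2).
rewrite -(fop_act g (c := map (fcol f) c) h1 h2 (map_permute _ _ _)).
rewrite -(fop_act f h h1 (map_permute _ _ _)) fop_cst !cst_trans.
exact: cst_irr.
Qed.

Lemma compmor_comp (c : seq (col C)) (x : col C) (d1 d2 : seq (col C))
    (u : op (rcons c x)) (v : op (d1 ++ x :: d2))
    (k := fcol g \o fcol f)
    (e1 : map k (rcons c x) = rcons (map k c) (k x))
    (e2 : map k (d1 ++ x :: d2) = map k d1 ++ k x :: map k d2)
    (e3 : map k (d1 ++ c ++ d2) = map k d1 ++ map k c ++ map k d2) :
  cst e3 (compmor_op (comp d1 d2 u v)) =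
  comp (map k d1) (map k d2) (cst e1 (compmor_op u)) (cst e2 (compmor_op v)).
Proof.
rewrite /compmor_op !cst_trans.
have f1 := map_rcons (fcol f) c x.
have f2 : map (fcol f) (d1 ++ x :: d2) =
    map (fcol f) d1 ++ fcol f x :: map (fcol f) d2 by rewrite map_cat.
have f3 : map (fcol f) (d1 ++ c ++ d2) =
    map (fcol f) d1 ++ map (fcol f) c ++ map (fcol f) d2 by rewrite !map_cat.
have g1 := map_rcons (fcol g) (map (fcol f) c) (fcol f x).
have g2 : map (fcol g) (map (fcol f) d1 ++ fcol f x :: map (fcol f) d2) =
    map (fcol g) (map (fcol f) d1) ++
    fcol g (fcol f x) :: map (fcol g) (map (fcol f) d2) by rewrite map_cat.
have g3 : map (fcol g)
      (map (fcol f) d1 ++ map (fcol f) c ++ map (fcol f) d2) =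
    map (fcol g) (map (fcol f) d1) ++ map (fcol g) (map (fcol f) c) ++
    map (fcol g) (map (fcol f) d2) by rewrite !map_cat.
have -> : fop f (comp d1 d2 u v) = cst (esym f3)
    (comp (map (fcol f) d1) (map (fcol f) d2)
      (cst f1 (fop f u)) (cst f2 (fop f v))).
  by rewrite -(fop_comp f u v f1 f2 f3) cst_trans cst_id.
rewrite fop_cst.
set u1 := cst f1 _; set v1 := cst f2 _.
have -> : fop g (comp (map (fcol f) d1) (map (fcol f) d2) u1 v1) =
    cst (esym g3) (comp (map (fcol g) (map (fcol f) d1))
      (map (fcol g) (map (fcol f) d2)) (cst g1 (fop g u1)) (cst g2 (fop g v1))).
  by rewrite -(fop_comp g u1 v1 g1 g2 g3) cst_trans cst_id.
rewrite /u1 /v1 !fop_cst !cst_trans.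
have q1 : rcons (map (fcol g) (map (fcol f) c)) (fcol g (fcol f x)) =
    rcons (map k c) (k x) by rewrite -map_comp.
have q2 : map (fcol g) (map (fcol f) d1) ++
    fcol g (fcol f x) :: map (fcol g) (map (fcol f) d2) =
    map k d1 ++ k x :: map k d2 by rewrite -!map_comp.
rewrite (comp_cst _ _ (esym (map_comp _ _ _)) (esym (map_comp _ _ _))
  (esym (map_comp _ _ _)) q1 q2) !cst_trans.
by congr (comp _ _ _ _); apply: cst_irr.
Qed.

Definition compMor : cycMor C E :=
  CycMor compmor_id compmor_act compmor_comp.

End CompMor.

Lemma compMor1 (C D : cycOperad) (f : cycMor C D) : compMor f (idMor C) = f.
Proof.
apply: cycMor_eq => //= c x e; rewrite /compmor_op /= /idmor_op fop_cst.
by rewrite !cst_trans cst_id.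
Qed.

Lemma comp1Mor (C D : cycOperad) (f : cycMor C D) : compMor (idMor D) f = f.
Proof.
by apply: cycMor_eq => //= c x e; rewrite /compmor_op /= /idmor_op !cst_trans cst_id.
Qed.

Lemma compMorA (B C D E : cycOperad) (h : cycMor D E) (g : cycMor C D)
    (f : cycMor B C) :
  compMor h (compMor g f) = compMor (compMor h g) f.
Proof.
apply: cycMor_eq => //= c x e; rewrite /compmor_op /= /compmor_op fop_cst.
by rewrite !cst_trans; apply: cst_irr.
Qed.

(** * Unrooted trees and the cyclic operads they generate *)

(* The vertices and edges of a tree, and its incidence relation; the input
   vertices are left implicit: an edge adjacent to [k] vertices has [2 - k] of
   its ends in the set of input vertices.  The incidence graph is the
   barycentric subdivision of the tree (without the input vertices), and simple
   connectedness is expressed by its being nonempty, connected and without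
   simple cycles.  The tree with one vertex and no edge is included: it is the
   contraction of the tree with two vertices and one edge. *)
Definition incidence (V E : Type) (adj : V -> E -> bool) : rel (V + E) :=
  fun a b => match a, b with
  | inl v, inr e | inr e, inl v => adj v e
  | _, _ => false
  end.

Record tree := Tree {
  vertex : finType;
  edge : finType;
  adj : vertex -> edge -> bool;
  tree_ends : forall e : edge, #|[set v | adj v e]| <= 2;
  tree_nonempty : 0 < #|{: vertex + edge}|;
  tree_connected : forall a b : vertex + edge, connect (incidence adj) a b;
  tree_acyclic : forall p : seq (vertex + edge),
    ucycle (incidence adj) p -> size p <= 2
}.

Arguments adj {_} v e.

(* [c] is an edge joining the two vertices [x] and [y]. *)
Definition joins (T : tree) (c : edge T) (x y : vertex T) : bool :=
  [&& x != y, adj x c & adj y c].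

Definition inner (T : tree) (c : edge T) : bool :=
  [exists x, exists y, joins c x y].

Definition outer (T : tree) (u : vertex T) : bool :=
  #|[set c | inner c & adj u c]| <= 1.

Definition listing (T : tree) (v : vertex T) (l : seq (edge T)) : bool :=
  perm_eq l (enum (adj v)).

Section Free.
Variable T : tree.

Inductive term : seq (edge T) -> Type :=
| tgen (v : vertex T) (l : seq (edge T)) of listing v l : term l
| tid (e : edge T) : term [:: e; e]
| tact (n : nat) (s : 'S_n) (c : seq (edge T)) of size c = n & term c :
    term (permute s c)
| tcomp (c : seq (edge T)) (x : edge T) (d1 d2 : seq (edge T)) of
    term (rcons c x) & term (d1 ++ x :: d2) : term (d1 ++ c ++ d2).

Definition termData : cycData :=
  @CycData (edge T) term tact tid tcomp.

Definition gen_equivariant (R : opRel termData) : Prop :=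
  forall (v : vertex T) (l : seq (edge T)) (n : nat) (s : 'S_n)
    (h : size l = n) (hl : listing v l) (hl' : listing v (permute s l)),
  R _ (tact s h (tgen hl)) (tgen hl').

Record congruence (R : opRel termData) : Prop := Congruence {
  cg_refl : forall c (x : term c), R c x x;
  cg_sym : forall c (x y : term c), R c x y -> R c y x;
  cg_trans : forall c (x y z : term c), R c x y -> R c y z -> R c x z;
  cg_act : forall n (s : 'S_n) c (h : size c = n) (x y : term c),
    R c x y -> R _ (tact s h x) (tact s h y);
  cg_comp : forall c x d1 d2 (u u' : term (rcons c x))
      (v v' : term (d1 ++ x :: d2)),
    R _ u u' -> R _ v v' -> R _ (tcomp u v) (tcomp u' v')
}.

Definition term_eq : opRel termData := fun c x y =>
  forall R : opRel termData,
    congruence R -> cycLaws R -> gen_equivariant R -> R c x y.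

Lemma term_eq_congruence : congruence term_eq.
Proof.
split.
- by move=> c x R cR lR gR; apply: (cg_refl cR).
- by move=> c x y H R cR lR gR; apply: (cg_sym cR); apply: H.
- by move=> c x y z H H' R cR lR gR; apply: (cg_trans cR); [apply: H|apply: H'].
- by move=> n s c h x y H R cR lR gR; apply: (cg_act cR); apply: H.
- by move=> c x d1 d2 u u' v v' H H' R cR lR gR;
     apply: (cg_comp cR); [apply: H|apply: H'].
Qed.

Lemma term_eq_laws : cycLaws term_eq.
Proof.
split; intros; move=> R cR lR gR.
- exact: (law_act1 lR).
- exact: (law_actM lR).
- exact: (law_unitr lR).
- exact: (law_unitl lR).
- exact: (law_assoc lR).
- by apply: (law_equiv lR); eassumption.
- by apply: (law_exchange lR); eassumption.
Qed.

Lemma term_eq_gen : gen_equivariant term_eq.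
Proof. by move=> v l n s h hl hl' R cR lR gR; apply: gR. Qed.

Section Quotient.
Variable c : seq (edge T).

HB.instance Definition _ := gen_eqMixin (term c).
HB.instance Definition _ := gen_choiceMixin (term c).

Definition term_rel : rel (term c) := fun x y => `[< term_eq x y >].

Lemma term_rel_refl : reflexive term_rel.
Proof. by move=> x; apply/asboolP; apply: (cg_refl term_eq_congruence). Qed.

Lemma term_rel_sym : symmetric term_rel.
Proof.
by move=> x y; apply/asboolP/asboolP; apply: (cg_sym term_eq_congruence).
Qed.

Lemma term_rel_trans : transitive term_rel.
Proof.
move=> y x z /asboolP xy /asboolP yz; apply/asboolP.
exact: (cg_trans term_eq_congruence xy yz).
Qed.

Canonical term_equiv := EquivRel term_rel term_rel_refl term_rel_sym term_rel_trans.

Definition free_op : Type := {eq_quot term_equiv}.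

Definition cls (x : term c) : free_op := \pi_({eq_quot term_equiv}) x.
Definition cls_repr (u : free_op) : term c := repr (u : {eq_quot term_equiv}).

Lemma repK (u : free_op) : cls (cls_repr u) = u.
Proof. exact: reprK. Qed.

Lemma clsP (x y : term c) : cls x = cls y <-> term_eq x y.
Proof.
split; first by move/eqmodP/asboolP.
by move=> H; apply/eqmodP/asboolP.
Qed.

End Quotient.

Definition freeData : cycData := @CycData (edge T) free_op
  (fun n s c h u => cls (tact s h (cls_repr u)))
  (fun e => cls (tid e))
  (fun c x d1 d2 u v => cls (tcomp (cls_repr u) (cls_repr v))).

Lemma rep_cls c (x : term c) : term_eq (cls_repr (cls x)) x.
Proof. by apply/clsP; rewrite repK. Qed.

Definition clsd c (u : @op freeData c) (x : @op termData c) : Prop := u = cls x.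

Lemma clsd_surj c (u : @op freeData c) : exists x, clsd u x.
Proof. by exists (cls_repr u); rewrite /clsd repK. Qed.

Lemma clsd_act n (s : 'S_n) c (h : size c = n) (u : @op freeData c) x :
  clsd u x -> clsd (act s h u) (act (D := termData) s h x).
Proof.
by move=> ->; apply/clsP; apply: (cg_act term_eq_congruence); apply: rep_cls.
Qed.

Lemma clsd_comp c a d1 d2 (u : @op freeData (rcons c a))
    (v : @op freeData (d1 ++ a :: d2)) x y :
  clsd u x -> clsd v y -> clsd (comp d1 d2 u v) (comp (D := termData) d1 d2 x y).
Proof.
move=> -> ->; apply/clsP; apply: (cg_comp term_eq_congruence); exact: rep_cls.
Qed.

Lemma clsd_cst p q (e : p = q) (u : @op freeData p) x :
  clsd u x -> clsd (cst e u) (cst (D := termData) e x).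
Proof. by case: q / e. Qed.

Lemma clsd_eq c (u v : @op freeData c) x y :
  clsd u x -> clsd v y -> term_eq x y -> u = v.
Proof. by move=> -> -> H; apply/clsP. Qed.

Lemma free_laws : cycLaws (D := freeData) (fun _ x y => x = y).
Proof.
have L := term_eq_laws.
split.
- move=> n c h e u; have [x ux] := clsd_surj u.
  exact: (clsd_eq (clsd_cst e (clsd_act 1 h ux)) ux (law_act1 L h e x)).
- move=> n s t c h h' e u; have [x ux] := clsd_surj u.
  apply: (clsd_eq (clsd_cst e (clsd_act t h' (clsd_act s h ux)))
           (clsd_act (t * s) h ux)).
  exact: (law_actM L).
- move=> c a e u; have [x ux] := clsd_surj u.
  apply: (clsd_eq (clsd_cst e (clsd_comp (d1 := [::]) (d2 := [:: a]) ux erefl)) ux).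
  exact: (law_unitr L).
- move=> a d1 d2 u; have [x ux] := clsd_surj u.
  apply: (clsd_eq (clsd_comp (c := [:: a]) erefl ux) ux).
  exact: (law_unitl L).
- move=> c x d1 d2 y g1 g2 u v w e1 e2 e3 e4.
  have [u' Hu] := clsd_surj u; have [v' Hv] := clsd_surj v.
  have [w' Hw] := clsd_surj w.
  apply: (clsd_eq (clsd_comp (clsd_cst e1 (clsd_comp Hu Hv)) Hw)
    (clsd_cst e4 (clsd_comp Hu
      (clsd_cst e3 (clsd_comp (clsd_cst e2 Hv) Hw))))).
  exact: (law_assoc L).
- move=> f a l d1 d2 l' d1' d2' n1 n2 n3 s t r U Hs Ht Hr u v h1 h2 h3 e1 e2 e3.
  have [u' Hu] := clsd_surj u; have [v' Hv] := clsd_surj v.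
  apply: (clsd_eq
    (clsd_comp (clsd_cst e1 (clsd_act s h1 Hu)) (clsd_cst e2 (clsd_act t h2 Hv)))
    (clsd_cst e3 (clsd_act r h3 (clsd_comp Hu Hv)))).
  exact: (law_equiv L U Hs Ht Hr).
- move=> f a l d1 d2 d' l1' l2' n1 n2 n3 s t r U Hs Ht Hr u v h1 h2 h3 e1 e2 e3.
  have [u' Hu] := clsd_surj u; have [v' Hv] := clsd_surj v.
  apply: (clsd_eq
    (clsd_comp (clsd_cst e2 (clsd_act t h2 Hv)) (clsd_cst e1 (clsd_act s h1 Hu)))
    (clsd_cst e3 (clsd_act r h3 (clsd_comp Hu Hv)))).
  exact: (law_exchange L U Hs Ht Hr).
Qed.

(* The free cyclic operad [A(T)]: formal composites of the vertices of [T]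
   modulo the least congruence containing the axioms. *)
Definition treeOp : cycOperad := CycOperad free_laws.

Definition gen (v : vertex T) (l : seq (edge T)) (h : listing v l) :
  @op treeOp l := cls (tgen h).

End Free.

(** * The category of unrooted trees *)

(* [phi] sends the generator at [v] to the generator at [w]; in particular the
   edges of [v] are mapped bijectively onto those of [w]. *)
Definition maps_vertex (S T : tree) (phi : cycMor (treeOp S) (treeOp T))
    (v : vertex S) (w : vertex T) : Prop :=
  forall (l : seq (edge S)) (h : listing v l),
    exists h' : listing w (map (fcol phi) l), fop phi (gen h) = gen h'.

Definition tree_iso (S T : tree) (i : edge S -> edge T)
    (j : vertex S -> vertex T) : Prop :=
  [/\ bijective i, bijective j & forall v e, adj (j v) (i e) = adj v e].

(* [i] and [q] present [S] as [T/c], the contraction of the inner edge [c] with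
   end vertices [x] and [y]; the vertex [xy] of [S] is [q x = q y]. *)
Definition contraction (S T : tree) (c : edge T) (x y : vertex T)
    (i : edge S -> edge T) (q : vertex T -> vertex S) : Prop :=
  [/\ joins c x y,
      injective i /\ (forall e, (exists e', i e' = e) <-> e <> c),
      (forall w, exists v, q v = w) /\
      (forall v w, q v = q w <->
         v = w \/ (v = x /\ w = y) \/ (v = y /\ w = x)),
      forall v e, v <> x -> v <> y -> adj (q v) e = adj v (i e)
    & forall e, adj (q x) e = adj x (i e) || adj y (i e)].

(* [i] and [j] present [S] as [T/u], where [u] is an outer vertex of [T]. *)
Definition deletion (S T : tree) (u : vertex T)
    (i : edge S -> edge T) (j : vertex S -> vertex T) : Prop :=
  [/\ outer u,
      injective i /\ (forall e, (exists e', i e' = e) <-> ~~ adj u e || inner e),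
      injective j /\ (forall v, (exists v', j v' = v) <-> v <> u)
    & forall v e, adj (j v) (i e) = adj v e].

(* [p] and [j] present [S] as [T_c], where the edge [c] of [T] is subdivided
   into [c1] and [c2] by the new vertex [w]. *)
Definition subdivision (S T : tree) (c : edge T) (w : vertex S)
    (c1 c2 : edge S) (p : edge S -> edge T) (j : vertex T -> vertex S) : Prop :=
  [/\ [/\ c1 <> c2, p c1 = c, p c2 = c &
          forall e, adj w e = (e == c1) || (e == c2)],
      (forall e', exists e, p e = e') /\
      (forall e e', p e = p e' -> e = e' \/ p e = c),
      (forall e, p e = c -> e = c1 \/ e = c2),
      injective j /\ (forall v, (exists v', j v' = v) <-> v <> w)
    & forall v e', adj v e' <-> exists2 e, p e = e' & adj (j v) e].

Definition single_vertex (T : tree) : Prop := #|vertex T| = 1.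

(* [T] is the tree [eta]. *)
Definition is_eta (T : tree) : Prop := #|vertex T| = 0 /\ #|edge T| = 1.

Section Generators.
Variables (S T : tree) (phi : cycMor (treeOp S) (treeOp T)).

Definition induced_iso : Prop :=
  exists j : vertex S -> vertex T,
    tree_iso (fcol phi) j /\ forall v, maps_vertex phi v (j v).

(* The inner coface map [delta^c]: the generator [xy] is sent to the composite
   along [c] of the generators [x] and [y]. *)
Definition inner_coface (c : edge T) : Prop :=
  exists (x y : vertex T) (q : vertex T -> vertex S),
    [/\ contraction c x y (fcol phi) q,
        forall v, v <> x -> v <> y -> maps_vertex phi (q v) v
      & forall (l : seq (edge S)) (l1 l2 : seq (edge T))
          (h : listing (q x) l) (hx : listing x (rcons l1 c))
          (hy : listing y (c :: l2)) (e : map (fcol phi) l = [::] ++ l1 ++ l2),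
        cst e (fop phi (gen h)) =
        comp (D := treeOp T) [::] l2 (gen hx) (gen hy)].

Definition outer_coface : Prop :=
  (~ single_vertex T /\
   exists (u : vertex T) (j : vertex S -> vertex T),
     deletion u (fcol phi) j /\ forall v, maps_vertex phi v (j v))
  \/ (single_vertex T /\ is_eta S).

(* The codegeneracy map [sigma^c]: the generator [w] is sent to an identity. *)
Definition codegeneracy : Prop :=
  exists (c : edge T) (w : vertex S) (c1 c2 : edge S)
      (j : vertex T -> vertex S),
    [/\ subdivision c w c1 c2 (fcol phi) j,
        forall v, maps_vertex phi (j v) v
      & forall (h : listing w [:: c1; c2])
          (e : map (fcol phi) [:: c1; c2] = [:: c; c]),
        cst e (fop phi (gen h)) = idop (D := treeOp T) c].

End Generators.

(* The maps of the category of trees, as the maps they induce between the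
   cyclic operads generated by trees.  These do not exhaust the morphisms of
   cyclic operads. *)
Inductive is_tree_map :
    forall S T : tree, cycMor (treeOp S) (treeOp T) -> Prop :=
| tm_iso S T phi : induced_iso phi -> @is_tree_map S T phi
| tm_inner S T phi c : inner_coface phi c -> @is_tree_map S T phi
| tm_outer S T phi : outer_coface phi -> @is_tree_map S T phi
| tm_degen S T phi : codegeneracy phi -> @is_tree_map S T phi
| tm_comp R S T (psi : cycMor (treeOp S) (treeOp T))
    (phi : cycMor (treeOp R) (treeOp S)) :
    is_tree_map psi -> is_tree_map phi -> is_tree_map (compMor psi phi).

Lemma is_tree_map_id (T : tree) : is_tree_map (idMor (treeOp T)).
Proof.
apply: tm_iso; exists id; split; first by split=> //; exists id.
move=> v l h; have h' : listing v (map id l) by rewrite map_id.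
exists h'; rewrite /= /idmor_op.
case: _ / (esym (map_id l)) h' => h' /=.
by rewrite (Prop_irrelevance h h').
Qed.

Record tmap (S T : tree) := TMap {
  tmor :> cycMor (treeOp S) (treeOp T);
  tmapP : is_tree_map tmor
}.

Lemma tmap_eq (S T : tree) (f g : tmap S T) : tmor f = tmor g -> f = g.
Proof.
case: f g => f hf [g hg] /= E; case: g / E hg => hg.
by rewrite (Prop_irrelevance hf hg).
Qed.

Definition tid_map (T : tree) : tmap T T := TMap (is_tree_map_id T).

Definition tcomp_map (R S T : tree) (g : tmap S T) (f : tmap R S) : tmap R T :=
  TMap (tm_comp (tmapP g) (tmapP f)).

Lemma tcomp_map1 (S T : tree) (f : tmap S T) : tcomp_map f (tid_map S) = f.
Proof. by apply: tmap_eq; apply: compMor1. Qed.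

Lemma tcomp_1map (S T : tree) (f : tmap S T) : tcomp_map (tid_map T) f = f.
Proof. by apply: tmap_eq; apply: comp1Mor. Qed.

Lemma tcomp_mapA (Q R S T : tree) (h : tmap S T) (g : tmap R S) (f : tmap Q R) :
  tcomp_map h (tcomp_map g f) = tcomp_map (tcomp_map h g) f.
Proof. by apply: tmap_eq; apply: compMorA. Qed.

(** * Astroidal sets *)

Record astroidal := Astroidal {
  aob :> tree -> Type;
  amap : forall S T : tree, tmap S T -> aob T -> aob S;
  amap_id : forall (T : tree) (x : aob T), amap (tid_map T) x = x;
  amap_comp : forall (R S T : tree) (g : tmap S T) (f : tmap R S) (x : aob T),
    amap (tcomp_map g f) x = amap f (amap g x)
}.

Arguments amap _ {S T} _ _.

Record hom (X Y : astroidal) := Hom {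
  hmap : forall T : tree, X T -> Y T;
  hmap_nat : forall (S T : tree) (f : tmap S T) (x : X T),
    hmap (amap X f x) = amap Y f (hmap x)
}.

Arguments hmap {X Y} _ {T} _.

Lemma hom_comp_nat (X Y Z : astroidal) (b : hom Y Z) (a : hom X Y)
    (S T : tree) (f : tmap S T) (x : X T) :
  hmap b (hmap a (amap X f x)) = amap Z f (hmap b (hmap a x)).
Proof. by rewrite !hmap_nat. Qed.

Definition hom_comp (X Y Z : astroidal) (b : hom Y Z) (a : hom X Y) : hom X Z :=
  Hom (hom_comp_nat b a).

Definition isomorphic (X Y : astroidal) : Prop :=
  exists a : hom X Y, forall T : tree, bijective (@hmap X Y a T).

Definition representable (T : tree) : astroidal :=
  Astroidal (aob := fun S => tmap S T)
    (amap := fun R S f g => tcomp_map g f)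
    (fun S f => tcomp_map1 f)
    (fun Q R S g f h => tcomp_mapA h g f).

Record subrep (T : tree) := Subrep {
  smem :> forall S : tree, tmap S T -> Prop;
  smem_closed : forall (R S : tree) (g : tmap S T) (f : tmap R S),
    smem g -> smem (tcomp_map g f)
}.

Section SubrepAstroidal.
Variables (T : tree) (P : subrep T).

Definition sub_ob (S : tree) : Type := {g : tmap S T | P S g}.

Definition sub_map (R S : tree) (f : tmap R S) (g : sub_ob S) : sub_ob R :=
  exist _ (tcomp_map (sval g) f) (smem_closed f (svalP g)).

Lemma sub_ob_eq (S : tree) (g h : sub_ob S) : sval g = sval h -> g = h.
Proof.
case: g h => g Hg [h Hh] /= E; case: h / E Hh => Hh.
by rewrite (Prop_irrelevance Hg Hh).
Qed.

Lemma sub_map_id (S : tree) (g : sub_ob S) : sub_map (tid_map S) g = g.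
Proof. by apply: sub_ob_eq; apply: tcomp_map1. Qed.

Lemma sub_map_comp (Q R S : tree) (g : tmap R S) (f : tmap Q R) (h : sub_ob S) :
  sub_map (tcomp_map g f) h = sub_map f (sub_map g h).
Proof. by apply: sub_ob_eq; apply: tcomp_mapA. Qed.

Definition subrep_astroidal : astroidal := Astroidal sub_map_id sub_map_comp.

Definition subrep_incl : hom subrep_astroidal (representable T) :=
  @Hom subrep_astroidal (representable T) (fun S g => sval g) (fun R S f g => erefl).

(* Restriction along the inclusion into [A[T]]. *)
Definition restrict (X : astroidal) (b : hom (representable T) X) :
    hom subrep_astroidal X :=
  hom_comp b subrep_incl.

End SubrepAstroidal.

Arguments restrict {T} P {X} b.

(* [f] belongs to the image of [A[S] -> A[T]] given by [a : S -> T]. *)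
Definition in_image (R S T : tree) (a : tmap S T) (f : tmap R T) : Prop :=
  exists g : tmap R S, f = tcomp_map a g.

Lemma in_image_closed (Q R S T : tree) (a : tmap S T) (f : tmap R T)
    (g : tmap Q R) :
  in_image a f -> in_image a (tcomp_map f g).
Proof. by case=> h ->; exists (tcomp_map h g); rewrite tcomp_mapA. Qed.

(* The coface maps of [T] other than [delta^k]. *)
Definition coface_but (T : tree) (k : edge T) (S : tree) (a : tmap S T) : Prop :=
  outer_coface a \/ exists2 c, c <> k & inner_coface a c.

Definition horn_mem (T : tree) (k : edge T) (R : tree) (f : tmap R T) : Prop :=
  exists (S : tree) (a : tmap S T), coface_but k a /\ in_image a f.

Lemma horn_closed (T : tree) (k : edge T) (Q R : tree) (f : tmap R T)
    (g : tmap Q R) :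
  horn_mem k f -> horn_mem k (tcomp_map f g).
Proof.
by case=> S [a [ak af]]; exists S, a; split=> //; apply: in_image_closed.
Qed.

Definition horn (T : tree) (k : edge T) : subrep T := Subrep (@horn_closed T k).

(* [a] is the inclusion of the corolla [C_v]. *)
Definition corolla_incl (T : tree) (v : vertex T) (S : tree) (a : tmap S T) :
    Prop :=
  single_vertex S /\ exists w : vertex S,
    [/\ injective (fcol a), forall e, (exists e', fcol a e' = e) <-> adj v e
      & maps_vertex a w v].

Definition segal_core_mem (T : tree) (R : tree) (f : tmap R T) : Prop :=
  exists (v : vertex T) (S : tree) (a : tmap S T),
    corolla_incl v a /\ in_image a f.

Lemma segal_core_closed (T : tree) (Q R : tree) (f : tmap R T) (g : tmap Q R) :
  segal_core_mem f -> segal_core_mem (tcomp_map f g).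
Proof.
case=> v [S [a [av af]]]; exists v, S, a; split=> //.
exact: in_image_closed.
Qed.

Definition segal_core (T : tree) : subrep T := Subrep (@segal_core_closed T).

Definition segal_condition (X : astroidal) : Prop :=
  forall T : tree, 0 < #|vertex T| ->
    bijective (fun b : hom (representable T) X => restrict (segal_core T) b).

Definition strict_inner_kan (X : astroidal) : Prop :=
  forall (T : tree) (k : edge T), inner k ->
  forall a : hom (subrep_astroidal (horn k)) X,
    exists! b : hom (representable T) X, restrict (horn k) b = a.

(** * The nerve of a cyclic operad *)

Definition nerve (C : cycOperad) : astroidal :=
  Astroidal (aob := fun T => cycMor (treeOp T) C)
    (amap := fun S T f x => compMor x f)
    (fun T x => compMor1 x)
    (fun R S T g f x => compMorA x g f).

(* Main.v *)
(** Operations of A(T) may use a vertex several times, but tree maps use each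
    vertex at most once; morphisms from A(T) to the additive monoid N count these
    uses, and operations that use at most two distinct vertices once each are
    identities, generators or composites of two generators, up to permutation.

    Under either condition an element of X(T) is determined by its restrictions
    to the corollas of T: for the Kan condition by induction on the number of
    vertices, as inner horns contain all corollas. Two composable elements of X
    on corollas glue to an element on a tree with two vertices, unique by the
    above, and its restriction along the composite operation is their composite.
    For the axioms one restricts an element on a tree with at most three vertices
    along the two sides, which are equal operations of its free operad. X embeds
    in the nerve of the resulting cyclic operad C. An element y of the nerve lies
    in the image once its restrictions to the faces of a horn (by induction), or
    its values at the vertices (for the Segal condition), can be glued in X; the
    pieces are compatible because X embeds in the nerve. Conversely, elements of
    a nerve are determined by arbitrary compatible values at the generators,
    since A(T) is free, and this yields both conditions. *)

From mathcomp Require Import all_boot perm.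
From mathcomp Require Import boolp zify.
Require Import Defs.
Set Implicit Arguments.
Unset Strict Implicit.
Unset Printing Implicit Defensive.

(** * Laws of cyclic operads without transports *)

(** Two formal obstacles shape the development. Profiles that the axioms identify are only provably
    equal, so operations are packed with their profiles, and action and composition become
    relations, [IsAct] and [IsComp], in which no transport occurs. And freeness of A(S) produces
    operad morphisms, while each morphism to be used must be shown to be a composite of the
    generating tree maps. Hence restriction along an operation exists only for operations that come
    from corollas of the category, and evaluation is a relation, [ev].

    Maps from a subpresheaf of A[T] to X are obtained by prescribing, through a functional relation,
    which value belongs to which operation of A(T). An element of X(R) respecting the relation is
    unique, so naturality is automatic and only existence has to be checked.

    Gluing is required for two and three vertices only, since composition involves two vertices and
    associativity three. Under the Kan condition gluing on two vertices comes first, as it supplies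
    the composites that make the faces of a three-vertex horn compatible. *)

Section Permute.
Variable T : Type.
Implicit Types c : seq T.

Lemma permuteE (x0 : T) n (s : 'S_n) c : size c = n ->
  permute s c = [seq nth x0 c (s i) | i <- enum 'I_n].
Proof.
move=> h; rewrite /permute.
have E (i : 'I_n) : onth c (s i) = Some (nth x0 c (s i)).
  have lt : s i < size c by rewrite h.
  by have := odflt_onth x0 c (s i); rewrite -onthTE in lt; case: onth lt => //= y _ ->.
by elim: (enum _) => //= i r ->; rewrite E.
Qed.

Lemma permute_nil n (s : 'S_n) : permute s ([::] : seq T) = [::].
Proof. by rewrite /permute; elim: (enum 'I_n) => //= i r ->; rewrite onth0n. Qed.

Lemma size_permute n (s : 'S_n) c : size c = n -> size (permute s c) = n.
Proof.
case: c => [|x0 c] h; first by rewrite permute_nil.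
by rewrite (permuteE x0) // size_map size_enum_ord.
Qed.

Lemma permute1 n c : size c = n -> permute (1%g : 'S_n) c = c.
Proof.
case: c => [|x0 c] h; first by rewrite permute_nil.
apply: (@eq_from_nth _ x0); first by rewrite size_permute.
move=> i; rewrite size_permute // => ltin.
rewrite (permuteE x0) // (nth_map (Ordinal ltin)) ?size_enum_ord //.
by rewrite perm1 nth_enum_ord.
Qed.

Lemma nth_permute x0 n (s : 'S_n) c (i : 'I_n) : size c = n ->
  nth x0 (permute s c) i = nth x0 c (s i).
Proof.
move=> h; rewrite (permuteE x0) // (nth_map i) ?size_enum_ord //.
by rewrite nth_ord_enum.
Qed.

Lemma permuteM n (s t : 'S_n) c : size c = n ->
  permute t (permute s c) = permute (t * s)%g c.
Proof.
case: c => [|x0 c] h.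
  by rewrite !permute_nil.
apply: (@eq_from_nth _ x0); first by rewrite !size_permute // size_permute.
move=> i; rewrite !size_permute ?size_permute // => ltin.
by rewrite -[i]/(val (Ordinal ltin)) !nth_permute ?size_permute // permM.
Qed.
End Permute.

Section PermuteEq.
Variable T : eqType.
Implicit Types c : seq T.

Lemma perm_permute n (s : 'S_n) c : size c = n -> perm_eq (permute s c) c.
Proof.
case: c => [|x0 c] h; first by rewrite permute_nil.
have := permute1 h; rewrite !(permuteE x0 _ h) => E; rewrite -[X in perm_eq _ X]E.
under [X in perm_eq _ X]eq_map => i do rewrite perm1.
rewrite (map_comp (fun i : 'I_n => nth x0 (x0 :: c) i) s) perm_map //.
apply: uniq_perm; [|exact: enum_uniq|].
  by rewrite map_inj_uniq ?enum_uniq //; apply: perm_inj.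
move=> i; rewrite mem_enum; apply/mapP; exists ((s^-1)%g i); first by rewrite mem_enum.
by rewrite permKV.
Qed.

Lemma permuteP c c' n : size c = n -> perm_eq c c' ->
  exists s : 'S_n, permute s c = c'.
Proof.
move=> h pc; have h' : size c' = n by rewrite -(perm_size pc).
have := pc; rewrite perm_sym.
rewrite -[c]/(val (Tuple (introT eqP h))) => /tuple_permP [s E]; exists s.
rewrite E; case: c h {E} pc => [|x0 c] h pc.
  have n0 : n = 0 by rewrite -h.
  by rewrite permute_nil [RHS]size0nil // size_tuple.
rewrite (permuteE x0) //= /image_mem.
by apply/eq_map => i; rewrite (tnth_nth x0).
Qed.

(** Distinct entries record where each position goes. Listings of the edges of a vertex are
    duplicate free, so any two of them differ by exactly one permutation. *)
Lemma permute_inj n (s t : 'S_n) c : size c = n -> uniq c ->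
  permute s c = permute t c -> s = t.
Proof.
move=> h U E; apply/permP => i; apply: val_inj.
case: c h U E => [|x0 c] h U E; first by have := ltn_ord i; rewrite -[X in _ < X]h.
have := congr1 (fun r => nth x0 r i) E; rewrite /= !nth_permute // => /eqP.
by rewrite nth_uniq ?h // => /eqP.
Qed.
End PermuteEq.

(* The axioms [law_equiv] and [law_exchange] label the entries of a profile by
   natural numbers; any distinct labels will do. *)
Lemma relabel (C : Type) (E : eqType) (f : E -> C) a S : uniq (a :: S) ->
  exists (ix : E -> nat) (g : nat -> C),
    (forall q, {subset q <= a :: S} -> map f q = map g (map ix q)) /\ uniq (map ix (a :: S)).
Proof.
move=> U; exists (index^~ (a :: S)), (fun k => f (nth a (a :: S) k)); split=> [q sq|].
  by rewrite -map_comp; apply/eq_in_map => e /sq eS /=; rewrite nth_index.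
rewrite map_inj_in_uniq // => e e' eS eS' E1.
by rewrite -(nth_index a eS) E1 nth_index.
Qed.

Section Packed.
Variable D : cycData.

(** Operations together with their profiles: an equation between operations over provably equal
    profiles becomes a plain equality of packed operations, and [pkP] absorbs the transport. *)
Definition pop := {c : seq (col D) & op c}.
Definition pk (c : seq (col D)) (x : op c) : pop := existT _ c x.
Definition pr (U : pop) : seq (col D) := projT1 U.

Lemma pkP (p q : seq (col D)) (x : op p) (y : op q) :
  pk x = pk y <-> exists e : p = q, cst e x = y.
Proof.
split=> [E|[e <-]]; last by case: q / e y.
have e : p = q := congr1 (@pr) E.
case: q / e y E => y E; exists erefl => /=.
(* Generalising to arbitrary packed operations makes the equation eliminable; the equality of
   profiles that remains is trivial by proof irrelevance. *)
suff : forall U V (E : U = V) (e : pr U = pr V),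
    cst e (projT2 U) = projT2 V by move=> /(_ _ _ E erefl).
by move=> U V E0; case: V / E0 => e; rewrite cst_id.
Qed.

Lemma pk_inj (p : seq (col D)) (x y : op p) : pk x = pk y -> x = y.
Proof. by case/pkP => e; rewrite cst_id. Qed.

Lemma pk_cst (p q : seq (col D)) (e : p = q) (x : op p) : pk (cst e x) = pk x.
Proof. by case: q / e. Qed.

(** Relations rather than functions, because on packed operations the action requires a given
    length, and composition below requires a decomposition of both profiles. *)
Definition IsAct n (s : 'S_n) (U W : pop) : Prop :=
  exists c (h : size c = n) (x : op c), U = pk x /\ W = pk (act s h x).

Definition IsComp (c : seq (col D)) a d1 d2 (U V W : pop) : Prop :=
  exists (u : op (rcons c a)) (v : op (d1 ++ a :: d2)),
    [/\ U = pk u, V = pk v & W = pk (comp d1 d2 u v)].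

Lemma IsAct_fun n (s : 'S_n) U W W' : IsAct s U W -> IsAct s U W' -> W = W'.
Proof.
move=> [c [h [x [-> ->]]]] [c' [h' [x' [/pkP [e Ex] ->]]]].
case: c' / e h' x' Ex => h' x' <- /=.
by rewrite (Prop_irrelevance h h').
Qed.

Lemma IsAct_ex n (s : 'S_n) U : size (pr U) = n -> exists W, IsAct s U W.
Proof. by case: U => c x /= h; exists (pk (act s h x)), c, h, x. Qed.

Lemma IsAct_pr n (s : 'S_n) U W : IsAct s U W -> pr W = permute s (pr U).
Proof. by move=> [c [h [x [-> ->]]]]. Qed.

Lemma IsAct_size n (s : 'S_n) U W : IsAct s U W -> size (pr U) = n.
Proof. by move=> [c [h [x [-> _]]]]. Qed.

Lemma IsComp_fun c a d1 d2 U V W W' :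
  IsComp c a d1 d2 U V W -> IsComp c a d1 d2 U V W' -> W = W'.
Proof. by move=> [u [v [-> -> ->]]] [u' [v' [/pk_inj <- /pk_inj <- ->]]]. Qed.

Lemma IsComp_ex c a d1 d2 U V : pr U = rcons c a -> pr V = d1 ++ a :: d2 ->
  exists W, IsComp c a d1 d2 U V W.
Proof.
case: U V => p x [q y] /= e1 e2; exists (pk (comp d1 d2 (cst e1 x) (cst e2 y))).
by exists (cst e1 x), (cst e2 y); split=> //; rewrite pk_cst.
Qed.

Lemma IsComp_pr c a d1 d2 U V W : IsComp c a d1 d2 U V W ->
  [/\ pr U = rcons c a, pr V = d1 ++ a :: d2 & pr W = d1 ++ c ++ d2].
Proof. by move=> [u [v [-> -> ->]]]. Qed.

Definition pid (x : col D) : pop := pk (idop x).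
End Packed.

Section Laws.
Variable D : cycOperad.
Let L := claws D.
Implicit Types U V W : pop D.

Lemma lact1 n U W : IsAct (1%g : 'S_n) U W -> W = U.
Proof.
move=> [c [h [x [-> ->]]]]; apply/pkP; exists (permute1 h).
exact: (law_act1 L).
Qed.

Lemma lactM n (s t : 'S_n) U V W :
  IsAct s U V -> IsAct t V W -> IsAct (t * s)%g U W.
Proof.
move=> [c [h [x [-> ->]]]] [c' [h' [x' [/pkP [e Ex] ->]]]].
case: c' / e h' x' Ex => h' x' <- /=.
exists c, h, x; split=> //; apply/pkP; exists (permuteM s t h).
exact: (law_actM L).
Qed.

Lemma lactV n (s : 'S_n) U V : IsAct s U V -> IsAct (s^-1)%g V U.
Proof.
move=> a; have sV : size (pr V) = n by rewrite (IsAct_pr a) size_permute // (IsAct_size a).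
have [W b] := IsAct_ex (s^-1)%g sV.
by have := lactM a b; rewrite mulVg => /lact1 <-.
Qed.

Lemma lunitr c a U W : IsComp c a [::] [:: a] U (pid a) W -> W = U.
Proof.
move=> [u [v [-> /pk_inj <- ->]]]; apply/pkP.
have e : [::] ++ c ++ [:: a] = rcons c a by rewrite /= cats1.
by exists e; apply: (law_unitr L).
Qed.

Lemma lunitl a d1 d2 V W : IsComp [:: a] a d1 d2 (pid a) V W -> W = V.
Proof.
by move=> [u [v [/pk_inj <- -> ->]]]; congr pk; apply: (law_unitl L).
Qed.

Lemma lassoc c x d1 d2 y g1 g2 U V W P Q P' Q' :
  IsComp c x d1 (rcons d2 y) U V P ->
  IsComp (d1 ++ c ++ d2) y g1 g2 P W Q ->
  IsComp (d1 ++ x :: d2) y g1 g2 V W P' ->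
  IsComp c x (g1 ++ d1) (d2 ++ g2) U P' Q' -> Q = Q'.
Proof.
move=> [u [v [-> -> ->]]] [p [w [/pkP [e1 <-] -> ->]]].
move=> [v' [w' [/pkP [e2 <-] /pk_inj <- ->]]].
move=> [u' [p' [/pk_inj <- /pkP [e3 <-] ->]]].
have e4 : (g1 ++ d1) ++ c ++ (d2 ++ g2) = g1 ++ (d1 ++ c ++ d2) ++ g2.
  by rewrite -!catA.
by rewrite (law_assoc L _ _ _ _ e2 e3 e4) pk_cst.
Qed.

(** Labels from any [eqType] are allowed so that the edges of a tree can label themselves, with
    [f := id]. *)
Lemma lequiv (E : eqType) (f : E -> col D) a l d1 d2 l' d1' d2' n1 n2 n3
    (s : 'S_n1) (t : 'S_n2) (r : 'S_n3) U V W U' V' W' :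
  uniq (a :: d1 ++ l ++ d2) ->
  permute s (rcons l a) = rcons l' a ->
  permute t (d1 ++ a :: d2) = d1' ++ a :: d2' ->
  permute r (d1 ++ l ++ d2) = d1' ++ l' ++ d2' ->
  n3 = size (d1 ++ l ++ d2) ->
  IsAct s U U' -> IsAct t V V' ->
  IsComp (map f l) (f a) (map f d1) (map f d2) U V W ->
  IsComp (map f l') (f a) (map f d1') (map f d2') U' V' W' ->
  IsAct r W W'.
Proof.
move=> Un Hs Ht Hr h3 aU aV; have [ix [g [fg Un']]] := relabel f Un.
have sub : {subset d1' ++ l' ++ d2' <= a :: d1 ++ l ++ d2}.
  by move=> e; rewrite -Hr (perm_mem (perm_permute _ _)) // inE orbC => ->.
have [fa] : map f [:: a] = map g (map ix [:: a]) by apply: fg => e; rewrite !inE => ->.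
rewrite fa !fg; try by [move=> e e1; apply: sub; rewrite !mem_cat e1 ?orbT
  | move=> e e1; rewrite inE !mem_cat e1 ?orbT].
rewrite /= !map_cat in Un'.
move=> [u [v [EU EV ->]]]; subst U V.
case: aU => p [h1 [u1 [/pkP [e1 Eu] ->]]]; case: aV => q [h2 [v1 [/pkP [e2 Ev] ->]]].
case: p / e1 h1 u1 Eu => h1 u1 <-; case: q / e2 h2 v1 Ev => h2 v1 <- /=.
move=> [u2 [v2 [/pkP [e1 <-] /pkP [e2 <-] ->]]].
have Hs' : permute s (rcons (map ix l) (ix a)) = rcons (map ix l') (ix a).
  by rewrite -map_rcons -map_permute Hs map_rcons.
have Ht' : permute t (map ix d1 ++ ix a :: map ix d2) = map ix d1' ++ ix a :: map ix d2'.
  by rewrite -map_cons -map_cat -map_permute Ht map_cat.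
have Hr' : permute r (map ix d1 ++ map ix l ++ map ix d2) = map ix d1' ++ map ix l' ++ map ix d2'.
  by rewrite -!map_cat -map_permute Hr !map_cat.
have h : size (map g (map ix d1) ++ map g (map ix l) ++ map g (map ix d2)) = n3.
  by rewrite h3 !size_cat !size_map.
have e3 : permute r (map g (map ix d1) ++ map g (map ix l) ++ map g (map ix d2)) = map g (map ix d1') ++ map g (map ix l') ++ map g (map ix d2').
  by rewrite -!map_cat -!map_permute Hr !map_cat.
eexists; exists h, (comp _ _ u v); split=> //.
by rewrite (law_equiv L Un' Hs' Ht' Hr' u v h1 h2 h e1 e2 e3) pk_cst.
Qed.

Lemma lexchange (E : eqType) (f : E -> col D) a l d1 d2 d' l1' l2' n1 n2 n3
    (s : 'S_n1) (t : 'S_n2) (r : 'S_n3) U V W U' V' W' :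
  uniq (a :: d1 ++ l ++ d2) ->
  permute s (rcons l a) = l1' ++ a :: l2' ->
  permute t (d1 ++ a :: d2) = rcons d' a ->
  permute r (d1 ++ l ++ d2) = l1' ++ d' ++ l2' ->
  n3 = size (d1 ++ l ++ d2) ->
  IsAct s U U' -> IsAct t V V' ->
  IsComp (map f l) (f a) (map f d1) (map f d2) U V W ->
  IsComp (map f d') (f a) (map f l1') (map f l2') V' U' W' ->
  IsAct r W W'.
Proof.
move=> Un Hs Ht Hr h3 aU aV; have [ix [g [fg Un']]] := relabel f Un.
have sub : {subset l1' ++ d' ++ l2' <= a :: d1 ++ l ++ d2}.
  by move=> e; rewrite -Hr (perm_mem (perm_permute _ _)) // inE orbC => ->.
have [fa] : map f [:: a] = map g (map ix [:: a]) by apply: fg => e; rewrite !inE => ->.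
rewrite fa !fg; try by [move=> e e1; apply: sub; rewrite !mem_cat e1 ?orbT
  | move=> e e1; rewrite inE !mem_cat e1 ?orbT].
rewrite /= !map_cat in Un'.
move=> [u [v [EU EV ->]]]; subst U V.
case: aU => p [h1 [u1 [/pkP [e1 Eu] ->]]]; case: aV => q [h2 [v1 [/pkP [e2 Ev] ->]]].
case: p / e1 h1 u1 Eu => h1 u1 <-; case: q / e2 h2 v1 Ev => h2 v1 <- /=.
move=> [v2 [u2 [/pkP [e2 <-] /pkP [e1 <-] ->]]].
have Hs' : permute s (rcons (map ix l) (ix a)) = map ix l1' ++ ix a :: map ix l2'.
  by rewrite -map_rcons -map_permute Hs map_cat.
have Ht' : permute t (map ix d1 ++ ix a :: map ix d2) = rcons (map ix d') (ix a).
  by rewrite -map_cons -map_cat -map_permute Ht map_rcons.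
have Hr' : permute r (map ix d1 ++ map ix l ++ map ix d2) = map ix l1' ++ map ix d' ++ map ix l2'.
  by rewrite -!map_cat -map_permute Hr !map_cat.
have h : size (map g (map ix d1) ++ map g (map ix l) ++ map g (map ix d2)) = n3.
  by rewrite h3 !size_cat !size_map.
have e3 : permute r (map g (map ix d1) ++ map g (map ix l) ++ map g (map ix d2)) = map g (map ix l1') ++ map g (map ix d') ++ map g (map ix l2').
  by rewrite -!map_cat -!map_permute Hr !map_cat.
eexists; exists h, (comp _ _ u v); split=> //.
by rewrite (law_exchange L Un' Hs' Ht' Hr' u v h1 h2 h e1 e2 e3) pk_cst.
Qed.
End Laws.

Section Identities.
Variable D : cycOperad.

Lemma permute2 (s : 'S_2) :
  s = 1%g \/ forall (T : Type) (a b : T), permute s [:: a; b] = [:: b; a].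
Proof.
pose i0 : 'I_2 := ord0; pose i1 : 'I_2 := lift ord0 ord0.
have i01 (i : 'I_2) : i = i0 \/ i = i1.
  by case: i => [[|[|//]] lt]; [left|right]; apply: val_inj.
have [s0|s0] := i01 (s i0); [left|right=> T a b].
- have s1 : s i1 = i1.
    case: (i01 (s i1)) => // s1; have := perm_inj (etrans s1 (esym s0)).
    by move/(congr1 val).
  by apply/permP => i; rewrite perm1; case: (i01 i) => ->.
- have s1 : s i1 = i0.
    case: (i01 (s i1)) => // s1; have := perm_inj (etrans s1 (esym s0)).
    by move/(congr1 val).
  rewrite (permuteE a) // !enum_ordSl enum_ord0 /=.
  by rewrite -/i0 -/i1 s0 s1.
Qed.

(* Identities are symmetric: by [lexchange], swapping reverses composition, and
   an identity is neutral on both sides. *)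
Lemma lact_id n (s : 'S_n) (x : col D) W : IsAct s (pid x) W -> W = pid x.
Proof.
move=> aW; have := IsAct_size aW; rewrite /= => e2.
case: n / e2 s aW => s aW.
have [s1|sw] := permute2 s; first by rewrite s1 in aW; apply: lact1 aW.
have pW : pr W = [:: x; x] by rewrite (IsAct_pr aW) /= sw.
have aW' := lactV aW.
have sV : forall (T : Type) (a b : T), permute (s^-1)%g [:: a; b] = [:: b; a].
  by move=> T a b; rewrite -[in LHS](sw _ b a) permuteM // mulVg permute1.
have [W1 C1] := @IsComp_ex D [:: x] x [::] [:: x] (pid x) W erefl pW.
have eW1 := lunitl C1; subst W1.
(* Exchanging the factors of the composite of the identity with [W] gives the identity and [W]
   again, so [s] fixes [W]; as the inverse of [s] sends [W] to the identity, the two coincide. *)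
have := @lexchange D nat (fun=> x) 2 [:: 0] [::] [:: 1] [:: 1] [::] [:: 0] 2 2 2 s (s^-1)%g s
  (pid x) W W W (pid x) W.
by move=> /(_ erefl (sw _ _ _) (sV _ _ _) (sw _ _ _) erefl aW aW' C1 C1) /lactV /IsAct_fun /(_ aW').
Qed.

Lemma permute_rot (c : seq nat) b : exists r : 'S_(size (rcons c b)),
  permute r (rcons c b) = b :: c.
Proof. by apply: permuteP => //; rewrite perm_rcons. Qed.

(** [law_unitr] treats the first entry of the identity only. For the second entry the identity is
    swapped, which does not change it by [lact_id], and the composite is off by the permutation
    moving the last entry to the front. *)
Lemma lunitr' c (x : col D) U W : IsComp c x [:: x] [::] U (pid x) W ->
  exists n (s : 'S_n), IsAct s U W.
Proof.
move=> C.
have [pU _ _] := IsComp_pr C.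
have [W0 C0] := IsComp_ex pU (erefl : pr (pid x) = [::] ++ x :: [:: x]).
have E := lunitr C0; subst W0.
(* Labels below [m] name the entries of [c], [m] is the composed entry and [m.+1] the free entry of
   the identity; the default value of [nth] gives the last two the colour [x]. *)
pose m := size c; pose f k := nth x c k.
have mf : map f (iota 0 m) = c by apply/(@eq_from_nth _ x); rewrite ?size_map ?size_iota // => i lt; rewrite (nth_map 0) ?size_iota // nth_iota.
have fd k : m <= k -> f k = x by move=> mk; rewrite /f nth_default.
have [r Hr] := permute_rot (iota 0 m) m.+1.
have [s Hs] : exists s : 'S_2, permute s [:: m; m.+1] = [:: m.+1; m].
  by apply: permuteP => //; rewrite -[[:: m.+1; m]]/(rcons [:: m.+1] m) perm_sym perm_rcons.
have [V' aV] := @IsAct_ex _ 2 s (pid x) erefl.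
have E := lact_id aV; subst V'.
have [U' aU] := IsAct_ex (1%g : 'S_m.+1) (etrans (congr1 size pU) (size_rcons c x)).
have E := lact1 aU; subst U'.
exists _, r.
apply: (@lequiv D nat f m (iota 0 m) [::] [:: m.+1] (iota 0 m) [:: m.+1] [::] m.+1 _ _
  1%g s r U (pid x) U U (pid x) W _ _ _ _ _ aU aV) => //.
- rewrite /= mem_cat mem_iota /= add0n ltnn /= inE neq_ltn ltnSn /=.
  rewrite cat_uniq iota_uniq /= orbF andbT mem_iota add0n /=.
  by rewrite -leqNgt leqnSn.
- by rewrite permute1 // size_rcons size_iota.
- by rewrite /= cats1 cats0 Hr.
- by rewrite /= cats1.
- by rewrite mf /= !fd.
- by rewrite mf /= !fd.
Qed.

End Identities.

Section MorPacked.
Variables (C D : cycOperad) (f : cycMor C D).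

Definition pfop (U : pop C) : pop D := pk (fop f (projT2 U)).

Lemma pr_pfop U : pr (pfop U) = map (fcol f) (pr U).
Proof. by []. Qed.

Lemma pfop_id (x : col C) : pfop (pid x) = pid (fcol f x).
Proof. by rewrite /pfop fop_id. Qed.

Lemma pfop_act n (s : 'S_n) U W : IsAct s U W -> IsAct s (pfop U) (pfop W).
Proof.
move=> [c [h [x [-> ->]]]].
have h' : size (map (fcol f) c) = n by rewrite size_map.
exists (map (fcol f) c), h', (fop f x); split=> //.
by rewrite -(fop_act f h h' (map_permute _ _ _)) pk_cst.
Qed.

Lemma pfop_comp c a d1 d2 U V W : IsComp c a d1 d2 U V W ->
  IsComp (map (fcol f) c) (fcol f a) (map (fcol f) d1) (map (fcol f) d2)
    (pfop U) (pfop V) (pfop W).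
Proof.
move=> [u [v [-> -> ->]]].
have e1 := map_rcons (fcol f) c a.
have e2 := map_cat (fcol f) d1 (a :: d2).
have e3 : map (fcol f) (d1 ++ c ++ d2) = map (fcol f) d1 ++ map (fcol f) c ++ map (fcol f) d2.
  by rewrite !map_cat.
exists (cst e1 (fop f u)), (cst e2 (fop f v)); rewrite !pk_cst.
by rewrite -(fop_comp f u v e1 e2 e3) pk_cst.
Qed.

End MorPacked.

Lemma pfop_compMor (B C D : cycOperad) (g : cycMor C D) (f : cycMor B C) U :
  pfop (compMor g f) U = pfop g (pfop f U).
Proof. by rewrite /pfop /= /compmor_op pk_cst. Qed.

Lemma pfop_idMor (C : cycOperad) U : pfop (idMor C) U = U.
Proof. by case: U => c x; rewrite /pfop /= /idmor_op pk_cst. Qed.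

Lemma cycMor_ext (C D : cycOperad) (f g : cycMor C D) :
  (forall x, fcol f x = fcol g x) -> (forall U, pfop f U = pfop g U) -> f = g.
Proof.
move=> E0 E1; apply: cycMor_eq => // c x e.
by apply: pk_inj; rewrite pk_cst; apply: (E1 (pk x)).
Qed.

(** * Free cyclic operads of trees *)

Section FreeUniversal.
Variables (T : tree).
Notation A := (treeOp T).

Definition pg (v : vertex T) l (h : listing v l) : pop A := @pk A l (gen h).

Definition pcls (c : seq (edge T)) (t : term c) : pop A := @pk A c (cls t).

Lemma pg_eq v v' l l' (h : listing v l) (h' : listing v' l') :
  v = v' -> l = l' -> pg h = pg h'.
Proof.
by move=> Ev El; case: v' / Ev h' => h'; case: l' / El h' => h'; rewrite (Prop_irrelevance h h').
Qed.

Lemma cls_act n (s : 'S_n) (c : seq (edge T)) (h : size c = n) (t : term c) :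
  IsAct s (pcls t) (pcls (tact s h t)).
Proof.
exists c, h, (cls t); split=> //; congr (@pk A _ _); apply/clsP.
by apply: (cg_act (term_eq_congruence T)); apply: (cg_sym (term_eq_congruence T)); apply: rep_cls.
Qed.

Lemma cls_comp (c : seq (edge T)) a d1 d2 (u : term (rcons c a)) (v : term (d1 ++ a :: d2)) :
  @IsComp A c a d1 d2 (pcls u) (pcls v) (pcls (tcomp u v)).
Proof.
exists (cls u), (cls v); split=> //; congr (@pk A _ _); apply/clsP.
by apply: (cg_comp (term_eq_congruence T));
  apply: (cg_sym (term_eq_congruence T)); apply: rep_cls.
Qed.

(** Each operation is the class of a term, and the term constructors descend to the relations
    [IsAct] and [IsComp]. *)
Lemma op_ind (P : pop A -> Prop) :
  (forall v l (h : listing v l), P (pg h)) -> (forall e, P (pid (e : col A))) ->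
  (forall n (s : 'S_n) U W, IsAct s U W -> P U -> P W) ->
  (forall c a d1 d2 U V W, IsComp c a d1 d2 U V W -> P U -> P V -> P W) ->
  forall U, P U.
Proof.
move=> Pg Pi Pa Pc [c u]; rewrite -[u]repK; elim: {u}(cls_repr u) => /=.
- exact: Pg.
- exact: Pi.
- by move=> n s d h t; apply: Pa; apply: cls_act.
- by move=> d a d1 d2 u Pu v Pv; apply: (Pc _ _ _ _ _ _ _ (cls_comp u v)).
Qed.

Lemma gen_act (v : vertex T) l n (s : 'S_n) (h : listing v l) (h' : listing v (permute s l)) :
  size l = n -> IsAct s (pg h) (pg h').
Proof.
move=> hs; suff -> : pg h' = pcls (tact s hs (tgen h)) by apply: cls_act.
congr (@pk A _ _); apply/clsP; apply: (cg_sym (term_eq_congruence T)).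
exact: term_eq_gen.
Qed.

Lemma listing_permute (v : vertex T) l n (s : 'S_n) : size l = n -> listing v l ->
  listing v (permute s l).
Proof. by move=> hs; rewrite /listing; apply: perm_trans; apply: perm_permute. Qed.

Lemma listing_perm (v : vertex T) l l' : listing v l -> listing v l' ->
  exists s : 'S_(size l), permute s l = l'.
Proof.
move=> h h'; apply: permuteP => //; apply: perm_trans h _.
by rewrite perm_sym.
Qed.

Lemma gen_act' (v : vertex T) l l' n (s : 'S_n) (h : listing v l) (h' : listing v l') :
  size l = n -> permute s l = l' -> IsAct s (pg h) (pg h').
Proof. by move=> hs E; case: l' / E h' => h'; apply: gen_act. Qed.

Section Eval.
Variables (D : cycOperad) (fc : edge T -> col D).
Variable g : forall v l, listing v l -> op (map fc l).
Hypothesis geq : forall v l n (s : 'S_n) (h : listing v l) (h' : listing v (permute s l)),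
  size l = n -> IsAct s (pk (g h)) (pk (g h')).

Lemma map_cat2 d1 a d2 :
  map fc (d1 ++ a :: d2) = map fc d1 ++ fc a :: map fc d2.
Proof. by rewrite map_cat. Qed.

Lemma map_cat3 d1 c d2 :
  map fc d1 ++ map fc c ++ map fc d2 = map fc (d1 ++ c ++ d2).
Proof. by rewrite !map_cat. Qed.

Fixpoint teval c (t : term c) : op (map fc c) :=
  match t in term c return op (map fc c) with
  | tgen v l h => g h
  | tid e => idop (fc e)
  | tact n s c h t => cst (esym (map_permute fc s c))
      (act s (etrans (size_map fc c) h) (teval t))
  | tcomp c x d1 d2 u v => cst (map_cat3 d1 c d2)
      (comp (map fc d1) (map fc d2) (cst (map_rcons fc c x) (teval u))
        (cst (map_cat2 d1 x d2) (teval v)))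
  end.

Definition pe c (t : term c) : pop D := pk (teval t).

Lemma pe_cst p q (e : p = q) (t : term p) :
  pe (cst (D := termData T) e t) = pe t.
Proof. by case: q / e. Qed.

Lemma pe_act n (s : 'S_n) c (h : size c = n) (t : term c) :
  IsAct s (pe t) (pe (tact s h t)).
Proof.
rewrite /pe /= pk_cst.
by exists (map fc c), (etrans (size_map fc c) h), (teval t).
Qed.

Lemma pe_comp c x d1 d2 (u : term (rcons c x)) (v : term (d1 ++ x :: d2)) :
  IsComp (map fc c) (fc x) (map fc d1) (map fc d2) (pe u) (pe v) (pe (tcomp u v)).
Proof.
rewrite /pe /= pk_cst.
by exists (cst (map_rcons fc c x) (teval u)), (cst (map_cat2 d1 x d2) (teval v));
  rewrite !pk_cst.
Qed.

(** The kernel of evaluation. Since [term_eq] is the least congruence satisfying the laws and the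
    equivariance of generators, it is enough to verify these for the kernel in order to evaluate
    classes. *)
Definition evalR : opRel (termData T) := fun c t t' => teval t = teval t'.

Lemma evalR_pe c (t t' : term c) : pe t = pe t' -> evalR t t'.
Proof. exact: pk_inj. Qed.

Lemma evalR_congruence : congruence evalR.
Proof.
split=> //.
- by move=> c x y z; apply: etrans.
- by move=> n s c h x y E; rewrite /evalR /= E.
- by move=> c x d1 d2 u u' v v' Eu Ev; rewrite /evalR /= Eu Ev.
Qed.

Lemma evalR_gen : gen_equivariant evalR.
Proof.
move=> v l n s h hl hl'; apply: evalR_pe.
exact: IsAct_fun (pe_act s h (tgen hl)) (geq _ _ h).
Qed.

Lemma evalR_laws : cycLaws evalR.
Proof.
split.
- move=> n c h e x; apply: evalR_pe; rewrite pe_cst.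
  exact: lact1 (pe_act _ h x).
- move=> n s t c h h' e x; apply: evalR_pe; rewrite pe_cst.
  exact: IsAct_fun (lactM (pe_act s h x) (pe_act t h' _)) (pe_act _ h x).
- move=> c x e u; apply: evalR_pe; rewrite pe_cst.
  exact: lunitr (pe_comp (d1 := [::]) (d2 := [:: x]) u (tid x)).
- move=> x d1 d2 u; apply: evalR_pe.
  exact: lunitl (pe_comp (c := [:: x]) (tid x) u).
- move=> c x d1 d2 y g1 g2 u v w e1 e2 e3 e4; apply: evalR_pe; rewrite pe_cst.
  have C1 := pe_comp (d2 := rcons d2 y) u v.
  have C2 := pe_comp (cst (D := termData T) e1 (tcomp (d2 := rcons d2 y) u v)) w.
  have C3 := pe_comp (cst (D := termData T) e2 v) w.
  have C4 := pe_comp (d1 := g1 ++ d1) (d2 := d2 ++ g2) u (cst (D := termData T) e3 (tcomp (cst (D := termData T) e2 v) w)).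
  rewrite !pe_cst !map_cat ?map_rcons in C1 C2 C3 C4.
  exact: lassoc C1 C2 C3 C4.
- move=> f a l d1 d2 l' d1' d2' n1 n2 n3 s t r Un Hs Ht Hr u v h1 h2 h3 e1 e2 e3.
  apply: evalR_pe; rewrite pe_cst.
  have C1 := pe_comp (cst (D := termData T) e1 (tact s h1 u)) (cst (D := termData T) e2 (tact t h2 v)).
  have C2 := pe_comp u v.
  have C3 := pe_act r h3 (tcomp u v).
  rewrite !pe_cst in C1.
  have h : n3 = size (d1 ++ l ++ d2) by rewrite -h3 !size_cat !size_map.
  rewrite -!(map_comp fc f) in C1 C2.
  have := lequiv (f := fc \o f) Un Hs Ht Hr h (pe_act s h1 u) (pe_act t h2 v) C2 C1.
  by move=> /IsAct_fun /(_ C3).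
- move=> f a l d1 d2 d' l1' l2' n1 n2 n3 s t r Un Hs Ht Hr u v h1 h2 h3 e1 e2 e3.
  apply: evalR_pe; rewrite pe_cst.
  have C1 := pe_comp (cst (D := termData T) e2 (tact t h2 v)) (cst (D := termData T) e1 (tact s h1 u)).
  have C2 := pe_comp u v.
  have C3 := pe_act r h3 (tcomp u v).
  rewrite !pe_cst in C1.
  have h : n3 = size (d1 ++ l ++ d2) by rewrite -h3 !size_cat !size_map.
  rewrite -!(map_comp fc f) in C1 C2.
  have := lexchange (f := fc \o f) Un Hs Ht Hr h (pe_act s h1 u) (pe_act t h2 v) C2 C1.
  by move=> /IsAct_fun /(_ C3).
Qed.

Lemma teval_eq c (t t' : term c) : term_eq t t' -> teval t = teval t'.
Proof. by move=> /(_ _ evalR_congruence evalR_laws evalR_gen). Qed.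

Definition fev c (u : @op A c) : op (map fc c) := teval (cls_repr u).

Lemma fev_cls c (t : term c) : fev (cls t) = teval t.
Proof. by apply: teval_eq; apply: rep_cls. Qed.

Lemma fev_id x : fev (idop (D := A) x) = idop (fc x).
Proof. by rewrite fev_cls. Qed.

Lemma fev_act n (s : 'S_n) c (h : size c = n) (h' : size (map fc c) = n)
    (e : map fc (permute s c) = permute s (map fc c)) (x : @op A c) :
  cst e (fev (act (D := A) s h x)) = act s h' (fev x).
Proof.
apply: pk_inj; rewrite pk_cst fev_cls; apply: IsAct_fun (pe_act s h _) _.
by exists (map fc c), h', (fev x).
Qed.

Lemma fev_comp c x d1 d2 (u : @op A (rcons c x)) (v : @op A (d1 ++ x :: d2))
  (e1 : map fc (rcons c x) = rcons (map fc c) (fc x))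
  (e2 : map fc (d1 ++ x :: d2) = map fc d1 ++ fc x :: map fc d2)
  (e3 : map fc (d1 ++ c ++ d2) = map fc d1 ++ map fc c ++ map fc d2) :
  cst e3 (fev (comp (D := A) d1 d2 u v)) =
  comp (map fc d1) (map fc d2) (cst e1 (fev u)) (cst e2 (fev v)).
Proof.
apply: pk_inj; rewrite pk_cst fev_cls; apply: IsComp_fun (pe_comp _ _) _.
by exists (cst e1 (fev u)), (cst e2 (fev v)); rewrite !pk_cst.
Qed.

Definition freeMor : cycMor A D := CycMor fev_id fev_act fev_comp.

Lemma freeMor_gen v l (h : listing v l) : pfop freeMor (pg h) = pk (g h).
Proof. by rewrite /pfop /= fev_cls. Qed.
End Eval.

Lemma listing_enum (v : vertex T) : listing v (enum (adj v)).
Proof. exact: perm_refl. Qed.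

Lemma listing_uniq (v : vertex T) l : listing v l -> uniq l.
Proof. by move=> h; rewrite (perm_uniq h) enum_uniq. Qed.

Lemma mem_listing (v : vertex T) l : listing v l -> forall e, (e \in l) = adj v e.
Proof. by move=> h e; rewrite (perm_mem h) mem_enum. Qed.

Lemma listingP (v : vertex T) l : uniq l -> (forall e, (e \in l) = adj v e) ->
  listing v l.
Proof.
by move=> U M; apply: uniq_perm => //; rewrite ?enum_uniq // => e; rewrite mem_enum M.
Qed.

(* It suffices to give the value of a generator at one listing of its edges,
   since any other listing is obtained by a unique permutation. *)
Lemma free_ex (D : cycOperad) (fc : edge T -> col D)
    (L : vertex T -> seq (edge T)) (hL : forall v, listing v (L v)) (G : vertex T -> pop D) :
  (forall v, pr (G v) = map fc (L v)) ->
  exists f : cycMor A D, (forall e, fcol f e = fc e) /\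
    forall v, pfop f (pg (hL v)) = G v.
Proof.
move=> pG.
have ex v l (h : listing v l) : exists x : op (map fc l),
    forall s : 'S_(size (L v)), permute s (L v) = l -> IsAct s (G v) (pk x).
  have [s0 E0] := listing_perm (hL v) h.
  have sz : size (pr (G v)) = size (L v) by rewrite pG size_map.
  have [[p x] aW] := IsAct_ex s0 sz.
  have pW := IsAct_pr aW; rewrite pG -map_permute E0 /= in pW.
  exists (cst pW x) => s E; rewrite pk_cst.
  by rewrite (permute_inj _ (listing_uniq (hL v)) (etrans E (esym E0))).
pose g v l (h : listing v l) := sval (cid (ex v l h)).
have gP v l (h : listing v l) (s : 'S_(size (L v))) : permute s (L v) = l ->
    IsAct s (G v) (pk (g v l h)).
  by rewrite /g; case: (cid _) => x /=; apply.
have geq v l n (s : 'S_n) (h : listing v l) (h' : listing v (permute s l)) :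
    size l = n -> IsAct s (pk (g v l h)) (pk (g v _ h')).
  move=> sl; have sL : size (L v) = n by rewrite -sl; apply: perm_size; apply: perm_trans (hL v) _; rewrite perm_sym.
  case: n / sL s h' sl => s h' sl.
  have [s0 E0] := listing_perm (hL v) h.
  have a0 := gP _ _ h _ E0.
  have E1 : permute (s * s0)%g (L v) = permute s l by rewrite -E0 permuteM.
  have a1 := gP _ _ h' _ E1.
  have sg : size (pr (pk (g v l h))) = size (L v) by rewrite /= size_map.
  have [W aW] := IsAct_ex s sg.
  by rewrite (IsAct_fun a1 (lactM a0 aW)).
exists (freeMor geq); split=> // v; rewrite freeMor_gen.
have sL : size (pr (G v)) = size (L v) by rewrite pG size_map.
have := gP v _ (hL v) 1%g (permute1 erefl).
exact: lact1.
Qed.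

Lemma pfop_gen_listing (D : cycOperad) (f g : cycMor A D) v l l' (h : listing v l)
    (h' : listing v l') :
  pfop f (pg h) = pfop g (pg h) -> pfop f (pg h') = pfop g (pg h').
Proof.
move=> E; have [s Es] := listing_perm h h'.
have a := gen_act' h h' erefl Es.
have := pfop_act f a; rewrite E => b; exact: IsAct_fun b (pfop_act g a).
Qed.

Lemma tree_ext (D : cycOperad) (f g : cycMor A D) :
  (forall e, fcol f e = fcol g e) ->
  (forall v, exists l (h : listing v l), pfop f (pg h) = pfop g (pg h)) -> f = g.
Proof.
move=> E0 E1; apply: cycMor_ext => //; apply: op_ind.
- move=> v l h; have [l' [h' E]] := E1 v; exact: pfop_gen_listing E.
- by move=> e; rewrite !pfop_id E0.
- move=> n s U W a E; have := pfop_act f a; rewrite E => b.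
  exact: IsAct_fun b (pfop_act g a).
- move=> c a d1 d2 U V W C EU EV.
  have := pfop_comp f C; rewrite EU EV E0 !(eq_map E0) => C'.
  exact: IsComp_fun C' (pfop_comp g C).
Qed.

End FreeUniversal.

(** * Counting vertices *)

(* Morphisms to this cyclic operad count the occurrences of vertices in an operation. *)
Definition natData : cycData :=
  @CycData unit (fun=> nat) (fun _ _ _ _ m => m) (fun=> 0)
    (fun _ _ _ _ m n => m + n).

Lemma cst_nat (p q : seq (col natData)) (e : p = q) (m : @op natData p) :
  cst e m = m :> nat.
Proof. by case: q / e. Qed.

Lemma nat_laws : cycLaws (D := natData) (fun _ x y => x = y).
Proof.
split=> *; rewrite /= ?cst_nat /= ?cst_nat /= ?cst_nat ?addn0 ?add0n ?addnA //.
by rewrite addnC.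
Qed.

Definition natOp : cycOperad := CycOperad nat_laws.

Section Count.
Variables (T : tree).
Notation A := (treeOp T).

Section Weight.
Variable w : vertex T -> nat.

Lemma cnt_subproof (v : vertex T) l n (s : 'S_n) (h : listing v l)
    (h' : listing v (permute s l)) : size l = n ->
  IsAct s (pk (w v : @op natOp (map (fun=> tt) l)))
          (pk (w v : @op natOp (map (fun=> tt) (permute s l)))).
Proof.
move=> sl; have h1 : size (map (fun=> tt) l) = n by rewrite size_map.
exists (map (fun=> tt) l), h1, (w v); split=> //; apply/pkP.
by exists (map_permute _ _ _); rewrite cst_nat.
Qed.

Definition cntMor : cycMor A natOp :=
  @freeMor T natOp (fun=> tt) (fun v l _ => w v) cnt_subproof.

Definition cnt (U : pop A) : nat := projT2 (pfop cntMor U).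

Lemma cnt_gen (v : vertex T) l (h : listing v l) : cnt (pg h) = w v.
Proof. by rewrite /cnt freeMor_gen. Qed.

Lemma cnt_id (e : edge T) : cnt (pid (e : col A)) = 0.
Proof. by rewrite /cnt pfop_id. Qed.

Lemma cnt_act n (s : 'S_n) U W : IsAct s U W -> cnt W = cnt U.
Proof. by move/(pfop_act cntMor) => [c [h [x [E1 E2]]]]; rewrite /cnt E1 E2. Qed.

Lemma cnt_comp c a d1 d2 U V W : IsComp c a d1 d2 U V W -> cnt W = cnt U + cnt V.
Proof. by move/(pfop_comp cntMor) => [u [v [E1 E2 E3]]]; rewrite /cnt E1 E2 E3. Qed.
End Weight.

Definition cntv (v : vertex T) : pop A -> nat := cnt (fun v' => v' == v : nat).
Definition tot : pop A -> nat := cnt (fun=> 1).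

Lemma cnt_sum w U : cnt w U = \sum_v w v * cntv v U.
Proof.
move: U; apply: op_ind.
- move=> v l h; rewrite cnt_gen (bigD1 v) //= big1 => [|v' nv].
    by rewrite /cntv cnt_gen eqxx muln1 addn0.
  by rewrite /cntv cnt_gen eq_sym (negbTE nv) muln0.
- by move=> e; rewrite cnt_id big1 // => v _; rewrite /cntv cnt_id muln0.
- by move=> n s U W a IH; rewrite (cnt_act _ a) IH; apply: eq_bigr => v _; rewrite /cntv (cnt_act _ a).
- move=> c a d1 d2 U V W C IU IV; rewrite (cnt_comp _ C) IU IV -big_split.
  by apply: eq_bigr => v _; rewrite /cntv (cnt_comp _ C) mulnDr.
Qed.

Lemma tot_sum U : tot U = \sum_v cntv v U.
Proof. by rewrite /tot cnt_sum; apply: eq_bigr => v _; rewrite mul1n. Qed.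

(** Only identities can occur, and these are stable under composition by the unit laws and under
    permutation by [lact_id]. *)
Lemma tot0_id U : tot U = 0 -> exists e : edge T, U = pid (e : col A).
Proof.
move: U; apply: op_ind.
- by move=> v l h; rewrite /tot cnt_gen.
- by move=> e _; exists e.
- move=> n s U W a IH; rewrite /tot (cnt_act _ a) => /IH [e eU].
  by exists e; rewrite eU in a; apply: lact_id a.
- move=> c a d1 d2 U V W C IU IV; rewrite /tot (cnt_comp _ C) => /eqP.
  rewrite addn_eq0 => /andP [/eqP /IU [e eU] /eqP /IV [e' eV]].
  have [pU pV _] := IsComp_pr C; rewrite eU in pU C.
  have [ec ea] : c = [:: e] /\ a = e.
    by have /rcons_inj [<- <-] : rcons [:: e] e = rcons c a := pU.
  by subst c a; exists e'; rewrite (lunitl C) eV.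
Qed.

(** In a composite the counts of the factors add up to one, so one factor is an identity and the
    other is, by induction, a generator. Composing with an identity changes it at most by a
    permutation, which relists the generator. *)
Lemma tot1_gen U : tot U = 1 -> exists v l (h : listing v l), U = pg h.
Proof.
move: U; apply: op_ind.
- by move=> v l h _; exists v, l, h.
- by move=> e; rewrite /tot cnt_id.
- move=> n s U W a IH; rewrite /tot (cnt_act _ a) => /IH [v [l [h eU]]].
  rewrite eU in a; have sl : size l = n := IsAct_size a.
  exists v, (permute s l), (listing_permute s sl h).
  exact: IsAct_fun a (gen_act' _ _ sl erefl).
- move=> c a d1 d2 U V W C IU IV; rewrite /tot (cnt_comp _ C).
  have [pU pV _] := IsComp_pr C.
  move=> E; have [[EU EV]|[EU EV]] : (tot U = 0 /\ tot V = 1) \/ (tot U = 1 /\ tot V = 0).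
    move: E; rewrite -/(tot U) -/(tot V); case: (tot U) => [|[|m]]; first by left.
      by case: (tot V) => // _; right.
    by [].
  + have [e eU] := tot0_id EU; rewrite eU in pU C.
    have [ec ea] : c = [:: e] /\ a = e.
      by have /rcons_inj [<- <-] : rcons [:: e] e = rcons c a := pU.
    subst c a; rewrite (lunitl C); exact: IV EV.
  + have [v [l [h eU]]] := IU EU.
    have [e eV] := tot0_id EV; rewrite eV in pV C.
    (* The identity may be entered at either of its two entries, which calls for [lunitr] or
       [lunitr']. *)
    have [n [s aW]] : exists n (s : 'S_n), IsAct s U W.
      case: d1 pV C => [|b [|b' d1]] [<-] => [<- C|<- <- C|]; last by case: d1.
        by rewrite (lunitr C); exists (size (pr U)), 1%g; have [W' a1] := IsAct_ex (1%g : 'S_(size (pr U))) erefl; have E1 := lact1 a1; rewrite E1 in a1.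
      exact: lunitr' C.
    rewrite eU in aW; have sl : size l = n := IsAct_size aW.
    exists v, (permute s l), (listing_permute s sl h).
    exact: IsAct_fun aW (gen_act' _ _ sl erefl).
Qed.

End Count.

(** Following [f] by a counting morphism gives a morphism from A(S) to the monoid of natural
    numbers, hence again the count for some weight. *)
Lemma cnt_mor (S T : tree) (f : cycMor (treeOp S) (treeOp T)) (w : vertex T -> nat) U :
  cnt w (pfop f U) = cnt (fun v => cnt w (pfop f (pg (listing_enum v)))) U.
Proof.
move: U; apply: op_ind.
- move=> v l h; rewrite cnt_gen.
  have [s Es] := listing_perm (listing_enum v) h.
  by have := pfop_act f (gen_act' (listing_enum v) h erefl Es) => /cnt_act ->.
- by move=> e; rewrite pfop_id !cnt_id.
- by move=> n s U W a; rewrite (cnt_act _ (pfop_act f a)) (cnt_act _ a).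
- by move=> c a d1 d2 U V W C IU IV; rewrite (cnt_comp _ (pfop_comp f C)) (cnt_comp _ C) IU IV.
Qed.

(** * Combinatorics of trees *)

Lemma incidence_sym (V E : Type) (a : V -> E -> bool) : symmetric (incidence a).
Proof. by move=> [v|e] [v'|e']. Qed.

Section TreeFacts.
Variable T : tree.
Notation V := (vertex T).
Notation E := (edge T).
Notation inc := (incidence (@adj T)).

(** The part of the path from [n] to its end closes up to a cycle, which acyclicity allows only when
    it has two nodes. *)
Lemma path_nochord a p n : path inc a p -> uniq (a :: p) -> n \in a :: p ->
  inc (last a p) n -> exists2 p1, p = rcons p1 (last a p) & last a p1 = n.
Proof.
move=> P U /splitPl sp; case: sp P U => p1 p2 En; rewrite cat_path last_cat En.
move=> /andP [_ P2] U I.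
have : size (n :: p2) <= 2.
  apply: (@tree_acyclic T); apply/andP; split.
    by rewrite /= rcons_path P2.
  have: uniq (n :: p2).
    move: U; rewrite -cat_cons (lastI a p1) En cat_rcons cat_uniq.
    by move=> /and3P [].
  by [].
case: p2 P2 U I => [|z [|z' p2]] //= _ _ I; last by exists p1; rewrite ?cats1.
by case: n {En} I.
Qed.

Lemma two_common (x y : V) (e e' : E) : x != y -> adj x e -> adj y e ->
  adj x e' -> adj y e' -> e = e'.
Proof.
move=> xy xe ye xe' ye'; apply/eqP/negPn/negP => ee'.
suff H : ucycle inc [:: inl x; inr e; inl y; inr e'] by have := tree_acyclic H.
by rewrite /ucycle /= xe ye xe' ye' /= !inE /= negb_or xy ee'.
Qed.

Lemma adj_third (x y z : V) (e : E) : x != y -> adj x e -> adj y e ->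
  adj z e -> z = x \/ z = y.
Proof.
move=> xy xe ye ze.
have [->|zx] := eqVneq z x; first by left.
have [->|zy] := eqVneq z y; first by right.
have := tree_ends e; have := @subset_leq_card _ [set x; y; z] [set v | adj v e].
move=> H; have /H : [set x; y; z] \subset [set v | adj v e].
  by apply/subsetP => v; rewrite !inE => /orP [/orP [] | ] /eqP ->.
rewrite cardsU cards2 xy cards1 (_ : _ :&: _ = set0) ?cards0 => [H1|].
  by move/(leq_trans H1).
apply/setP => v; rewrite !inE; apply/negbTE/negP => /andP [/orP [] /eqP -> /eqP E1];
  by rewrite E1 eqxx in zx zy.
Qed.

Lemma joinsP (c : E) (x y : V) : reflect [/\ x != y, adj x c & adj y c] (joins c x y).
Proof. exact: and3P. Qed.

Lemma innerP (c : E) (u : V) : adj u c -> inner c -> exists y, joins c u y.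
Proof.
move=> uc /existsP [x /existsP [y /joinsP [xy xc yc]]].
have [E1|E1] := adj_third xy xc yc uc; subst u.
  by exists y; apply/joinsP.
by exists x; apply/joinsP; rewrite eq_sym.
Qed.

Lemma innerI (c : E) (x y : V) : joins c x y -> inner c.
Proof. by move=> H; apply/existsP; exists x; apply/existsP; exists y. Qed.

Lemma edge_vertex (v : V) (e : E) : exists v, adj v e.
Proof.
have /connectP [[|[w|//] p] //= /andP [we _] _] := tree_connected (inr e) (inl v).
by exists w.
Qed.

Lemma simple_path (a b : V + E) :
  exists2 p, path inc a p & uniq (a :: p) /\ last a p = b.
Proof.
have /connectP [p P ->] := tree_connected a b.
by case/shortenP: P => p' P' U _; exists p'.
Qed.

Lemma inner_at (u w : V) : u != w -> exists c y, joins c u y.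
Proof.
have [p P [U L]] := simple_path (inl u) (inl w).
case: p P U L => [|[z|e] [|[v|e'] p]] //=; try by rewrite andbF.
  by move=> _ _ [->]; rewrite eqxx.
move=> /and3P [ue ve _] /andP [Un _] _ _; exists e, v; apply/joinsP; split=> //.
by apply: contraNneq Un => ->; rewrite !inE eqxx.
Qed.

Lemma outer_ext n a p (w : V) : #|{: V + E}| - size p <= n ->
  path inc a p -> uniq (a :: p) -> last a p = inl w ->
  exists q (u : V), [/\ path inc a (p ++ q), uniq (a :: p ++ q),
    last a (p ++ q) = inl u & outer u].
Proof.
elim: n p w => [|n IH] p w sz P U L; have [ow|] := boolP (outer w);
  try by exists [::], w; rewrite cats0.
  have := max_card [in a :: p]; rewrite (card_uniqP U) /= => lt.
  by move: sz; rewrite leqn0 subn_eq0 => /(leq_trans lt); rewrite ltnn.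
rewrite /outer -ltnNge => /card_gt1P [e [e' []]].
rewrite !inE => /andP [ie we] /andP [ie' we'] ee'.
have {ee'} [e1 [ie1 we1 ne1]] : exists e1, [/\ inner e1, adj w e1 & inr e1 \notin a :: p].
  have [ine|ne] := boolP (inr e \in a :: p); last by exists e.
  have [ine'|ne'] := boolP (inr e' \in a :: p); last by exists e'.
  have [|p1 Ep Ea] := path_nochord P U ine; first by rewrite L.
  have [|p2 Ep' Ea'] := path_nochord P U ine'; first by rewrite L.
  have /rcons_inj [E12] := etrans (esym Ep) Ep'.
  by move: Ea'; rewrite -E12 Ea => -[E1]; rewrite E1 eqxx in ee'.
have [w' /joinsP [ww' _ w'e1]] := innerP we1 ie1.
pose p1 := p ++ [:: inr e1].
have P1 : path inc a p1 by rewrite cat_path P L /= we1.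
have L1 : last a p1 = inr e1 by rewrite last_cat.
have U1 : uniq (a :: p1) by rewrite -cat_cons cat_uniq U /= orbF ne1.
have ne2 : inl w' \notin a :: p1.
  apply/negP => iw'; have [|p2 Ep Ea] := path_nochord P1 U1 iw'.
    by rewrite L1.
  move: Ep; rewrite L1 /p1 cats1 => /rcons_inj [E12]; move: Ea; rewrite -E12 L => -[E1].
  by rewrite E1 eqxx in ww'.
pose p2 := p1 ++ [:: inl w'].
have [||||q [u [Pq Uq Lq ou]]] := IH p2 w'.
- rewrite /p2 /p1 !size_cat /= !addn1 !subnS; move: sz; case: (_ - _) => // m.
  by rewrite ltnS /= => /(leq_trans (leq_pred m)).
- by rewrite cat_path P1 L1 /= w'e1.
- by rewrite -cat_cons cat_uniq U1 /= orbF ne2.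
- by rewrite last_cat.
by exists ([:: inr e1; inl w'] ++ q), u; rewrite /p2 /p1 -!catA /= in Pq Uq Lq *.
Qed.

Lemma outer_avoid1 (x w : V) : w != x -> exists u : V, outer u /\ u != x.
Proof.
rewrite eq_sym => /inner_at [c [y /joinsP [xy xc yc]]].
have [|||q [u [_ U L ou]]] := @outer_ext _ (inl x) [:: inr c; inl y] y (leqnn _).
- by rewrite /= xc yc.
- by rewrite /= !inE /= xy.
- by [].
exists u; split=> //; apply/eqP => E1; subst u.
have : inl x \in [:: inr c; inl y] ++ q.
  by have := mem_last (inr c) (inl y :: q); rewrite /= in L *; rewrite L.
by case/andP: U => /negbTE ->.
Qed.

(** A proper extension of a simple path that already contains [x] and [y] ends away from both. The
    simple path from [x] to [w] either begins with [c], or its first step can be preceded by [y] and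
    [c]. *)
Lemma outer_avoid2 (c : E) (x y w : V) : joins c x y -> w != x -> w != y ->
  exists u : V, [/\ outer u, u != x & u != y].
Proof.
move=> /joinsP [xy xc yc] wx wy.
suff [a [b [q [P U L]]]] : exists a b q, [/\ path inc a (b ++ q), uniq (a :: b ++ q) &
   [/\ inl x \in a :: b, inl y \in a :: b & exists2 v : V, last (last a b) q = inl v & q != [::]]].
  case: L => xab yab [v Lv nq].
  have [|||q' [u [P' U' L' ou]]] := @outer_ext _ a (b ++ q) v (leqnn _) => //.
    by rewrite last_cat.
  have uq : inl u \in q ++ q'.
    move: L'; rewrite -catA !last_cat; case: q nq {P U Lv P' U'} => //= z q _ <-.
    by rewrite -last_cat; apply: mem_last.
  move: U'; rewrite -catA -cat_cons cat_uniq => /and3P [_ /hasPn H _].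
  by exists u; split=> //; apply: contraNneq (H _ uq) => ->.
have [p P [U L]] := simple_path (inl x) (inl w).
case: p P U L => [|[z|e] [|[v|e'] p]] //=; try by rewrite andbF.
  by move=> _ _ [E1]; rewrite E1 eqxx in wx.
move=> /and3P [xe ve P] U L; have [E1|ec] := eqVneq e c.
  subst e; have vx : v != x.
    by move: U; rewrite !inE => /andP [/norP [_ /norP [h _]] _]; rewrite eq_sym.
  have [E1|E1] := adj_third xy xc yc ve; first by rewrite E1 eqxx in vx.
  subst v; exists (inl x), [:: inr c; inl y], p; split=> //=; first by rewrite xc yc.
  split; rewrite ?inE ?eqxx ?orbT //; exists w => //.
  by apply: contraNneq wy => E1; move: L; rewrite E1 /= => -[->].
have vx : v != x.
  by move: U; rewrite !inE => /andP [/norP [_ /norP [h _]] _]; rewrite eq_sym.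
have vy : v != y.
  by apply: contraNneq ec => E1; subst v; apply/eqP; apply: (two_common xy).
exists (inl y), [:: inr c; inl x], [:: inr e; inl v]; split=> /=.
- by rewrite yc xc xe ve.
- rewrite !inE /= !(inj_eq (@inl_inj _ _)) !(inj_eq (@inr_inj _ _)).
  by rewrite (eq_sym y x) (eq_sym y v) (eq_sym x v) (eq_sym c e) (negbTE vy) (negbTE vx) (negbTE xy) (negbTE ec).
- by split; rewrite ?inE ?eqxx ?orbT //; exists v.
Qed.

Lemma listing_rem (v : V) e : adj v e ->
  listing v (e :: rem e (enum (adj v))) /\ listing v (rcons (rem e (enum (adj v))) e).
Proof.
move=> ve; have h : listing v (e :: rem e (enum (adj v))).
  by rewrite /listing perm_sym perm_to_rem // mem_enum.
by split=> //; apply: (perm_trans _ h); rewrite perm_rcons.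
Qed.

(** By [two_common] the vertices share no edge besides [c], so the profile of their composite has
    distinct entries. *)
Lemma listing_common (x y : V) c l d1 d2 : x != y ->
  listing x (rcons l c) -> listing y (d1 ++ c :: d2) -> uniq (c :: d1 ++ l ++ d2).
Proof.
move=> xy hx hy; have Ux := listing_uniq hx; have Uy := listing_uniq hy.
have xc : adj x c by rewrite -(mem_listing hx) mem_rcons mem_head.
have yc : adj y c by rewrite -(mem_listing hy) mem_cat mem_head orbT.
rewrite rcons_uniq in Ux; case/andP: Ux => cl Ul.
have Uy' : uniq (c :: d1 ++ d2) by rewrite (perm_uniq (permEl (perm_catCA [:: c] d1 d2))).
move: Uy'; rewrite cons_uniq => /andP [cd Ud].
have Dj : ~~ has (mem l) (d1 ++ d2).
  apply/hasPn => e ed; apply/negP => el0; have el : e \in l := el0.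
  have xe : adj x e by rewrite -(mem_listing hx) mem_rcons inE el orbT.
  have ye : adj y e.
    by rewrite -(mem_listing hy) mem_cat inE; move: ed; rewrite mem_cat => /orP [->|->]; rewrite ?orbT.
  by rewrite (two_common xy xe ye xc yc) (negbTE cl) in el.
rewrite (perm_uniq (_ : perm_eq _ (c :: l ++ d1 ++ d2))).
  by rewrite cons_uniq mem_cat (negbTE cl) (negbTE cd) cat_uniq Ul Dj Ud.
by rewrite perm_cons perm_catCA.
Qed.

End TreeFacts.

(** * A rank criterion for acyclicity *)

Section Acyclicity.
Variables (N : eqType) (e : rel N) (rank : N -> nat).
Hypothesis e_sym : symmetric e.
Hypothesis rank_neq : forall x y, e x y -> rank x != rank y.
Hypothesis rank_lower : forall x y z, e x y -> e x z -> rank y < rank x ->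
  rank z < rank x -> y = z.

(* A cycle would contain two neighbours of its node of largest rank. *)
Lemma acyclic_rank p : ucycle e p -> size p <= 2.
Proof.
move=> /andP [C U]; rewrite leqNgt; apply/negP => sz.
have [m mp mx] : exists2 m, m \in p & forall z, z \in p -> rank z <= rank m.
  case: p sz {C U} => // a p _; elim: p a => [|b p IH] a.
    by exists a; rewrite ?mem_head // => z; rewrite inE => /eqP ->.
  have [m mp mx] := IH b; have [le|le] := leqP (rank a) (rank m).
    exists m; first by rewrite inE mp orbT.
    by move=> z; rewrite inE => /orP [/eqP -> //|/mx].
  exists a; rewrite ?mem_head // => z; rewrite inE => /orP [/eqP -> //|/mx h].
  exact: leq_trans h (ltnW le).
have [i q Eq] := rot_to mp.
have Cq : path.cycle e (m :: q) by rewrite -Eq rot_cycle.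
have Uq : uniq (m :: q) by rewrite -Eq rot_uniq.
have sq : 2 < size (m :: q) by rewrite -Eq size_rot.
have mq z : z \in m :: q -> rank z <= rank m by rewrite -Eq mem_rot; apply: mx.
case: q {Eq} Cq Uq sq mq => // y q; case: (lastP q) => // {}q z Cq Uq _ mq.
have my : e m y by case/andP: Cq.
have mz : e m z by move: Cq; rewrite /= rcons_path last_rcons => /and3P [_ _]; rewrite e_sym.
have low x : x \in m :: y :: rcons q z -> e m x -> rank x < rank m.
  by move=> /mq le /rank_neq ne; rewrite ltn_neqAle le eq_sym ne.
have E1 : y = z.
  apply: (rank_lower my mz); apply: low => //.
    by rewrite !inE eqxx orbT.
  by rewrite !inE mem_rcons mem_head !orbT.
by move: Uq; rewrite E1 /= mem_rcons mem_head andbF.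
Qed.
End Acyclicity.

(** * Morphisms sending vertices to vertices *)

Section Etale.
Variables (S T : tree).
Implicit Types (i : edge S -> edge T) (j : vertex S -> vertex T).

(** A local bijection on the edges adjacent to each vertex, which is what freeness needs to send
    generators to generators. *)
Definition etale i j := forall v l, listing v l -> listing (j v) (map i l).

Lemma etale_ex i j : etale i j -> exists f : cycMor (treeOp S) (treeOp T),
  (forall e, fcol f e = i e) /\ forall v, maps_vertex f v (j v).
Proof.
move=> ij; have [f [fi fg]] := @free_ex S (treeOp T) i _ (@listing_enum S)
  (fun v => pg (ij v _ (listing_enum v))) (fun v => erefl).
exists f; split=> // v l h.
have h' : listing (j v) (map (fcol f) l) by rewrite (eq_map fi); exact: (ij v l h).
exists h'; apply: pk_inj; rewrite -/(pg h').
have [s Es] := listing_perm (listing_enum v) h.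
have a := pfop_act f (gen_act' (listing_enum v) h erefl Es).
rewrite fg in a; apply: (IsAct_fun a); apply: gen_act'; first by rewrite size_map.
by rewrite (eq_map fi) -map_permute Es.
Qed.

Lemma maps_vertex_pg (f : cycMor (treeOp S) (treeOp T)) v w l (h : listing v l) :
  maps_vertex f v w -> exists h' : listing w (map (fcol f) l), pfop f (pg h) = pg h'.
Proof. by move=> /(_ l h) [h' E]; exists h'; rewrite /pfop /= E. Qed.

(** Any other listing differs by a permutation, with which [f] commutes; one listing therefore
    decides. *)
Lemma maps_vertexI (f : cycMor (treeOp S) (treeOp T)) v w l l' (h : listing v l)
    (h' : listing w l') : pfop f (pg h) = pg h' -> maps_vertex f v w.
Proof.
move=> E m hm; have pE : map (fcol f) l = l' := congr1 (@pr _) E.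
have [s Es] := listing_perm h hm.
have E2 : map (fcol f) m = permute s l' by rewrite -pE -map_permute Es.
have hm' : listing w (map (fcol f) m).
  by rewrite E2; apply: (listing_permute _ _ h'); rewrite -pE size_map.
exists hm'; apply: pk_inj.
have a := pfop_act f (gen_act' h hm erefl Es); rewrite E in a.
by apply: (IsAct_fun a); apply: gen_act' => //; rewrite -pE size_map.
Qed.

Lemma maps_vertex_adj (f : cycMor (treeOp S) (treeOp T)) v w e :
  injective (fcol f) -> maps_vertex f v w -> adj w (fcol f e) = adj v e.
Proof.
move=> fi /(_ _ (listing_enum v)) [h _].
by rewrite -(mem_listing h) mem_map // mem_enum.
Qed.

End Etale.

(** * Deleting an outer vertex *)

Section Deletion.
Variables (T : tree) (u w : vertex T).
Hypothesis wu : w != u.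
Hypothesis ou : outer u.
Notation N := (vertex T + edge T)%type.

Definition delV := {v : vertex T | v != u}.
Definition delE := {e : edge T | ~~ adj u e || inner e}.
Definition delAdj (v : delV) (e : delE) := adj (val v) (val e).

Lemma del_ends (e : delE) : #|[set v | delAdj v e]| <= 2.
Proof.
rewrite -(card_imset _ val_inj); apply: leq_trans (tree_ends (val e)).
by apply: subset_leq_card; apply/subsetP => v /imsetP [v' + ->]; rewrite !inE.
Qed.

Lemma del_nonempty : 0 < #|{: delV + delE}|.
Proof. by apply/card_gt0P; exists (inl (exist _ w wu : delV)). Qed.

Definition delEmb (a : delV + delE) : N :=
  match a with inl v => inl (val v) | inr e => inr (val e) end.

Lemma delEmb_inj : injective delEmb.
Proof. by move=> [v|e] [v'|e'] //= [E1]; congr (_ _); apply: val_inj. Qed.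

Lemma delEmb_inc a b :
  incidence delAdj a b = incidence (@adj T) (delEmb a) (delEmb b).
Proof. by case: a b => [v|e] [v'|e']. Qed.

(* The deleted nodes are retracted to the inner edge at [u]. *)
Lemma del_connected (a b : delV + delE) : connect (incidence delAdj) a b.
Proof.
have [c [y J]] : exists c y, joins c u y by apply: (@inner_at _ u w); rewrite eq_sym.
have Pc : ~~ adj u c || inner c by rewrite (innerI J) orbT.
pose c0 : delE := exist _ c Pc.
pose r (n : N) : delV + delE :=
  match n with
  | inl v => if insub v is Some v' then inl v' else inr c0
  | inr e => if insub e is Some e' then inr e' else inr c0
  end.
have rE n : r (delEmb n) = n by case: n => [v|e] /=; rewrite valK.
have rI v e : adj v e -> connect (incidence delAdj) (r (inl v)) (r (inr e)).
  move=> ve; rewrite /r; case: insubP => [v' nv Ev|]; case: insubP => [e' ne Ee|ne].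
  - by apply: connect1; rewrite /= /delAdj Ev Ee.
  - case/norP: ne; rewrite negbK => ue; case/negP.
    by apply: (@innerI _ _ v u); apply/joinsP.
  - rewrite negbK => /eqP Ev; subst v.
    (* As [u] is outer, [c] is the only inner edge at [u], so a surviving edge at [u] can only be
       [c]. *)
    suff -> : e' = c0 by apply: connect0.
    apply: val_inj; rewrite Ee /=; rewrite ve /= in ne.
    move: ou; rewrite /outer => /card_le1_eqP; apply; rewrite inE ?ne //.
    by rewrite (innerI J); case/joinsP: J.
  - by rewrite connect0.
rewrite -[a]rE -[b]rE; have /connectP [p P ->] := tree_connected (delEmb a) (delEmb b).
elim: p (delEmb a) P => [|n p IH] m /=; first by rewrite connect0.
move=> /andP [mn /IH]; apply: connect_trans.
case: m n mn => [v|e] [v'|e'] //= ve; first exact: rI.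
by rewrite (sym_connect_sym (incidence_sym delAdj)); apply: rI.
Qed.
End Deletion.

Lemma inj_surj_bij (A B : Type) (f : A -> B) :
  injective f -> (forall y, exists x, f x = y) -> bijective f.
Proof.
move=> fI fS; exists (fun y => sval (cid (fS y))) => [x|y]; last by case: cid.
by apply: fI; case: cid.
Qed.

Section DeletionTree.
Variables (T : tree) (u w : vertex T).
Hypothesis wu : w != u.
Hypothesis ou : outer u.

Lemma del_acyclic (p : seq (delV u + delE u)) :
  ucycle (incidence (@delAdj T u)) p -> size p <= 2.
Proof.
move=> /andP [C U]; rewrite -(size_map (@delEmb T u)).
apply: tree_acyclic; rewrite /ucycle (map_inj_uniq (@delEmb_inj T u)) U andbT.
apply: homo_cycle C => a b; by rewrite delEmb_inc.
Qed.

Definition delTree : tree :=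
  Tree (@del_ends T u) (del_nonempty wu) (del_connected wu ou) del_acyclic.

(** A surviving vertex loses none of its edges, since an edge shared with [u] is inner and therefore
    kept. *)
Lemma del_etale : @etale delTree T val val.
Proof.
move=> v l h; apply: listingP; first by rewrite (map_inj_uniq val_inj) (listing_uniq h).
move=> e; have [/andP [Pe ve]|ne] := boolP ((~~ adj u e || inner e) && adj (val v) e).
  have -> : e = val (exist _ e Pe : delE u) by [].
  by rewrite (mem_map val_inj) (mem_listing h) /= ve.
rewrite negb_and in ne; have nve : adj (val v) e = false.
  apply/negbTE; case/orP: ne => // /norP [ue ie]; apply: contra ie => ve.
  apply: (@innerI _ _ (val v) u); apply/joinsP; split=> //; first exact: (valP v).
  by move: ue; rewrite negbK.
rewrite nve; apply/negP => /mapP [e' + Ee]; rewrite (mem_listing h) => ve'.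
by have : adj (val v) (val e') := ve'; rewrite -Ee nve.
Qed.

Lemma del_map : exists (f : tmap delTree T),
  [/\ outer_coface f, injective (fcol f) & forall v, maps_vertex f v (val v)].
Proof.
have [f [fi fm]] := etale_ex del_etale.
have fv : fcol f = val by apply/funext => e; apply: fi.
suff fo : outer_coface f.
  by exists (TMap (tm_outer fo)); split=> //=; rewrite fv; apply: val_inj.
left; split.
  rewrite /single_vertex => T1; have := card_le1_eqP (_ : #|vertex T| <= 1).
  by rewrite T1 => /(_ isT w u) E1; move: wu; rewrite E1 ?eqxx.
exists u, val; rewrite fv; split=> //; split=> //.
- split; first exact: val_inj.
  move=> e; split=> [[e' <-]|Pe]; first exact: (valP e').
  by exists (exist _ e Pe).
- split; first exact: val_inj.
  move=> v; split=> [[v' <-]|/eqP nv]; first by apply/eqP; apply: (valP v').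
  by exists (exist _ v nv).
Qed.

Lemma card_delV : #|vertex delTree| = #|vertex T|.-1.
Proof. by rewrite /= card_sig -(cardC1 u). Qed.

End DeletionTree.

Section Factor.
Variables (K S T : tree).
Variables (f : cycMor (treeOp S) (treeOp T)) (j : vertex S -> vertex T).
Variables (k : cycMor (treeOp K) (treeOp T)) (jk : vertex K -> vertex T).
Hypothesis fI : injective (fcol f).
Hypothesis fm : forall v, maps_vertex f v (j v).
Hypothesis km : forall v, maps_vertex k v (jk v).
Hypothesis jks : forall v, exists w, j w = jk v.
Variable v0 : vertex K.

(** Injectivity of [f] on edges allows the edge map of [k] to be lifted vertex by vertex; every edge
    of [K] is reached because [K] has a vertex. With an outer coface as [f], this moves a subtree
    into a smaller tree. *)
Lemma factor : exists (k' : cycMor (treeOp K) (treeOp S)) (jk' : vertex K -> vertex S),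
  [/\ k = compMor f k', forall v, maps_vertex k' v (jk' v) & forall v, j (jk' v) = jk v].
Proof.
pose jk' v := sval (cid (jks v)).
have jk'E v : j (jk' v) = jk v by rewrite /jk'; case: cid.
have ex e : exists e', fcol f e' = fcol k e.
  have [v ve] := edge_vertex v0 e.
  have [h _] := @fm (jk' v) _ (listing_enum (jk' v)).
  have [h' _] := @km v _ (listing_enum v).
  have : fcol k e \in map (fcol f) (enum (adj (jk' v))).
    by rewrite (mem_listing h) jk'E -(mem_listing h') map_f // mem_enum.
  by case/mapP => e' _ ->; exists e'.
pose i e := sval (cid (ex e)).
have iE e : fcol f (i e) = fcol k e by rewrite /i; case: cid.
have et : etale i jk'.
  move=> v l h; have [h' _] := @km v _ h; have [h2 _] := @fm (jk' v) _ (listing_enum (jk' v)).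
  have E1 : map (fcol f) (map i l) = map (fcol k) l.
    by rewrite -map_comp; apply: eq_map.
  apply: listingP.
    by rewrite -(map_inj_uniq fI) E1 (listing_uniq h').
  move=> e; rewrite -(mem_map fI) E1 (mem_listing h') -jk'E.
  by rewrite -(mem_listing h2) (mem_map fI) mem_enum.
have [k' [k'i k'm]] := etale_ex et.
exists k', jk'; split=> //.
apply: tree_ext => [e|v]; first by rewrite /= k'i iE.
exists _, (listing_enum v); rewrite pfop_compMor.
have [h1 E1] := maps_vertex_pg (listing_enum v) (k'm v).
have [h2 E2] := maps_vertex_pg h1 (@fm (jk' v)).
have [h3 E3] := maps_vertex_pg (listing_enum v) (@km v).
rewrite E1 E2 E3.
have EL : map (fcol k) (enum (adj v)) = map (fcol f) (map (fcol k') (enum (adj v))).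
  by rewrite -map_comp; apply: eq_map => e /=; rewrite k'i iE.
move: h2 h3 {E2 E3}; rewrite EL jk'E => h2 h3.
by rewrite (Prop_irrelevance h2 h3).
Qed.
End Factor.

Lemma iso_is_tree_map (S T : tree) (f : cycMor (treeOp S) (treeOp T)) j (v0 : vertex S) :
  injective (fcol f) -> injective j -> (forall v, maps_vertex f v (j v)) ->
  (forall v, exists w, j w = v) -> is_tree_map f.
Proof.
move=> fI jI fm jS; apply: tm_iso; exists j; split=> //; split.
- apply: inj_surj_bij => // e; have [v ve] := edge_vertex (j v0) e.
  have [w Ew] := jS v; have [h _] := fm w _ (listing_enum w).
  have : e \in map (fcol f) (enum (adj w)) by rewrite (mem_listing h) Ew.
  by case/mapP => e' _ ->; exists e'.
- exact: inj_surj_bij.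
- by move=> v e; apply: maps_vertex_adj.
Qed.

(** While [T] has a vertex outside the image, some outer vertex lies outside it too ([outer_avoid1],
    [outer_avoid2]); deleting it factors the map through an outer coface from a smaller tree. When
    no vertex is left over, the map is an isomorphism. *)
Lemma incl_is_tree_map n (K T : tree) (k : cycMor (treeOp K) (treeOp T))
    (jk : vertex K -> vertex T) (x y : vertex K) : #|vertex T| <= n ->
  injective (fcol k) -> injective jk -> (forall v, maps_vertex k v (jk v)) ->
  (x = y \/ exists c, joins c x y) -> (forall v, v = x \/ v = y) ->
  is_tree_map k.
Proof.
elim: n T k jk => [|n IH] T k jk Tn kI jI km xy Vxy.
  have : 0 < #|vertex T| by apply/card_gt0P; exists (jk x).
  by rewrite ltnNge Tn.
have [allV|] := pselect (forall v, v = jk x \/ v = jk y).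
  apply: (iso_is_tree_map x kI jI km) => v.
  by case: (allV v) => ->; [exists x|exists y].
move=> /existsNP [w /not_orP [/eqP wx /eqP wy]].
have [u [ou ux uy]] : exists u, [/\ outer u, u != jk x & u != jk y].
  case: xy => [E1|[c /joinsP [nxy xc yc]]].
    have [u [ou ux]] := outer_avoid1 wx; exists u; split=> //; by rewrite -E1.
  apply: (@outer_avoid2 _ (fcol k c) _ _ w) => //; apply/joinsP; split.
  - by rewrite (inj_eq jI).
  - by rewrite (maps_vertex_adj _ kI (km x)).
  - by rewrite (maps_vertex_adj _ kI (km y)).
rewrite eq_sym in ux; have [f [fo fI fm]] := del_map ux ou.
have [|k' [jk' [kE k'm jk'E]]] := factor fI fm km _ x.
  move=> v; have nv : jk v != u by case: (Vxy v) => ->; rewrite // eq_sym.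
  by exists (exist _ (jk v) nv).
rewrite kE; apply: tm_comp; first exact: tmapP.
apply: (IH _ k' jk') => //.
- rewrite card_delV; move: Tn; case: #|_| => //.
- by move=> e e' E1; apply: kI; rewrite kE /= E1.
- by move=> v v' E1; apply: jI; rewrite -!jk'E E1.
Qed.

(** * Star-shaped trees *)

Section Star.
Variables (I E : finType) (Y : pred E) (X : I -> pred E) (link : I -> E).
Hypothesis XI : forall i i' e, X i e -> X i' e -> i = i'.
Hypothesis linkX : forall i, X i (link i).
Hypothesis linkY : forall i, Y (link i).
Hypothesis linkU : forall i e, X i e -> Y e -> e = link i.
Hypothesis cover : forall e, Y e \/ exists i, X i e.

(** [None] is the centre and [I] indexes its neighbours. With no, one or two neighbours this yields
    the corollas and the trees with two and three vertices. *)
Definition starAdj (v : option I) (e : E) : bool :=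
  if v is Some i then X i e else Y e.

Lemma star_ends e : #|[set v | starAdj v e]| <= 2.
Proof.
have [[i Xi]|nX] := pselect (exists i, X i e).
  apply: leq_trans (_ : #|[set None; Some i]| <= 2).
    apply: subset_leq_card; apply/subsetP => -[i'|]; rewrite !inE //= => Xi'.
    by rewrite (XI Xi Xi') eqxx.
  by rewrite cards2.
apply: leq_trans (_ : #|[set (None : option I)]| <= 2); last by rewrite cards1.
apply: subset_leq_card; apply/subsetP => -[i'|]; rewrite !inE //= => Xi'.
by case: nX; exists i'.
Qed.

Lemma star_nonempty : 0 < #|{: option I + E}|.
Proof. by apply/card_gt0P; exists (inl None). Qed.

Lemma star_connected (a b : option I + E) : connect (incidence starAdj) a b.
Proof.
have sym := sym_connect_sym (incidence_sym starAdj).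
have rV i : connect (incidence starAdj) (inl None) (inl (Some i)).
  apply: (@connect_trans _ _ (inr (link i))); apply: connect1 => /=; first exact: linkY.
  exact: linkX.
have r a' : connect (incidence starAdj) (inl None) a'.
  case: a' => [[i|]|e] //; case: (cover e) => [Ye|[i Xi]]; first exact: connect1.
  by apply: (connect_trans (rV i)); apply: connect1.
by apply: (@connect_trans _ _ (inl None)); rewrite // sym.
Qed.

(** The distance from the centre in the incidence graph. *)
Definition star_rank (a : option I + E) : nat :=
  match a with
  | inl None => 0
  | inl (Some _) => 2
  | inr e => if Y e then 1 else 3
  end.

Lemma star_acyclic (p : seq (option I + E)) :
  ucycle (incidence starAdj) p -> size p <= 2.
Proof.
apply: (@acyclic_rank _ _ star_rank (incidence_sym starAdj)).
- by move=> [[i|]|e] [[i'|]|e'] //= H; rewrite ?H //; case: (Y _).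
- move=> [[i|]|e] [[i1|]|e1] [[i2|]|e2] //=; try by case: (Y _).
  + by move=> X1 X2; case Y1: (Y e1) => // _; case Y2: (Y e2) => // _;
      rewrite (linkU X1 Y1) (linkU X2 Y2).
  + by move=> X1 X2 _ _; rewrite (XI X1 X2).
Qed.

Definition starTree : tree := Tree star_ends star_nonempty star_connected star_acyclic.
End Star.

(** * Corollas and trees with two or three vertices *)

Lemma eta_ends (e : unit) : #|[set v : void | false]| <= 2.
Proof. by rewrite (leq_trans (max_card _)) // card_void. Qed.

Lemma eta_nonempty : 0 < #|{: void + unit}|.
Proof. by apply/card_gt0P; exists (inr tt). Qed.

Lemma eta_connected (a b : void + unit) :
  connect (incidence (fun (v : void) (e : unit) => false)) a b.
Proof. by case: a b => [[]|[]] [[]|[]]. Qed.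

Lemma eta_acyclic (p : seq (void + unit)) :
  ucycle (incidence (fun (v : void) (e : unit) => false)) p -> size p <= 2.
Proof.
move=> /andP [_ /card_uniqP <-]; apply: (leq_trans (max_card _)).
by rewrite card_sum card_void card_unit.
Qed.

Definition eta : tree := Tree eta_ends eta_nonempty eta_connected eta_acyclic.

Definition Cor (n : nat) : tree.
Proof.
refine (@starTree void 'I_n predT (fun _ => pred0) (fun v : void => match v with end) _ _ _ _ _);
  by [move=> [] | left].
Defined.

Definition cv n : vertex (Cor n) := None.

Lemma cvE n (v : vertex (Cor n)) : v = cv n.
Proof. by case: v => [[]|]. Qed.

Lemma cor_listing n : listing (cv n) (enum 'I_n).
Proof. by apply: listingP => [|e]; rewrite ?enum_uniq // mem_enum. Qed.

(** The universal operation with [n] entries: a morphism out of A(Cor n) is determined by its image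
    ([cor_ext]), which can be any operation with [n] entries ([cor_free]). *)
Definition gcor n : pop (treeOp (Cor n)) := pg (cor_listing n).

Lemma cor_ext n (D : cycOperad) (f g : cycMor (treeOp (Cor n)) D) :
  pfop f (gcor n) = pfop g (gcor n) -> f = g.
Proof.
move=> E; apply: tree_ext => [e|v].
  have /eq_in_map := congr1 (@pr _) E; apply; exact: mem_enum.
by rewrite (cvE v); exists _, (cor_listing n).
Qed.

Lemma enum_tnth (A : Type) (l : seq A) :
  map (tnth (in_tuple l)) (enum 'I_(size l)) = l.
Proof. by rewrite map_tnth_enum. Qed.

Lemma cor_free n (D : cycOperad) (U : pop D) : size (pr U) = n ->
  exists f : cycMor (treeOp (Cor n)) D, pfop f (gcor n) = U.
Proof.
case: n /; have H (v : vertex (Cor (size (pr U)))) : listing v (enum 'I_(size (pr U))) by rewrite (cvE v); exact: cor_listing.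
have [|f [_ fU]] := @free_ex (Cor (size (pr U))) D (tnth (in_tuple (pr U))) (fun=> enum 'I_(size (pr U))) H (fun=> U).
  by move=> v; rewrite enum_tnth.
by exists f; apply: etrans (fU (cv _)); congr pfop; apply: pg_eq.
Qed.

Lemma card_cor n : #|vertex (Cor n)| = 1.
Proof. by rewrite card_option card_void. Qed.

Lemma map_uniq_inj (A B : eqType) (f : A -> B) s :
  uniq (map f s) -> {in s &, injective f}.
Proof.
elim: s => //= a s IH /andP [na /IH {}IH] x y; rewrite !inE.
move=> /orP [/eqP -> | xs] /orP [/eqP -> | ys] // E; last exact: IH.
- by rewrite E map_f in na.
- by rewrite -E map_f in na.
Qed.

Lemma cor_tmap (T : tree) (v : vertex T) l n (h : listing v l) : size l = n ->
  exists f : tmap (Cor n) T, pfop f (gcor n) = pg h.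
Proof.
move=> sl; have [f fU] := @cor_free n (treeOp T) (pg h) sl.
have pE : map (fcol f) (enum 'I_n) = l := congr1 (@pr _) fU.
suff F : is_tree_map f by exists (TMap F).
apply: (@incl_is_tree_map _ (Cor n) T f (fun=> v) (cv n) (cv n) (leqnn _)).
- have U := listing_uniq h; rewrite -pE in U => e e' E.
  by apply: (map_uniq_inj U) => //; rewrite mem_enum.
- by move=> w w'; rewrite (cvE w) (cvE w').
- by move=> w; rewrite (cvE w); apply: maps_vertexI fU.
- by left.
- by move=> w; left; apply: cvE.
Qed.

Lemma eta_free (D : cycOperad) (c : col D) :
  exists f : cycMor (treeOp eta) D, fcol f tt = c.
Proof.
have [|f [fE _]] := @free_ex eta D (fun=> c) (fun=> [::]) (fun v : void => match v with end) (fun v : void => match v with end).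
  by case.
by exists f; rewrite fE.
Qed.

Lemma eta_ext (D : cycOperad) (f g : cycMor (treeOp eta) D) :
  fcol f tt = fcol g tt -> f = g.
Proof. by move=> E; apply: tree_ext => [[]|[]]. Qed.

Lemma eta_tmap (T : tree) (e : edge T) : exists f : tmap eta T, fcol f tt = e.
Proof.
have [[v _]|nV] := pselect (exists v : vertex T, true).
  have {v} [v ve] := edge_vertex v e.
  have [f fE] := cor_tmap (listing_enum v) erefl.
  have : e \in map (fcol f) (enum 'I_(size (enum (adj v)))).
    by have -> : map (fcol f) (enum 'I_(size (enum (adj v)))) = enum (adj v) := congr1 (@pr _) fE; rewrite mem_enum.
  case/mapP => i _ Ei.
  have [g gi] := @eta_free (treeOp (Cor (size (enum (adj v))))) i.
  have G : is_tree_map g.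
    apply: tm_outer; right; split; first exact: card_cor.
    by split; rewrite ?card_void ?card_unit.
  by exists (tcomp_map f (TMap G)); rewrite /= gi Ei.
have [f fe] := @eta_free (treeOp T) e; suff F : is_tree_map f by exists (TMap F).
have eE e' : e' = e.
  have /connectP [[|[v|//] p] //= P L] := tree_connected (inr e : vertex T + edge T) (inr e').
    by case: L.
  by case: nV; exists v.
apply: tm_iso; exists (fun v : void => match v with end); split; last by case.
split; last by case.
- apply: inj_surj_bij => [[] []//|e']; exists tt; by rewrite fe (eE e').
- by apply: inj_surj_bij => [[]|v]; case: nV; exists v.
Qed.

(** The corolla with two edges is [eta] with its edge subdivided. Restriction along this
    codegeneracy will provide the identities of X. *)
Lemma cor2_eta : exists f : tmap (Cor 2) eta, pfop f (gcor 2) = pid (tt : col (treeOp eta)).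
Proof.
have [f fE] := @cor_free 2 (treeOp eta) (pid (tt : col (treeOp eta))) erefl.
suff F : is_tree_map f by exists (TMap F).
pose i1 : 'I_2 := lift ord0 ord0.
have i01 (i : 'I_2) : i = ord0 \/ i = i1.
  by case: i => [[|[|//]] lt]; [left|right]; apply: val_inj.
apply: tm_degen; exists tt, (cv 2), ord0, i1, (fun v : void => match v with end); split.
- split=> //.
  + by split=> //; [case: (fcol f _) | case: (fcol f _) | move=> e; case: (i01 e) => ->].
  + split; first by case; exists ord0; case: (fcol f _).
    by move=> e e' _; right; case: (fcol f _).
  + split; first by case.
    by move=> v; rewrite (cvE v); split=> //; case; case.
- by case.
- move=> h e; apply: pk_inj; rewrite pk_cst; apply: etrans fE.
  have E12 : enum 'I_2 = [:: ord0; i1].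
    by rewrite !enum_ordSl enum_ord0.
  by apply: (congr1 (pfop f) (_ : pg h = gcor 2)); apply: pg_eq; rewrite ?E12.
Qed.

Lemma count_listing (A : eqType) (x : A) s : (x \in s) = (0 < count_mem x s).
Proof. by rewrite -has_pred1 has_count. Qed.

Lemma uniq_count (A : eqType) (s : seq A) : (forall x, count_mem x s <= 1) -> uniq s.
Proof.
move=> H; apply: count_mem_uniq => x; rewrite count_listing.
by have := H x; case: (count_mem x s) => [|[]].
Qed.

Lemma fc_ex (A : eqType) (B : Type) (s : seq A) (s' : seq B) (b : B) :
  uniq s -> size s = size s' -> exists f : A -> B, map f s = s'.
Proof.
move=> U sz; exists (fun a => nth b s' (index a s)).
apply: (@eq_from_nth _ b); rewrite size_map // => i lt.
case: s U sz lt => // a s U sz lt.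
by rewrite (nth_map a) // index_uniq.
Qed.

Lemma size_split (A : Type) (s : seq A) a b : size s = a + b ->
  exists s1 s2, [/\ s = s1 ++ s2, size s1 = a & size s2 = b].
Proof.
move=> sz; exists (take a s), (drop a s); rewrite cat_take_drop size_drop size_take sz.
split=> //; last by rewrite addnC addnK.
by case: ltnP => // le; apply/eqP; rewrite eqn_leq leq_addr le.
Qed.

Definition twoV (T : tree) (x y : vertex T) := forall v, v = x \/ v = y.

(** Multiplicity one for every edge says at once that the lists are disjoint, duplicate free and
    exhaust [E], in a form that [lia] handles. *)
Lemma T2_build (E : finType) (c : E) l d1 d2 :
  (forall e, count_mem e (c :: d1 ++ l ++ d2) = 1) ->
  exists (T : tree) (x y : vertex T) c' l' d1' d2',
  [/\ x != y /\ twoV x y, listing x (rcons l' c'), listing y (d1' ++ c' :: d2') &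
      [/\ size l' = size l, size d1' = size d1 & size d2' = size d2]].
Proof.
move=> Ct; have Cl e : count_mem e (rcons l c) + count_mem e (d1 ++ c :: d2) = 1 + (c == e).
  by have := Ct e; rewrite -cats1 /= !count_cat /=; lia.
pose Y : pred E := mem (d1 ++ c :: d2); pose X (_ : unit) : pred E := mem (rcons l c).
have A1 i i' e : X i e -> X i' e -> i = i' by case: i i' => [] [].
have A2 i : X i c by rewrite /X /= mem_rcons mem_head.
have A3 (i : unit) : Y c by rewrite /Y /= mem_cat mem_head orbT.
have A4 i e : X i e -> Y e -> e = c.
  rewrite /X /Y /= !count_listing => h1 h2; apply/eqP; rewrite eq_sym.
  by have := Cl e; case: (c == e) => //; lia.
have A5 e : Y e \/ exists i, X i e.
  suff /orP [h|h] : Y e || X tt e by [left|right; exists tt].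
  by rewrite /X /Y /= !count_listing; have := Cl e; lia.
pose T := @starTree unit E Y X (fun=> c) A1 A2 A3 A4 A5.
exists T, (Some tt), None, c, l, d1, d2; split=> //.
- by split=> // -[[]|]; [left|right].
- apply: listingP => //; apply: uniq_count => e.
  by have := Ct e; rewrite -cats1 /= !count_cat /=; lia.
- apply: listingP => //; apply: uniq_count => e.
  by have := Ct e; rewrite /= !count_cat /=; lia.
Qed.

Lemma T2_ex p q1 q2 : exists (T : tree) (x y : vertex T) c l d1 d2,
  [/\ x != y /\ twoV x y, listing x (rcons l c), listing y (d1 ++ c :: d2) &
      [/\ size l = p, size d1 = q1 & size d2 = q2]].
Proof.
(* The ordinals in their natural order are cut into blocks of the prescribed sizes. *)
have [s1 [s2 [E0 sc]]] := size_split (size_enum_ord (1 + (q1 + (p + q2)))).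
move=> /size_split [d1 [s3 [E1 sd1 /size_split [l [d2 [E2 sl sd2]]]]]].
case: s1 sc E0 => [|c []] // _; rewrite {s2}E1 {s3}E2 => E0.
have [|T [x [y [c' [l' [d1' [d2' [h1 h2 h3 [e1 e2 e3]]]]]]]]] := @T2_build _ c l d1 d2.
  by move=> e; rewrite -[_ :: _]E0 count_uniq_mem ?enum_uniq // mem_enum.
exists T, x, y, c', l', d1', d2'; split=> //.
by split; [apply: etrans e1 sl|apply: etrans e2 sd1|apply: etrans e3 sd2].
Qed.

(** A star with centre [y], whose neighbours [x] and [z] are attached along [k] and [m]. *)
Lemma T3_build (E : finType) (k m : E) C D1 D2 G1 G2 :
  (forall e, count_mem e (k :: m :: C ++ D1 ++ D2 ++ G1 ++ G2) = 1) ->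
  exists (T : tree) (x y z : vertex T) k m C' D1' D2' G1' G2',
  [/\ [/\ x != y, y != z, x != z & forall v, [\/ v = x, v = y | v = z]],
      listing x (rcons C' k), listing y (D1' ++ k :: rcons D2' m), listing z (G1' ++ m :: G2') &
      [/\ size C' = size C, size D1' = size D1, size D2' = size D2, size G1' = size G1 &
          size G2' = size G2]].
Proof.
move=> Ct.
have Cs e : count_mem e (rcons C k) + count_mem e (D1 ++ k :: rcons D2 m) +
    count_mem e (G1 ++ m :: G2) = 1 + (k == e) + (m == e).
  by have := Ct e; rewrite -!cats1 /= !count_cat /= ?count_cat /=; lia.
pose Y : pred E := mem (D1 ++ k :: rcons D2 m).
pose X (b : bool) : pred E := if b then mem (rcons C k) else mem (G1 ++ m :: G2).
pose lk (b : bool) := if b then k else m.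
have Ex e : count_mem e (rcons C k) = count_mem e C + (k == e).
  by rewrite -cats1 count_cat /= addn0.
have Ey e : count_mem e (D1 ++ k :: rcons D2 m) =
    count_mem e D1 + (k == e) + count_mem e D2 + (m == e).
  by rewrite -cats1 count_cat /= count_cat /=; lia.
have Ez e : count_mem e (G1 ++ m :: G2) = count_mem e G1 + (m == e) + count_mem e G2.
  by rewrite count_cat /=; lia.
have {}Ct e : (k == e) + (m == e) + count_mem e C + count_mem e D1 + count_mem e D2 +
    count_mem e G1 + count_mem e G2 = 1.
  by rewrite -[RHS](Ct e) /= !count_cat; lia.
have A1 i i' e : X i e -> X i' e -> i = i'.
  by case: i i' => [] []; rewrite /X //= !count_listing Ex Ez; have := Ct e; lia.
have A2 i : X i (lk i) by case: i; rewrite /X /= ?mem_rcons ?mem_cat mem_head ?orbT.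
have A3 i : Y (lk i) by case: i; rewrite /Y /= mem_cat inE ?mem_rcons ?mem_head ?eqxx !orbT.
have A4 i e : X i e -> Y e -> e = lk i.
  case: i; rewrite /X /Y /= !count_listing ?Ex ?Ez ?Ey => h1 h2; apply/eqP; rewrite eq_sym;
    by move: h1 h2 (Ct e); case: (_ == e); case: (_ == e) => //; lia.
have A5 e : Y e \/ exists i, X i e.
  have /or3P [h|h|h] : [|| Y e, X true e | X false e].
  - by rewrite /X /Y /= !count_listing; have := Cs e; lia.
  - by left.
  - by right; exists true.
  - by right; exists false.
pose T := @starTree bool E Y X lk A1 A2 A3 A4 A5.
exists T, (Some true), None, (Some false), k, m, C, D1, D2, G1, G2; split=> //.
- by split=> // -[[]|]; [apply: Or31|apply: Or33|apply: Or32].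
- by apply: listingP => //; apply: uniq_count => e; rewrite Ex; have := Ct e; lia.
- by apply: listingP => //; apply: uniq_count => e; rewrite Ey; have := Ct e; lia.
- by apply: listingP => //; apply: uniq_count => e; rewrite Ez; have := Ct e; lia.
Qed.

Lemma T3_ex p q1 q2 r1 r2 : exists (T : tree) (x y z : vertex T) k m C D1 D2 G1 G2,
  [/\ [/\ x != y, y != z, x != z & forall v, [\/ v = x, v = y | v = z]],
      listing x (rcons C k), listing y (D1 ++ k :: rcons D2 m), listing z (G1 ++ m :: G2) &
      [/\ size C = p, size D1 = q1, size D2 = q2, size G1 = r1 & size G2 = r2]].
Proof.
have [s1 [s2 [E0 sk]]] := size_split (size_enum_ord (1 + (1 + (p + (q1 + (q2 + (r1 + r2))))))).
move=> /size_split [s3 [s4 [E1 sm]]] /size_split [C [s5 [E2 sC]]].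
move=> /size_split [D1 [s6 [E3 sD1]]] /size_split [D2 [s7 [E4 sD2]]].
move=> /size_split [G1 [G2 [E5 sG1 sG2]]].
case: s1 sk E0 => [|k []] // _; case: s3 sm E1 => [|m []] // _.
rewrite E2 E3 E4 E5 => -> E0.
have [|T [x [y [z [k' [m' [C' [D1' [D2' [G1' [G2' [h1 h2 h3 h4 [e1 e2 e3 e4 e5]]]]]]]]]]]]] := @T3_build _ k m C D1 D2 G1 G2.
  by move=> e; rewrite -[_ :: _]E0 count_uniq_mem ?enum_uniq // mem_enum.
exists T, x, y, z, k', m', C', D1', D2', G1', G2'; split=> //.
by split; [apply: etrans e1 sC|apply: etrans e2 sD1|apply: etrans e3 sD2|apply: etrans e4 sG1|apply: etrans e5 sG2].
Qed.

(** * Tree maps *)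

Lemma cat_inj (A : Type) (s1 s2 t1 t2 : seq A) : s1 ++ t1 = s2 ++ t2 ->
  size s1 = size s2 -> s1 = s2 /\ t1 = t2.
Proof.
move=> E sz; split; first by rewrite -(take_size_cat t1 sz) E take_size_cat.
by rewrite -(drop_size_cat t1 sz) E drop_size_cat.
Qed.

Section Relist.
Variable T : tree.
Notation A := (treeOp T).
Variables (x y : vertex T) (c : edge T).
Hypothesis xy : x != y.

(** Edges serve as their own labels, being distinct by [listing_common], so the equivariance axiom
    applies directly. *)
Lemma comp_relist l d1 d2 l' d1' d2' n (r : 'S_n)
    (hx : listing x (rcons l c)) (hy : listing y (d1 ++ c :: d2))
    (hx' : listing x (rcons l' c)) (hy' : listing y (d1' ++ c :: d2')) (W W' : pop A) :
  size (d1 ++ l ++ d2) = n ->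
  permute r (d1 ++ l ++ d2) = d1' ++ l' ++ d2' ->
  @IsComp A l c d1 d2 (pg hx) (pg hy) W -> @IsComp A l' c d1' d2' (pg hx') (pg hy') W' ->
  IsAct r W W'.
Proof.
move=> sz Hr C C'.
have [s Hs] := listing_perm hx hx'; have [t Ht] := listing_perm hy hy'.
have aU := gen_act' hx hx' erefl Hs; have aV := gen_act' hy hy' erefl Ht.
have Un := listing_common xy hx hy.
apply: (@lequiv A (edge T) id c l d1 d2 l' d1' d2' _ _ _ s t r _ _ _ _ _ _ Un Hs Ht Hr (esym sz) aU aV);
  by rewrite !map_id.
Qed.

Lemma comp_swap l d1 d2 l' d1' d2' n (r : 'S_n)
    (hx : listing x (rcons l c)) (hy : listing y (d1 ++ c :: d2))
    (hy' : listing y (rcons l' c)) (hx' : listing x (d1' ++ c :: d2')) (W W' : pop A) :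
  size (d1 ++ l ++ d2) = n ->
  permute r (d1 ++ l ++ d2) = d1' ++ l' ++ d2' ->
  @IsComp A l c d1 d2 (pg hx) (pg hy) W -> @IsComp A l' c d1' d2' (pg hy') (pg hx') W' ->
  IsAct r W W'.
Proof.
move=> sz Hr C C'.
have [s Hs] := listing_perm hx hx'; have [t Ht] := listing_perm hy hy'.
have aU := gen_act' hx hx' erefl Hs; have aV := gen_act' hy hy' erefl Ht.
have Un := listing_common xy hx hy.
apply: (@lexchange A (edge T) id c l d1 d2 l' d1' d2' _ _ _ s t r _ _ _ _ _ _ Un Hs Ht Hr (esym sz) aU aV);
  by rewrite !map_id.
Qed.

Lemma comp_pg l d1 d2 (hx : listing x (rcons l c)) (hy : listing y (d1 ++ c :: d2)) :
  exists W : pop A, @IsComp A l c d1 d2 (pg hx) (pg hy) W.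
Proof. exact: IsComp_ex. Qed.

Lemma comp_mem l d1 d2 (hx : listing x (rcons l c)) (hy : listing y (d1 ++ c :: d2)) e :
  (e \in d1 ++ l ++ d2) = (e != c) && (adj x e || adj y e).
Proof.
rewrite -(mem_listing hx) -(mem_listing hy) !mem_cat mem_rcons !inE.
have := listing_common xy hx hy; rewrite cons_uniq !mem_cat => /andP [nc _].
have [->|ne] /= := eqVneq e c; first exact: negbTE.
by case: (e \in d1); case: (e \in l); case: (e \in d2).
Qed.

Lemma comp_perm l d1 d2 l' d1' d2'
    (hx : listing x (rcons l c)) (hy : listing y (d1 ++ c :: d2))
    (hx' : listing x (rcons l' c)) (hy' : listing y (d1' ++ c :: d2')) :
  perm_eq (d1 ++ l ++ d2) (d1' ++ l' ++ d2').
Proof.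
apply: uniq_perm.
- by have := listing_common xy hx hy; rewrite cons_uniq => /andP [].
- by have := listing_common xy hx' hy'; rewrite cons_uniq => /andP [].
- by move=> e; rewrite (comp_mem hx hy) (comp_mem hx' hy').
Qed.
End Relist.

Section InnerCoface.
Variables (S T : tree) (c : edge T) (x y : vertex T) (q : vertex T -> vertex S).
Variable f : cycMor (treeOp S) (treeOp T).
Variables (l1 d1 d2 : seq (edge T)) (l0 : seq (edge S)).
Variables (hx0 : listing x (rcons l1 c)) (hy0 : listing y (d1 ++ c :: d2))
  (h0 : listing (q x) l0).
Hypothesis xy : x != y.
Hypothesis fI : injective (fcol f).
Hypothesis f_im : forall e, (exists e', fcol f e' = e) <-> e <> c.
Hypothesis q_surj : forall w, exists v, q v = w.
Hypothesis q_eq : forall v w, q v = q w <-> v = w \/ (v = x /\ w = y) \/ (v = y /\ w = x).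
Hypothesis fm : forall v, v <> x -> v <> y -> maps_vertex f (q v) v.
Hypothesis fC : @IsComp (treeOp T) l1 c d1 d2 (pg hx0) (pg hy0) (pfop f (pg h0)).

(** The definition of an inner coface asks for all listings with [c] first at [y]; by [comp_relist]
    they are determined by a single composite, with [c] at any position. *)
Lemma inner_cofaceI : inner_coface f c.
Proof.
have pE : map (fcol f) l0 = d1 ++ l1 ++ d2 by have [_ _] := IsComp_pr fC.
exists x, y, q; split.
- split=> //.
  + apply/joinsP; split=> //.
      by rewrite -(mem_listing hx0) mem_rcons mem_head.
    by rewrite -(mem_listing hy0) mem_cat mem_head orbT.
  + by move=> v e vx vy; rewrite (maps_vertex_adj e fI (fm vx vy)).
  + move=> e; rewrite -(mem_listing h0) -(mem_map fI) pE (comp_mem xy hx0 hy0).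
    by have /f_im /eqP -> : exists e', fcol f e' = fcol f e by exists e.
- exact: fm.
- move=> l m1 m2 h hx hy e; apply: pk_inj; rewrite pk_cst.
  have [r Hr] := listing_perm h0 h.
  have a := pfop_act f (gen_act' h0 h erefl Hr).
  apply: (IsAct_fun a).
  apply: (@comp_relist T x y c xy _ _ _ m1 [::] m2 _ r _ _ hx (hy : listing y ([::] ++ c :: m2)) _ _ _ _ fC).
  + exact: etrans (esym (congr1 size pE)) (size_map _ _).
  + apply: etrans (congr1 (permute r) (esym pE)) _.
    by rewrite -map_permute Hr.
  + by exists (gen hx), (gen hy).
Qed.
End InnerCoface.

(** Contracting the only inner edge of a two-vertex tree gives a corolla, so the composite of both
    vertices is realised by an inner coface. *)
Lemma cor_face (S : tree) (x y : vertex S) c n (W : pop (treeOp S)) l d1 d2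
    (hx : listing x (rcons l c)) (hy : listing y (d1 ++ c :: d2)) :
  x != y -> twoV x y ->
  @IsComp (treeOp S) l c d1 d2 (pg hx) (pg hy) W -> n = size (pr W) ->
  exists f : tmap (Cor n) S, pfop f (gcor n) = W.
Proof.
move=> xy tV C sW; have [_ _ pW] := IsComp_pr C.
have [f fW] := @cor_free n _ W (esym sW).
have pE : map (fcol f) (enum 'I_n) = d1 ++ l ++ d2 by rewrite -pW -fW.
have Un := listing_common xy hx hy.
have fI : injective (fcol f).
  move=> e e' E; move: Un; rewrite cons_uniq -pE => /andP [_ U].
  by apply: (map_uniq_inj U) => //; rewrite mem_enum.
suff F : inner_coface f c by exists (TMap (tm_inner F)).
apply: (@inner_cofaceI _ _ c x y (fun=> cv n) f l d1 d2 _ hx hy (cor_listing n)) => //.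
- move=> e; have M := comp_mem xy hx hy e.
  split=> [[e' Ee]|/eqP ne].
    have : e \in d1 ++ l ++ d2 by rewrite -pE -Ee map_f // mem_enum.
    by rewrite M => /andP [/eqP].
  have [v ve] := edge_vertex x e.
  have : e \in d1 ++ l ++ d2.
    by rewrite M ne; case: (tV v) => <-; rewrite ve ?orbT.
  by rewrite -pE => /mapP [e' _ ->]; exists e'.
- by move=> w; exists x; rewrite (cvE w).
- move=> v w; split=> // _.
  by case: (tV v) => ->; case: (tV w) => ->; [left|right;left|right;right|left].
- by move=> v vx vy; case: (tV v).
- by rewrite -/(gcor n) fW.
Qed.

Section Codegeneracy.
Variables (S T : tree) (w v' : vertex S) (v : vertex T) (f : cycMor (treeOp S) (treeOp T)).
Variables (c1 c2 : edge S) (c : edge T) (lv : seq (edge S)).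
Hypotheses (wv : w != v') (tV : twoV w v') (T1 : forall u : vertex T, u = v).
Variables (hw : listing w [:: c1; c2]) (hv : listing v' lv) (hv' : listing v (map (fcol f) lv)).
Hypothesis c2v : adj v' c2.
Hypothesis fw : pfop f (pg hw) = pid (c : col (treeOp T)).
Hypothesis fv : pfop f (pg hv) = pg hv'.

(** Here [w] is the bivalent vertex subdividing [c]. Restriction along such maps will yield the unit
    laws of the operad of X. *)
Lemma codegeneracyI : is_tree_map f.
Proof.
have [E1 E2] : fcol f c1 = c /\ fcol f c2 = c by have [] := congr1 (@pr _) fw.
have wE e : adj w e = (e == c1) || (e == c2) by rewrite -(mem_listing hw) !inE.
have c12 : c1 <> c2.
  by have := listing_uniq hw; rewrite /= inE andbT => /eqP.
have U := listing_uniq hv'.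
have inj e e' : adj v' e -> adj v' e' -> fcol f e = fcol f e' -> e = e'.
  by move=> he he'; apply: (map_uniq_inj U); rewrite (mem_listing hv).
have nv e : ~~ adj v' e -> fcol f e = c.
  move=> ne; have [u ue] := edge_vertex w e.
  case: (tV u) => E; rewrite E ?wE in ue; last by rewrite ue in ne.
  by case/orP: ue => /eqP ->.
apply: tm_degen; exists c, w, c1, c2, (fun=> v'); split.
- split.
  + by [].
  + split.
      move=> e'; have [u ue] := edge_vertex v e'; rewrite (T1 u) in ue.
      have : e' \in map (fcol f) lv by rewrite (mem_listing hv').
      by case/mapP => e _ ->; exists e.
    move=> e e' E; have [he|/nv] := boolP (adj v' e); last by right.
    have [he'|/nv <-] := boolP (adj v' e'); last by right.
    by left; apply: inj.
  + move=> e E; have [he|ne] := boolP (adj v' e).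
      by right; apply: inj => //; rewrite E2.
    have [u ue] := edge_vertex w e.
    case: (tV u) => Eu; rewrite Eu ?wE in ue; last by rewrite ue in ne.
    by case/orP: ue => /eqP; [left|right].
  + split; first by move=> u u' _; rewrite (T1 u) (T1 u').
    move=> u; split=> [[_ <-]|nu]; first by apply/eqP; rewrite eq_sym.
    by exists v; case: (tV u).
  + move=> u e'; rewrite (T1 u) -(mem_listing hv'); split.
      by case/mapP => e; rewrite (mem_listing hv) => he ->; exists e.
    by case=> e <- he; rewrite map_f // (mem_listing hv).
- by move=> u; rewrite (T1 u); apply: maps_vertexI fv.
- move=> h e; apply: pk_inj; rewrite pk_cst; apply: etrans fw.
  by apply: (congr1 (pfop f) (_ : pg h = pg hw)); apply: pg_eq.
Qed.
End Codegeneracy.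

Section TwoVertexMor.
Variables (S : tree) (x y : vertex S) (c : edge S) (l d1 d2 : seq (edge S)).
Hypotheses (xy : x != y) (tV : twoV x y).
Variables (hx : listing x (rcons l c)) (hy : listing y (d1 ++ c :: d2)).

Lemma T2_exhaust e : e \in c :: d1 ++ l ++ d2.
Proof.
rewrite inE (comp_mem xy hx hy); case: eqP => //= _.
by have [v ve] := edge_vertex x e; case: (tV v) => <-; rewrite ve ?orbT.
Qed.

(** By freeness, a morphism out of a two-vertex tree amounts to a composable pair of operations. *)
Lemma T2_mor (D : cycOperad) (U V : pop D) l' a d1' d2' :
  pr U = rcons l' a -> pr V = d1' ++ a :: d2' ->
  size l' = size l -> size d1' = size d1 -> size d2' = size d2 ->
  exists f : cycMor (treeOp S) D, [/\ pfop f (pg hx) = U, pfop f (pg hy) = V,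
    fcol f c = a, map (fcol f) l = l' & map (fcol f) d1 = d1' /\ map (fcol f) d2 = d2'].
Proof.
move=> pU pV sl s1 s2; have Un := listing_common xy hx hy.
have [|fc] := @fc_ex _ _ (c :: d1 ++ l ++ d2) (a :: d1' ++ l' ++ d2') a Un.
  by rewrite /= !size_cat sl s1 s2.
rewrite /= !map_cat => -[Ec] /cat_inj [|E1 /cat_inj [|El E2]]; rewrite ?size_map //.
pose L v := if v == x then rcons l c else d1 ++ c :: d2.
have hL v : listing v (L v).
  by rewrite /L; case: eqP => [->//|nx]; case: (tV v) => // ->.
have [|f [fE fg]] := @free_ex S D fc L hL (fun v => if v == x then U else V).
  by move=> v; rewrite /L; case: eqP => _; rewrite ?pU ?pV ?map_rcons ?map_cat /= ?El ?Ec ?E1 ?E2.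
exists f; rewrite !(eq_map fE) fE; split=> //.
- have := fg x; rewrite eqxx => <-; congr pfop; apply: pg_eq => //; by rewrite /L eqxx.
- have := fg y; rewrite eq_sym (negbTE xy) => <-; congr pfop; apply: pg_eq => //.
  by rewrite /L eq_sym (negbTE xy).
Qed.

Lemma T2_inj (T : tree) (f : cycMor (treeOp S) (treeOp T)) :
  uniq (map (fcol f) (c :: d1 ++ l ++ d2)) -> injective (fcol f).
Proof. by move=> U e e' E; apply: (map_uniq_inj U) => //; apply: T2_exhaust. Qed.
End TwoVertexMor.

Lemma sub2_emb (S T : tree) (x' y' : vertex S) (c' : edge S) l' d1' d2' (x y : vertex T) c l d1 d2
    (hx' : listing x' (rcons l' c')) (hy' : listing y' (d1' ++ c' :: d2'))
    (hx : listing x (rcons l c)) (hy : listing y (d1 ++ c :: d2)) (f : cycMor (treeOp S) (treeOp T)) :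
  x' != y' -> twoV x' y' -> x != y ->
  pfop f (pg hx') = pg hx -> pfop f (pg hy') = pg hy -> fcol f c' = c ->
  map (fcol f) l' = l -> map (fcol f) d1' = d1 -> map (fcol f) d2' = d2 ->
  injective (fcol f) /\ exists jk : vertex S -> vertex T,
    [/\ injective jk, forall v, maps_vertex f v (jk v), forall v, jk v = x \/ jk v = y &
        exists c, joins c x' y'].
Proof.
move=> xy' tV xy fx fy fc fl f1 f2; split.
  apply: (T2_inj xy' tV hx' hy').
  by rewrite map_cons !map_cat fc fl f1 f2; apply: (listing_common xy hx hy).
pose jk v := if v == x' then x else y.
have [jx jy] : jk x' = x /\ jk y' = y by rewrite /jk eqxx eq_sym (negbTE xy').
exists jk; split.
- move=> v w; case: (tV v) => ->; case: (tV w) => ->; rewrite ?jx ?jy // => E.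
    by rewrite E eqxx in xy.
  by rewrite E eqxx in xy.
- move=> v; case: (tV v) => ->; rewrite ?jx ?jy; first exact: maps_vertexI fx.
  exact: maps_vertexI fy.
- by move=> v; case: (tV v) => ->; auto.
- exists c'; apply/joinsP; split=> //.
    by rewrite -(mem_listing hx') mem_rcons mem_head.
  by rewrite -(mem_listing hy') mem_cat mem_head orbT.
Qed.

(** Two vertices sharing an edge span a subtree, and its inclusion is a tree map by
    [incl_is_tree_map]. *)
Lemma sub2_tmap (S T : tree) (x' y' : vertex S) (c' : edge S) l' d1' d2' (x y : vertex T) c l d1 d2
  (hx' : listing x' (rcons l' c')) (hy' : listing y' (d1' ++ c' :: d2'))
  (hx : listing x (rcons l c)) (hy : listing y (d1 ++ c :: d2)) :
  x' != y' -> twoV x' y' -> x != y ->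
  size l = size l' -> size d1 = size d1' -> size d2 = size d2' ->
  exists f : tmap S T, [/\ pfop f (pg hx') = pg hx, pfop f (pg hy') = pg hy,
    fcol f c' = c, map (fcol f) l' = l & map (fcol f) d1' = d1 /\ map (fcol f) d2' = d2].
Proof.
move=> xy' tV xy sl s1 s2.
have [f [fx fy fc fl [f1 f2]]] := @T2_mor _ _ _ _ _ _ _ xy' tV hx' hy' (treeOp T) (pg hx) (pg hy)
  _ _ _ _ erefl erefl sl s1 s2.
have [fI [jk [jI jm _ J]]] := sub2_emb xy' tV xy fx fy fc fl f1 f2.
suff F : is_tree_map f by exists (TMap F).
exact: (@incl_is_tree_map _ S T f jk x' y' (leqnn _) fI jI jm (or_intror J) tV).
Qed.

Lemma map_preim (A B : eqType) (f : A -> B) (L : seq B) :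
  (forall b, b \in L -> exists a, f a = b) -> exists l, map f l = L.
Proof.
elim: L => [|b L IH] H; first by exists [::].
have [|l <-] := IH; first by move=> b' hb; apply: H; rewrite inE hb orbT.
by have [|a <-] := H b; [rewrite mem_head|exists (a :: l)].
Qed.

Lemma perm_ex (A : eqType) (l l' : seq A) : perm_eq l l' ->
  exists r : 'S_(size l), permute r l = l'.
Proof. exact: permuteP. Qed.

(* Either end of [c] may be taken as the first factor. *)
Lemma inner_comp (S T : tree) (f : cycMor (treeOp S) (treeOp T)) c x y q :
  contraction c x y (fcol f) q ->
  (forall (l : seq (edge S)) (l1 l2 : seq (edge T))
     (h : listing (q x) l) (hx : listing x (rcons l1 c))
     (hy : listing y (c :: l2)) (e : map (fcol f) l = [::] ++ l1 ++ l2),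
     cst e (fop f (gen h)) = comp (D := treeOp T) [::] l2 (gen hx) (gen hy)) ->
  forall x' y' l1 l2 (hx : listing x' (rcons l1 c)) (hy : listing y' (c :: l2)),
  x' != y' -> exists l (h : listing (q x) l),
    @IsComp (treeOp T) l1 c [::] l2 (pg hx) (pg (hy : listing y' ([::] ++ c :: l2)))
      (pfop f (pg h)).
Proof.
move=> [/joinsP [xy xc yc] [fI fim] _ _ qadj] fC.
have main l1 l2 (hx : listing x (rcons l1 c)) (hy : listing y (c :: l2)) :
    exists l (h : listing (q x) l),
    @IsComp (treeOp T) l1 c [::] l2 (pg hx) (pg (hy : listing y ([::] ++ c :: l2)))
      (pfop f (pg h)).
  have M := comp_mem xy hx (hy : listing y ([::] ++ c :: l2)).
  have [|l El] := @map_preim _ _ (fcol f : edge S -> edge T) ([::] ++ l1 ++ l2).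
    by move=> e; rewrite M => /andP [/eqP ne _]; apply/fim.
  have h : listing (q x) l.
    apply: listingP.
      rewrite -(map_inj_uniq fI) El.
      have := listing_common xy hx (hy : listing y ([::] ++ c :: l2)).
      by rewrite cons_uniq => /andP [].
    move=> e; rewrite -(mem_map fI) El M qadj.
    by have /fim /eqP -> : exists e', fcol f e' = fcol f e by exists e.
  exists l, h, (gen hx), (gen hy); split=> //.
  by apply/pkP; exists El; apply: fC.
move=> x' y' l1 l2 hx hy xy'.
have x'c : adj x' c by rewrite -(mem_listing hx) mem_rcons mem_head.
have y'c : adj y' c by rewrite -(mem_listing hy) mem_head.
have [E1|E1] := adj_third xy xc yc x'c.
  have E2 : y' = y by have [E2|//] := adj_third xy xc yc y'c; rewrite E1 E2 eqxx in xy'.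
  by subst x' y'; apply: main.
have E2 : y' = x by have [//|E2] := adj_third xy xc yc y'c; rewrite E1 E2 eqxx in xy'.
subst x' y'.
have hx2 : listing x (rcons l2 c) by apply: perm_trans hy; rewrite perm_rcons.
have hy2 : listing y (c :: l1) by apply: perm_trans hx; rewrite perm_sym perm_rcons.
have [l [h C]] := main _ _ hx2 hy2.
have [r Hr] := @perm_ex _ (l2 ++ l1) (l1 ++ l2) (permEl (perm_catC _ _)).
have [W C'] := comp_pg hx (hy : listing x ([::] ++ c :: l2)).
have a := @comp_swap T x y c xy l2 [::] l1 l1 [::] l2 _ r hx2 hy2 hx hy _ _ erefl Hr C C'.
have pE : map (fcol f) l = l2 ++ l1 by have [_ _] := IsComp_pr C.
have sl : size l = size (l2 ++ l1) by rewrite -pE size_map.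
have h' := listing_permute r sl h.
exists _, h'; suff -> : pfop f (pg h') = W by [].
exact: IsAct_fun (pfop_act f (gen_act h h' sl)) a.
Qed.

Lemma inner_vertex (S T : tree) (f : cycMor (treeOp S) (treeOp T)) c s : inner_coface f c ->
  (exists v, maps_vertex f s v) \/
  exists x y l1 l2 (hx : listing x (rcons l1 c)) (hy : listing y ([::] ++ c :: l2)) l
    (h : listing s l), x != y /\ @IsComp (treeOp T) l1 c [::] l2 (pg hx) (pg hy) (pfop f (pg h)).
Proof.
move=> [x [y [q [con fm fC]]]]; have [/joinsP [xy xc yc] _ [qs qe] _ _] := con.
have [v <-] := qs s; have [vx|nx] := pselect (q v = q x); last first.
  by left; exists v; apply: fm => E; apply: nx; rewrite E //; apply/qe; right; right.
have [_ xl] := listing_rem xc; have [yl _] := listing_rem yc.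
have [l [h C]] := inner_comp con fC xl yl xy; right.
by rewrite vx; exists x, y, _, _, xl, yl, l, h.
Qed.

Lemma degen_vertex (S T : tree) (f : cycMor (treeOp S) (treeOp T)) c w c1 c2 j s :
  subdivision c w c1 c2 (fcol f) j -> (forall v, maps_vertex f (j v) v) ->
  (forall (h : listing w [:: c1; c2]) (e : map (fcol f) [:: c1; c2] = [:: c; c]),
     cst e (fop f (gen h)) = idop (D := treeOp T) c) ->
  (exists2 v, s = j v & maps_vertex f s v) \/
  s = w /\ exists l (h : listing s l), pfop f (pg h) = pid (c : col (treeOp T)).
Proof.
move=> [[c12 E1 E2 wadj] _ _ [_ jim] _] fm fC.
have [->|/jim [v <-]] := pselect (s = w); last by left; exists v.
have h : listing w [:: c1; c2].
  apply: listingP; first by rewrite /= inE andbT; apply/eqP.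
  by move=> e; rewrite wadj !inE.
have e : map (fcol f) [:: c1; c2] = [:: c; c] by rewrite /= E1 E2.
by right; split=> //; exists _, h; apply/pkP; exists e; apply: fC.
Qed.

(** * Multiplicities of vertices under tree maps *)

Section TmapCount.
Variables (S T : tree).

(** The matrix of multiplicities of [f]; composing morphisms multiplies these matrices. *)
Definition mcnt (f : cycMor (treeOp S) (treeOp T)) v w := cntv w (pfop f (pg (listing_enum v))).

Lemma mcntE (f : cycMor (treeOp S) (treeOp T)) v w l (h : listing v l) :
  mcnt f v w = cntv w (pfop f (pg h)).
Proof.
have [s Es] := listing_perm (listing_enum v) h.
by have := cnt_act (fun v' => v' == w : nat) (pfop_act f (gen_act' (listing_enum v) h erefl Es)).
Qed.

Lemma mcnt_maps (f : cycMor (treeOp S) (treeOp T)) v v' w :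
  maps_vertex f v v' -> mcnt f v w = (v' == w).
Proof.
by move=> /(maps_vertex_pg (listing_enum v)) [h E]; rewrite /mcnt E /cntv cnt_gen.
Qed.

Lemma cntv_pfop (f : cycMor (treeOp S) (treeOp T)) w U :
  cntv w (pfop f U) = \sum_v mcnt f v w * cntv v U.
Proof. by rewrite /cntv cnt_mor cnt_sum. Qed.

Lemma sum_inj_le1 (j : vertex S -> vertex T) w : injective j ->
  \sum_v (j v == w) <= 1.
Proof.
move=> jI; rewrite (eq_bigr (fun v => if j v == w then 1 else 0)) => [|v _]; last by case: (_ == _).
rewrite -big_mkcond /= sum1dep_card; apply/card_le1_eqP => v v'.
by rewrite !inE => /eqP <- /eqP /jI ->.
Qed.
End TmapCount.

Lemma sum_delta (I : finType) (i0 : I) : \sum_i (i == i0 : nat) = 1.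
Proof. by rewrite (bigD1 i0) //= eqxx big1 ?addn0 // => i /negbTE ->. Qed.

(** Bounding the whole column, and not only its entries, makes the property stable under composition
    of tree maps. General operad morphisms, which may repeat a vertex, can violate it. *)
Lemma tmap_cnt (S T : tree) (f : cycMor (treeOp S) (treeOp T)) w : is_tree_map f ->
  \sum_v mcnt f v w <= 1.
Proof.
move=> F; elim: {S T f} F w => [S T f|S T f c|S T f|S T f|R S T g f _ IHg _ IHf] /=.
- move=> [j [[_ /bij_inj jI _] fm]] w.
  under eq_bigr => v _ do rewrite (mcnt_maps _ (@fm v)).
  exact: sum_inj_le1.
- move=> [x [y [q [con fm fC]]]] w.
  suff E s : mcnt f s w = (s == q w) by under eq_bigr => v _ do rewrite E; rewrite sum_delta.
  have [/joinsP [xy xc yc] _ [qs qe] _ _] := con; have [v <-] := qs s.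
  have [vx|nx] := pselect (q v = q x).
    have [_ xl] := listing_rem xc; have [yl _] := listing_rem yc.
    have [l [h C]] := inner_comp con fC xl yl xy.
    rewrite vx (mcntE _ _ h) /cntv (cnt_comp _ C) !cnt_gen.
    have -> : (q x == q w) = (x == w) || (y == w).
      apply/eqP/orP => [/qe|].
        by case=> [->|[[_ ->]|[/eqP]]]; [left|right|rewrite (negbTE xy)].
      by case=> /eqP <-; apply/qe; [left|right;left].
    case: (eqVneq x w) => [<-|] /=; last by rewrite add0n.
    by rewrite eq_sym (negbTE xy).
  rewrite (@mcnt_maps _ _ _ _ v); last first.
    by apply: fm => E; apply: nx; rewrite E //; apply/qe; right; right.
  congr nat_of_bool; apply/eqP/eqP => [->//|/qe [//|[[E _]|[E _]]]]; case: nx.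
    by rewrite E.
  by rewrite E; apply/qe; right; right.
- move=> [[_ [u [j [[_ _ [jI _] _] fm]]]]|[_ [S0 _]]] w.
    under eq_bigr => v _ do rewrite (mcnt_maps _ (@fm v)).
    exact: sum_inj_le1.
  by rewrite big_pred0 // => v; have := card0_eq S0 v.
- move=> [c [v0 [c1 [c2 [j [sub fm fC]]]]]] w.
  have [_ _ _ [jI jim] _] := sub.
  suff E s : mcnt f s w = (s == j w) by under eq_bigr => v _ do rewrite E; rewrite sum_delta.
  have [[v -> mv]|[Es [l [h E]]]] := degen_vertex s sub fm fC.
    by rewrite (mcnt_maps _ mv) (inj_eq jI).
  rewrite (mcntE _ _ h) E /cntv cnt_id; case: eqP => // Ew.
  by have : s <> v0 by apply/jim; exists w.
- move=> w.
  have E v : mcnt (compMor g f) v w = \sum_s mcnt g s w * mcnt f v s.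
    by rewrite /mcnt pfop_compMor cntv_pfop.
  under eq_bigr => v _ do rewrite E.
  rewrite exchange_big /=; apply: leq_trans (IHg w); apply: leq_sum => s _.
  by rewrite -big_distrr /= -[leqRHS]muln1 leq_mul2l IHf orbT.
Qed.

Definition rz (T : tree) (W : pop (treeOp T)) :=
  exists n (f : tmap (Cor n) T), pfop f (gcor n) = W.

Lemma rz_cnt (T : tree) (W : pop (treeOp T)) v : rz W -> cntv v W <= 1.
Proof.
move=> [n [f <-]]; have := tmap_cnt v (tmapP f).
by rewrite (bigD1 (cv n)) //= (mcntE _ _ (cor_listing n)) => /(leq_trans (leq_addr _ _)).
Qed.

Section TwoGenerators.
Variables (S : tree) (x y : vertex S) (c : edge S) (l m1 m2 : seq (edge S)).
Hypotheses (xy : x != y) (tV : twoV x y).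
Variables (hx : listing x (rcons l c)) (hy : listing y (m1 ++ c :: m2)) (W0 : pop (treeOp S)).
Hypothesis C0 : @IsComp (treeOp S) l c m1 m2 (pg hx) (pg hy) W0.

Inductive op2 (U : pop (treeOp S)) : Prop :=
| Op2id e of U = pid (e : col (treeOp S))
| Op2gen v l0 (h : listing v l0) of U = pg h
| Op2comp n (s : 'S_n) of IsAct s W0 U.

Lemma op2_act n (s : 'S_n) U W : IsAct s U W -> op2 U -> op2 W.
Proof.
move=> a [e E|v l0 h E|m t a0].
- by apply: (@Op2id _ e); rewrite E in a; apply: lact_id a.
- rewrite E in a; have sl : size l0 = n := IsAct_size a.
  apply: (@Op2gen _ v _ (listing_permute s sl h)).
  exact: IsAct_fun a (gen_act' _ _ sl erefl).
- have E : n = m by rewrite -(IsAct_size a) (IsAct_pr a0) size_permute // (IsAct_size a0).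
  by case: m / E t a0 => t a0; apply: (@Op2comp _ n (s * t)%g); apply: lactM a0 a.
Qed.

(** Counts add up in a composite, so both factors inherit the bounds and fall under the three cases
    by induction. Two generators must then be the two distinct vertices, meeting along [c]; beside a
    full composite there is only room for an identity. *)
Lemma op2P U : cntv x U <= 1 -> cntv y U <= 1 -> op2 U.
Proof.
have cW v : cntv v W0 = (x == v) + (y == v).
  by rewrite /cntv (cnt_comp _ C0) !cnt_gen.
have cA v n (s : 'S_n) U1 : IsAct s W0 U1 -> cntv v U1 = (x == v) + (y == v).
  by move=> a; rewrite -cW /cntv (cnt_act _ a).
move: U; apply: op_ind.
- by move=> v l0 h _ _; apply: Op2gen erefl.
- by move=> e _ _; apply: Op2id erefl.
- move=> n s U W a IH; rewrite /cntv !(cnt_act _ a) => /IH {}IH /IH {}IH.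
  exact: op2_act a IH.
- move=> d a d1 d2 U V W C IU IV; rewrite /cntv !(cnt_comp _ C) => cx cy.
  have [pU pV pW] := IsComp_pr C.
  have oU : op2 U by apply: IU; [apply: leq_trans cx|apply: leq_trans cy]; apply: leq_addr.
  have oV : op2 V by apply: IV; [apply: leq_trans cx|apply: leq_trans cy]; apply: leq_addl.
  case: (oU) => [e E|v l0 h E|n s aU].
  + rewrite E in pU C; have /rcons_inj [Ed Ea] : rcons [:: e] e = rcons d a := pU.
    by subst d a; rewrite (lunitl C).
  + case: (oV) => [e E'|v' l' h' E'|n s aV].
    * rewrite E' in pV C.
      case: d1 pV C {pW} => [|b [|b' d1]] [<-] => [<- C|<- <- C|]; last by case: d1.
        by rewrite (lunitr C).
      by have [n [s aW]] := lunitr' C; apply: op2_act aW oU.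
    * subst U V; move: (pU) (pV) => /= El El'; rewrite El in h C pU cx cy oU IU *.
      rewrite El' in h' C pV cx cy oV IV *.
      rewrite !cnt_gen in cx cy.
      have va : adj v a by rewrite -(mem_listing h) mem_rcons mem_head.
      have v'a : adj v' a by rewrite -(mem_listing h') mem_cat mem_head orbT.
      have xc : adj x c by rewrite -(mem_listing hx) mem_rcons mem_head.
      have yc : adj y c by rewrite -(mem_listing hy) mem_cat mem_head orbT.
      have yx' : y != x by rewrite eq_sym.
      have yx : (y == x) = false by rewrite eq_sym (negbTE xy).
      have [[Ev Ev']|[Ev Ev']] : (v = x /\ v' = y) \/ (v = y /\ v' = x).
        by case: (tV v) cx cy => ->; case: (tV v') => ->; rewrite ?eqxx ?yx ?(negbTE xy) //; [left|right].
      - subst v v'; have Ea := two_common xy va v'a xc yc; subst a.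
        have [r Hr] := perm_ex (comp_perm xy hx hy h h').
        exact: Op2comp (comp_relist xy erefl Hr C0 C).
      - subst v v'; have Ea := two_common xy v'a va xc yc; subst a.
        have pe : perm_eq (m1 ++ l ++ m2) (d1 ++ d ++ d2).
          apply: uniq_perm.
          + by have := listing_common xy hx hy; rewrite cons_uniq => /andP [].
          + by have := listing_common yx' h h'; rewrite cons_uniq => /andP [].
          + move=> e; rewrite (comp_mem xy hx hy).
            by rewrite (comp_mem yx' h h') orbC.
        have [r Hr] := perm_ex pe.
        exact: Op2comp (comp_swap xy erefl Hr C0 C).
    (* A generator cannot be composed with an operation that already uses both vertices. *)
    * move: cx cy; rewrite -!/(cntv _ _) E /cntv !cnt_gen -!/(cntv _ _) !(cA _ _ _ _ aV).
      rewrite !eqxx; case: (tV v) => ->; rewrite eqxx; lia.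
  + have tV0 : tot V = 0.
      rewrite tot_sum big1 // => v _.
      move: cx cy; rewrite -!/(cntv _ _) !(cA _ _ _ _ aU) !eqxx.
      by case: (tV v) => ->; lia.
    have [e E'] := tot0_id tV0; rewrite E' in pV C.
    case: d1 pV C {pW} => [|b [|b' d1]] [<-] => [<- C|<- <- C|]; last by case: d1.
      by rewrite (lunitr C).
    by have [n' [s' aW]] := lunitr' C; apply: op2_act aW oU.
Qed.
End TwoGenerators.

(** * Restrictions to corollas *)

Lemma size_gcor n : size (pr (gcor n)) = n.
Proof. exact: size_enum_ord. Qed.

Lemma size_pfop_gcor n (D : cycOperad) (f : cycMor (treeOp (Cor n)) D) :
  size (pr (pfop f (gcor n))) = n.
Proof. by rewrite pr_pfop size_map size_gcor. Qed.

Lemma rz_gen (T : tree) (v : vertex T) l (h : listing v l) : rz (pg h).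
Proof. by have [f E] := cor_tmap h erefl; exists (size l), f. Qed.

Lemma rz_map (S T : tree) (f : tmap S T) W : rz W -> rz (pfop f W).
Proof.
move=> [n [g <-]]; exists n, (tcomp_map f g).
exact: pfop_compMor.
Qed.

Lemma rz_act (T : tree) n (s : 'S_n) (U W : pop (treeOp T)) :
  IsAct s U W -> rz U -> rz W.
Proof.
move=> a [m [f E]]; have sz : size (pr (gcor m)) = n.
  by rewrite -(IsAct_size a) -E pr_pfop size_map.
have b := gen_act' (cor_listing m) (@listing_permute (Cor m) (cv m) _ n s sz (cor_listing m)) sz erefl.
have := pfop_act f b; rewrite E => /(IsAct_fun a) ->.
exact/rz_map/rz_gen.
Qed.

Definition em (T : tree) (e : edge T) : tmap eta T := sval (cid (eta_tmap e)).

Lemma emE (T : tree) (e : edge T) : fcol (em e) tt = e.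
Proof. by rewrite /em; case: cid. Qed.

Lemma em_eq (T : tree) (e : edge T) (f : tmap eta T) : fcol f tt = e -> f = em e.
Proof. by move=> E; apply/tmap_eq/eta_ext; rewrite emE. Qed.

Definition dg : tmap (Cor 2) eta := sval (cid cor2_eta).

Lemma dgE : pfop dg (gcor 2) = pid (tt : col (treeOp eta)).
Proof. by rewrite /dg; case: cid. Qed.

Lemma rz_comp2 (S : tree) (x y : vertex S) c l d1 d2
    (hx : listing x (rcons l c)) (hy : listing y (d1 ++ c :: d2)) (W : pop (treeOp S)) :
  x != y -> twoV x y -> @IsComp (treeOp S) l c d1 d2 (pg hx) (pg hy) W -> rz W.
Proof.
by move=> xy tV C; have [f E] := cor_face xy tV C erefl; exists (size (pr W)), f.
Qed.

(** The composite is formed in an abstract two-vertex tree, where it is an inner coface, and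
    transported along the inclusion of the subtree. *)
Lemma rz_comp (T : tree) (x y : vertex T) c l d1 d2
    (hx : listing x (rcons l c)) (hy : listing y (d1 ++ c :: d2)) (W : pop (treeOp T)) :
  x != y -> @IsComp (treeOp T) l c d1 d2 (pg hx) (pg hy) W -> rz W.
Proof.
move=> xy C.
have [S [x' [y' [c' [l' [d1' [d2' [[xy' tV] hx' hy' [sl s1 s2]]]]]]]]] :=
  T2_ex (size l) (size d1) (size d2).
have [f [fx fy fc fl [f1 f2]]] := sub2_tmap hx' hy' hx hy xy' tV xy (esym sl) (esym s1) (esym s2).
have [W' C'] := comp_pg hx' hy'.
have := pfop_comp f C'; rewrite fx fy fc fl f1 f2 => /(IsComp_fun C) ->.
exact: rz_map (rz_comp2 xy' tV C').
Qed.

Section Evaluation.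
Variable X : astroidal.

Definition ecol (T : tree) (t : X T) (e : edge T) : X eta := amap X (em e) t.

Lemma ecol_map (S T : tree) (f : tmap S T) (t : X T) e :
  ecol (amap X f t) e = ecol t (fcol f e).
Proof.
rewrite /ecol -amap_comp; congr (amap X _ t).
by apply: em_eq; rewrite /= emE.
Qed.

(** Operations of X with any number of entries; colours are read off afterwards by [prof], so that
    operations can be compared before their profiles are known to agree. *)
Definition Zop := {n & X (Cor n)}.

Definition prof (z : Zop) : seq (X eta) :=
  [seq ecol (projT2 z) i | i <- enum 'I_(projT1 z)].

(* [ev t W z] when the operation [W] of [A(T)] is given by a map from a corolla
   and [z] is the restriction of [t] along this map. *)
Definition ev (T : tree) (t : X T) (W : pop (treeOp T)) (z : Zop) : Prop :=
  exists n (f : tmap (Cor n) T), pfop f (gcor n) = W /\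
    z = existT (fun n => X (Cor n) : Type) n (amap X f t).

Lemma ev_ex (T : tree) (t : X T) W : rz W -> exists z, ev t W z.
Proof. by move=> [n [f E]]; exists (existT _ n (amap X f t)), n, f. Qed.

Lemma ev_rz (T : tree) (t : X T) W z : ev t W z -> rz W.
Proof. by move=> [n [f [E _]]]; exists n, f. Qed.

(** By [cor_ext] the operation [W] determines the map from the corolla that realises it. *)
Lemma ev_fun (T : tree) (t : X T) W z z' : ev t W z -> ev t W z' -> z = z'.
Proof.
move=> [n [f [E ->]]] [m [g [E' ->]]].
have nm : n = m by rewrite -(size_pfop_gcor f) E -E' size_pfop_gcor.
case: m / nm g E' => g E'; suff -> : f = g by [].
by apply: tmap_eq; apply: cor_ext; rewrite E E'.
Qed.

Lemma ev_map (S T : tree) (f : tmap S T) (t : X T) W z :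
  ev (amap X f t) W z -> ev t (pfop f W) z.
Proof.
move=> [n [g [<- ->]]]; exists n, (tcomp_map f g).
by rewrite pfop_compMor amap_comp.
Qed.

(** Realisability of [W] in [S] gives some value of [amap X f t] at [W], which [ev_map] identifies
    with the only value of [t] at the image of [W]. *)
Lemma ev_map' (S T : tree) (f : tmap S T) (t : X T) W z : rz W ->
  ev t (pfop f W) z -> ev (amap X f t) W z.
Proof.
move=> /(ev_ex (amap X f t)) [z' e'] e; have := ev_map e' => /(ev_fun e).
by move=> ->.
Qed.

Lemma ev_prof (T : tree) (t : X T) W z : ev t W z -> prof z = map (ecol t) (pr W).
Proof.
move=> [n [f [<- ->]]]; rewrite /prof /= -map_comp.
by apply: eq_map => i /=; rewrite ecol_map.
Qed.

Definition idZ (a : X eta) : Zop := existT (fun n => X (Cor n) : Type) 2 (amap X dg a).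

Lemma ev_id (T : tree) (t : X T) (e : edge T) : ev t (pid (e : col (treeOp T))) (idZ (ecol t e)).
Proof.
exists 2, (tcomp_map (em e) dg); rewrite pfop_compMor dgE pfop_id emE.
by split=> //; rewrite amap_comp.
Qed.

Lemma ecol_eta (a : X eta) : ecol a (tt : edge eta) = a.
Proof.
rewrite /ecol -[RHS](amap_id a); congr (amap X _ a).
by apply/esym/em_eq.
Qed.

Lemma prof_idZ a : prof (idZ a) = [:: a; a].
Proof. by have := ev_prof (ev_id a (tt : edge eta)); rewrite /= ecol_eta. Qed.

Lemma idZ_inj : injective idZ.
Proof. by move=> a b /(congr1 prof); rewrite !prof_idZ => -[]. Qed.

Lemma ev_self (z : Zop) : ev (projT2 z) (gcor (projT1 z)) z.
Proof.
case: z => n x /=; exists n, (tid_map (Cor n)); rewrite pfop_idMor.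
by rewrite amap_id.
Qed.

(** The symmetric groups act on the operations of X by restriction along the automorphisms of
    corollas. *)
Definition actR n (s : 'S_n) (z z' : Zop) : Prop :=
  exists2 W, IsAct s (gcor (projT1 z)) W & ev (projT2 z) W z'.

Lemma actR_ex n (s : 'S_n) z : size (prof z) = n -> exists z', actR s z z'.
Proof.
rewrite /prof size_map => sz; have [W a] := @IsAct_ex _ _ s (gcor (projT1 z)) sz.
have [z' e] := ev_ex (projT2 z) (rz_act a (rz_gen _)).
by exists z', W.
Qed.

Lemma actR_fun n (s : 'S_n) z z1 z2 : actR s z z1 -> actR s z z2 -> z1 = z2.
Proof. by move=> [W a e] [W' /(IsAct_fun a) <-]; apply: ev_fun e. Qed.

Lemma ev_act (T : tree) (t : X T) n (s : 'S_n) U W z z' :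
  ev t U z -> IsAct s U W -> actR s z z' -> ev t W z'.
Proof.
move=> [m [f [<- ->]]] a [V b e] /=.
have := pfop_act f b => /(IsAct_fun a) ->; exact: ev_map e.
Qed.

Lemma ev_actR (T : tree) (t : X T) n (s : 'S_n) U W z z' :
  ev t U z -> IsAct s U W -> ev t W z' -> actR s z z'.
Proof.
move=> e a e'; have sz : size (prof z) = n.
  by rewrite (ev_prof e) size_map (IsAct_size a).
have [z1 b] := actR_ex s sz.
by rewrite (ev_fun e' (ev_act e a b)).
Qed.

Lemma ev_col (T : tree) (t t' : X T) (v : vertex T) l (h : listing v l) z e :
  ev t (pg h) z -> ev t' (pg h) z -> adj v e -> ecol t e = ecol t' e.
Proof.
move=> /ev_prof E1 /ev_prof; rewrite E1 => /eq_in_map E ve; apply: E.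
by rewrite (mem_listing h).
Qed.

(** Injectivity of the Segal map, phrased with evaluations. The clause on edges carries the
    information for trees without vertices; in the presence of a vertex [qinj_gen] deduces it from
    the other one. *)
Definition qinj := forall (T : tree) (t t' : X T),
  (forall e, ecol t e = ecol t' e) ->
  (forall v, exists l (h : listing v l) z, ev t (pg h) z /\ ev t' (pg h) z) -> t = t'.

(* [compR p q u v z] when [z] is the composite of the first factor [u] with [p]
   entries before the last one and the second factor [v] at its entry [q]. *)
Definition compR (p q : nat) (u v z : Zop) : Prop :=
  exists (T : tree) (t : X T) (x y : vertex T) c l d1 d2
    (hx : listing x (rcons l c)) (hy : listing y (d1 ++ c :: d2)) (W : pop (treeOp T)),
  [/\ [/\ x != y, size l = p & size d1 = q], ev t (pg hx) u, ev t (pg hy) v,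
     @IsComp (treeOp T) l c d1 d2 (pg hx) (pg hy) W & ev t W z].

Lemma compR_intro (S T : tree) (f : tmap S T) (t : X T) (x y : vertex S) c l d1 d2
    (hx : listing x (rcons l c)) (hy : listing y (d1 ++ c :: d2)) (W : pop (treeOp S)) u v z :
  x != y -> @IsComp (treeOp S) l c d1 d2 (pg hx) (pg hy) W ->
  ev t (pfop f (pg hx)) u -> ev t (pfop f (pg hy)) v -> ev t (pfop f W) z ->
  compR (size l) (size d1) u v z.
Proof.
move=> xy C eu ev_ ez; exists S, (amap X f t), x, y, c, l, d1, d2, hx, hy, W.
split=> //.
- by apply: ev_map' eu; apply: rz_gen.
- by apply: ev_map' ev_; apply: rz_gen.
- by apply: ev_map' ez; apply: rz_comp C.
Qed.

Hypothesis Q : qinj.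

Lemma qinj_gen (T : tree) (t t' : X T) (v0 : vertex T) :
  (forall v, exists l (h : listing v l) z, ev t (pg h) z /\ ev t' (pg h) z) -> t = t'.
Proof.
move=> H; apply: Q => // e; have [v ve] := edge_vertex v0 e.
by have [l [h [z [e1 e2]]]] := H v; apply: ev_col e1 e2 ve.
Qed.

(** Both realisations are pulled back to one abstract two-vertex tree. There the two elements agree
    on both vertices, hence are equal by [Q], and so are their restrictions along the composite. *)
Lemma compR_fun p q u v z z' : compR p q u v z -> compR p q u v z' -> z = z'.
Proof.
move=> [T [t [x [y [c [l [d1 [d2 [hx [hy [W [[xy sl s1] eu ev_ C ez]]]]]]]]]]]].
move=> [T' [t' [x' [y' [c' [l' [d1' [d2' [hx' [hy' [W' [[xy' sl' s1'] eu' ev_' C' ez']]]]]]]]]]]].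
have s2 : size d2 = size d2'.
  have := congr1 size (etrans (esym (ev_prof ev_)) (ev_prof ev_')).
  by rewrite /= !size_map !size_cat /= s1 s1' => /addnI [].
have [S [a [b [k [m [f1 [f2 [[ab tV] ha hb [sm sf1 sf2]]]]]]]]] := T2_ex p q (size d2).
have [||| f [fx fy fc fl [g1 g2]]] := sub2_tmap ha hb hx hy ab tV xy; rewrite ?sl ?s1 ?sm ?sf1 //.
have [||| f' [fx' fy' fc' fl' [g1' g2']]] := sub2_tmap ha hb hx' hy' ab tV xy';
  rewrite ?sl' ?s1' ?sm ?sf1 -?s2 //.
have [V CV] := comp_pg ha hb.
have EW : W = pfop f V.
  by have := pfop_comp f CV; rewrite fx fy fc fl g1 g2 => /(IsComp_fun C).
have EW' : W' = pfop f' V.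
  by have := pfop_comp f' CV; rewrite fx' fy' fc' fl' g1' g2' => /(IsComp_fun C').
have Et : amap X f t = amap X f' t'.
  apply: (qinj_gen a) => w; case: (tV w) => ->.
  - exists _, ha, u; split; (apply: ev_map'; first exact: rz_gen); by rewrite ?fx ?fx'.
  - exists _, hb, v; split; (apply: ev_map'; first exact: rz_gen); by rewrite ?fy ?fy'.
have rV : rz V := rz_comp ab CV.
rewrite EW in ez; rewrite EW' in ez'.
have h1 := ev_map' rV ez; have h2 := ev_map' rV ez'.
by rewrite Et in h1; apply: ev_fun h1 h2.
Qed.

(** * Maps out of a subpresheaf from a functional relation *)

Section GlueK.
Variables (T : tree) (K : pop (treeOp T) -> Zop -> Prop) (P : subrep T).
Hypothesis Kfun : forall W z z', K W z -> K W z' -> z = z'.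

Definition good (R : tree) (f : tmap R T) (x : X R) :=
  forall W z, ev x W z -> K (pfop f W) z.

Lemma good_fun (R : tree) (f : tmap R T) x x' : good f x -> good f x' -> x = x'.
Proof.
move=> g g'; apply: Q.
- move=> e; apply: idZ_inj; apply: Kfun; first exact: g (ev_id x e).
  exact: g' (ev_id x' e).
- move=> v; have h := listing_enum v.
  have [z e] := ev_ex x (rz_gen h); have [z' e'] := ev_ex x' (rz_gen h).
  by exists _, h, z; split=> //; rewrite (Kfun (g _ _ e) (g' _ _ e')).
Qed.

Lemma good_map (R R' : tree) (f : tmap R T) (r : tmap R' R) x :
  good f x -> good (tcomp_map f r) (amap X r x).
Proof. by move=> g W z /ev_map /g; rewrite /= pfop_compMor. Qed.

Hypothesis Pgood : forall R (f : tmap R T), P R f -> exists x, good f x.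

(** An element respecting [K] over a given map is unique ([good_fun]), and respecting [K] is stable
    under restriction ([good_map]); hence arbitrary choices are natural. *)
Lemma glueK : exists b : hom (subrep_astroidal P) X,
  forall R (f : sub_ob P R), good (sval f) (hmap b f).
Proof.
pose F R (f : sub_ob P R) : X R := sval (cid (Pgood (svalP f))).
have Fg R (f : sub_ob P R) : good (sval f) (F R f) by rewrite /F; case: cid.
have nat R R' (r : tmap R' R) (f : sub_ob P R) :
    F R' (amap (subrep_astroidal P) r f) = amap X r (F R f).
  apply: (good_fun (Fg R' _)); apply: good_map; exact: Fg.
by exists (@Hom (subrep_astroidal P) X F (fun S R r f => nat R S r f)).
Qed.
End GlueK.

End Evaluation.

Section Yoneda.
Variables (X : astroidal) (T : tree).

Lemma yo_nat (t : X T) (R S : tree) (r : tmap R S) (f : representable T S) :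
  amap X (amap (representable T) r f) t = amap X r (amap X f t).
Proof. exact: amap_comp. Qed.

Definition yo (t : X T) : hom (representable T) X :=
  @Hom (representable T) X (fun S f => amap X f t) (fun S R r f => yo_nat t r f).

Lemma hom_eq (A B : astroidal) (b b' : hom A B) :
  (forall S (f : A S), hmap b f = hmap b' f) -> b = b'.
Proof.
case: b b' => [m n] [m' n'] /= E.
have {}E : m = m' by apply: functional_extensionality_dep => S; apply: funext => f.
by case: m' / E n' => n'; rewrite (Prop_irrelevance n n').
Qed.

Lemma yoK (b : hom (representable T) X) : b = yo (hmap b (tid_map T)).
Proof.
apply: hom_eq => S f /=; rewrite -(hmap_nat b f (tid_map T)) /=.
by rewrite tcomp_1map.
Qed.
End Yoneda.

(** * The cyclic operad of an astroidal set *)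

(** The three vertices and the three edges would form a cycle of length six in the incidence
    graph. *)
Lemma no_triangle (T : tree) (x y z : vertex T) (k m e : edge T) :
  x != y -> y != z -> x != z -> adj x k -> adj y k -> adj y m -> adj z m ->
  adj x e -> adj z e -> False.
Proof.
move=> xy yz xz xk yk ym zm xe ze.
have three (v1 v2 v3 : vertex T) d : v1 != v2 -> v2 != v3 -> v1 != v3 -> adj v1 d -> adj v2 d ->
    adj v3 d -> False.
  move=> n12 n23 n13 a1 a2 a3; have [E|E] := adj_third n12 a1 a2 a3.
    by rewrite E eqxx in n13.
  by rewrite E eqxx in n23.
have km : k != m by apply/eqP => E; subst m; apply: (three x y z k).
have ke : k != e by apply/eqP => E; subst e; apply: (three x y z k).
have me : m != e by apply/eqP => E; subst e; apply: (three x y z m).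
have : ucycle (incidence (@adj T)) [:: inl x; inr k; inl y; inr m; inl z; inr e].
  by rewrite /ucycle /= xk yk ym zm xe ze /= !inE /= !negb_or /= xy xz km ke yz me.
by move/tree_acyclic.
Qed.

(** Here [a] stands for [p], and [b] for [q] and [r] merged along [c]. This recognises the inner
    faces of a three-vertex tree, which associativity needs. *)
Lemma face3 (T S : tree) (p q r : vertex T) (a b : vertex S) (f : cycMor (treeOp S) (treeOp T))
    c l1 d1 d2 lp la lb (hq : listing q (rcons l1 c)) (hr : listing r (d1 ++ c :: d2))
    (hp : listing p lp) (ha : listing a la) (hb : listing b lb) W :
  p != q -> q != r -> p != r -> (forall v, [\/ v = p, v = q | v = r]) ->
  a != b -> twoV a b -> injective (fcol f) ->
  @IsComp (treeOp T) l1 c d1 d2 (pg hq) (pg hr) W ->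
  pfop f (pg ha) = pg hp -> pfop f (pg hb) = W -> inner_coface f c.
Proof.
move=> pq qr pr' V3 ab tV fI C fa fb.
pose Q v := if v == p then a else b.
have Qq : Q q = b by rewrite /Q eq_sym (negbTE pq).
have Qr : Q r = b by rewrite /Q eq_sym (negbTE pr').
have Qp : Q p = a by rewrite /Q eqxx.
have qc : adj q c by rewrite -(mem_listing hq) mem_rcons mem_head.
have rc : adj r c by rewrite -(mem_listing hr) mem_cat mem_head orbT.
have pc : ~~ adj p c.
  apply/negP => pc; have [E|E] := adj_third qr qc rc pc; first by rewrite E eqxx in pq.
  by rewrite E eqxx in pr'.
have ap : map (fcol f) la = lp := congr1 (@pr _) fa.
have bW : map (fcol f) lb = d1 ++ l1 ++ d2.
  by have [_ _ <-] := IsComp_pr C; rewrite -fb.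
have hb' : listing (Q q) lb by rewrite Qq.
apply: (@inner_cofaceI _ _ c q r Q f l1 d1 d2 lb hq hr hb') => //.
- move=> e; split=> [[e' Ee]|/eqP ne].
    have [v ve'] := edge_vertex a e'; case: (tV v) => Ev; subst v.
      have : e \in lp by rewrite -ap -Ee map_f // (mem_listing ha).
      by rewrite (mem_listing hp) => pe E; rewrite E (negbTE pc) in pe.
    have : e \in d1 ++ l1 ++ d2 by rewrite -bW -Ee map_f // (mem_listing hb).
    by rewrite (comp_mem qr hq hr) => /andP [/eqP].
  have [v ve] := edge_vertex p e.
  have [] : v = p \/ (v = q \/ v = r) by case: (V3 v); auto.
    move=> E; subst v; rewrite -(mem_listing hp) -ap in ve.
    by case/mapP: ve => e' _ ->; exists e'.
  move=> E; have : e \in d1 ++ l1 ++ d2.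
    by rewrite (comp_mem qr hq hr) ne; case: E => <-; rewrite ve ?orbT.
  by rewrite -bW => /mapP [e' _ ->]; exists e'.
- by move=> w; case: (tV w) => ->; [exists p|exists q].
- have nab : a <> b by apply/eqP.
  have nba : b <> a by apply/eqP; rewrite eq_sym.
  move=> v w; split; last first.
    by case=> [->//|[[-> ->]|[-> ->]]]; rewrite Qq Qr.
  case: (V3 v) => ->; case: (V3 w) => ->; rewrite ?Qp ?Qq ?Qr //; auto.
- move=> v vq vr; case: (V3 v) => // ->; rewrite Qp.
  exact: maps_vertexI fa.
- rewrite (pg_eq hb' hb Qq erefl) fb; exact: C.
Qed.

Lemma map_rcons_inv (A B : Type) (f : A -> B) s c x : map f s = rcons c x ->
  exists L i, [/\ s = rcons L i, map f L = c & f i = x].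
Proof.
case: (lastP s) => [|L i]; first by case: c.
by rewrite map_rcons => /rcons_inj [<- <-]; exists L, i.
Qed.

Lemma map_cat_inv (A B : Type) (f : A -> B) s d1 x d2 : map f s = d1 ++ x :: d2 ->
  exists D1 i D2, [/\ s = D1 ++ i :: D2, map f D1 = d1, f i = x & map f D2 = d2].
Proof.
elim: d1 s => [|y d1 IH] [|i s] //= [].
  by move=> <- <-; exists [::], i, s.
by move=> <- /IH [D1 [j [D2 [-> <- <- <-]]]]; exists (i :: D1), j, D2.
Qed.

Section OperadOf.
Variable X : astroidal.
Hypothesis Q : qinj X.

(** The surjectivity half of the Segal condition; [cl] expresses that the prescribed values have
    matching colours along the edges. *)
Definition glue (T : tree) := forall (uu : vertex T -> Zop X) (L : vertex T -> seq (edge T))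
  (hL : forall v, listing v (L v)) (cl : edge T -> X eta),
  (forall v, prof (uu v) = map cl (L v)) -> exists t : X T, forall v, ev t (pg (hL v)) (uu v).

(** Composition rests on gluing over two vertices and associativity on gluing over three. Isolating
    these instances lets the operad be built from the Kan condition before general gluing is
    available. *)
Definition glue_twoV := forall (T : tree) (x y : vertex T), x != y -> twoV x y -> glue T.

Definition glue_threeV := forall (T : tree) (x y z : vertex T) (k m : edge T),
  x != y -> y != z -> x != z -> (forall v, [\/ v = x, v = y | v = z]) ->
  joins k x y -> joins m y z -> glue T.

Lemma glue_pair (T : tree) (a b : vertex T) la lb (ha : listing a la) (hb : listing b lb)
    (u v : Zop X) (cl : edge T -> X eta) : glue T -> a != b -> twoV a b ->
  prof u = map cl la -> prof v = map cl lb ->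
  exists t : X T, ev t (pg ha) u /\ ev t (pg hb) v.
Proof.
move=> G ab tV pu pv; have ba : (b == a) = false by rewrite eq_sym (negbTE ab).
pose L w := if w == a then la else lb.
have hL w : listing w (L w) by rewrite /L; case: (tV w) => ->; rewrite ?eqxx ?ba.
have [|t et] := G (fun w => if w == a then u else v) L hL cl.
  by move=> w; rewrite /L; case: eqP.
exists t; split.
  by have := et a; rewrite eqxx; congr (ev _ _ _); apply: pg_eq; rewrite // /L eqxx.
by have := et b; rewrite ba; congr (ev _ _ _); apply: pg_eq; rewrite // /L ba.
Qed.

Lemma actR_prof n (s : 'S_n) (z z' : Zop X) : actR s z z' -> prof z' = permute s (prof z).
Proof. by move=> [W a e]; rewrite (ev_prof e) (IsAct_pr a) map_permute. Qed.

Lemma actR1 n (z z' : Zop X) : actR (1%g : 'S_n) z z' -> z' = z.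
Proof. by move=> [W /lact1 -> e]; apply: ev_fun e (ev_self z). Qed.

Lemma actRM n (s t : 'S_n) (z z1 z2 : Zop X) : actR s z z1 -> actR t z1 z2 -> actR (t * s)%g z z2.
Proof.
move=> [W1 a1 e1] b.
have sz : size (pr W1) = n.
  by rewrite (IsAct_pr a1) size_permute // (IsAct_size a1).
have [W2 a2] := IsAct_ex t sz.
exists W2; first exact: lactM a1 a2.
exact: ev_act e1 a2 b.
Qed.

Hypothesis G2 : glue_twoV.

Lemma glue2 (u v : Zop X) c x d1 d2 : prof u = rcons c x -> prof v = d1 ++ x :: d2 ->
  exists (T : tree) (t : X T) (a b : vertex T) k l m1 m2
    (ha : listing a (rcons l k)) (hb : listing b (m1 ++ k :: m2)),
  [/\ a != b, twoV a b, ev t (pg ha) u, ev t (pg hb) v &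
     [/\ size l = size c, size m1 = size d1 & size m2 = size d2]].
Proof.
move=> pu pv; have [T [a [b [k [l [m1 [m2 [[ab tV] ha hb [sl s1 s2]]]]]]]]] :=
  T2_ex (size c) (size d1) (size d2).
have [|cl] := @fc_ex _ _ (k :: m1 ++ l ++ m2) (x :: d1 ++ c ++ d2) x (listing_common ab ha hb).
  by rewrite /= !size_cat sl s1 s2.
rewrite /= !map_cat => -[Ec] /cat_inj [|E1 /cat_inj [|El E2]]; rewrite ?size_map //.
have [||t [ea eb]] := @glue_pair T a b _ _ ha hb u v cl (G2 ab tV) ab tV.
- by rewrite pu map_rcons El Ec.
- by rewrite pv map_cat /= E1 Ec E2.
by exists T, t, a, b, k, l, m1, m2, ha, hb.
Qed.

Lemma compR_ex (u v : Zop X) c x d1 d2 : prof u = rcons c x -> prof v = d1 ++ x :: d2 ->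
  exists z, compR (size c) (size d1) u v z.
Proof.
move=> pu pv; have [T [t [a [b [k [l [m1 [m2 [ha [hb [ab _ ea eb [sl s1 _]]]]]]]]]]]] := glue2 pu pv.
have [W C] := comp_pg ha hb; have [z ez] := ev_ex t (rz_comp ab C).
by exists z, T, t, a, b, k, l, m1, m2, ha, hb, W.
Qed.

Lemma compR_prof (u v z : Zop X) c x d1 d2 : prof u = rcons c x -> prof v = d1 ++ x :: d2 ->
  compR (size c) (size d1) u v z -> prof z = d1 ++ c ++ d2.
Proof.
move=> pu pv [T [t [a [b [k [l [m1 [m2 [ha [hb [W [[ab sl s1] ea eb C ez]]]]]]]]]]]].
have [_ _ pW] := IsComp_pr C.
have := ev_prof ea; rewrite pu /= map_rcons => /rcons_inj [-> _].
have := ev_prof eb; rewrite pv /= map_cat => /cat_inj [|-> [_ ->]]; first by rewrite size_map.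
by rewrite (ev_prof ez) pW !map_cat.
Qed.

Definition XopT (c : seq (X eta)) := {z : Zop X | prof z = c}.

Lemma Xact_subproof n (s : 'S_n) c (h : size c = n) (x : XopT c) :
  exists z', actR s (sval x) z'.
Proof. by apply: actR_ex; rewrite (svalP x). Qed.

Definition Xact n (s : 'S_n) c (h : size c = n) (x : XopT c) : XopT (permute s c) :=
  let z := cid (Xact_subproof s h x) in
  exist _ (sval z) (etrans (actR_prof (svalP z)) (congr1 (permute s) (svalP x))).

Definition Xid (a : X eta) : XopT [:: a; a] := exist _ (idZ a) (prof_idZ a).

Definition Xcomp c x d1 d2 (u : XopT (rcons c x)) (v : XopT (d1 ++ x :: d2)) :
    XopT (d1 ++ c ++ d2) :=
  let z := cid (compR_ex (svalP u) (svalP v)) in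
  exist _ (sval z) (compR_prof (svalP u) (svalP v) (svalP z)).

Definition Xdata : cycData := @CycData (X eta) XopT Xact Xid Xcomp.

Definition zv (c : seq (X eta)) (x : @op Xdata c) : Zop X := sval (x : XopT c).

Lemma zv_inj c (x y : @op Xdata c) : zv x = zv y -> x = y.
Proof.
case: x y => [z e] [z' e'] /= E; case: z' / E e' => e'.
by rewrite (Prop_irrelevance e e').
Qed.

Lemma zv_cst p q (e : p = q) (x : @op Xdata p) : zv (cst e x) = zv x.
Proof. by case: q / e. Qed.

Lemma zv_prof c (x : @op Xdata c) : prof (zv x) = c.
Proof. exact: svalP x. Qed.

Lemma zv_act n (s : 'S_n) c (h : size c = n) (x : @op Xdata c) :
  actR s (zv x) (zv (act s h x)).
Proof. by rewrite /zv /=; case: cid. Qed.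

Lemma zv_comp c x d1 d2 (u : @op Xdata (rcons c x)) (v : @op Xdata (d1 ++ x :: d2)) :
  compR (size c) (size d1) (zv u) (zv v) (zv (comp d1 d2 u v)).
Proof. by rewrite /zv /=; case: cid. Qed.

(* The composable pair is realized in a tree with two vertices, so that both
   sides of the axiom are restrictions of one element of [X] along one operation
   of that tree. *)
Lemma Xlaw_label (f : nat -> X eta) a l d1 d2 (u v : Zop X) :
  uniq (a :: d1 ++ l ++ d2) ->
  prof u = rcons (map f l) (f a) -> prof v = map f d1 ++ f a :: map f d2 ->
  exists (T : tree) (t : X T) (x y : vertex T) (g : nat -> edge T)
    (hx : listing x (rcons (map g l) (g a))) (hy : listing y (map g d1 ++ g a :: map g d2)),
  [/\ x != y, ev t (pg hx) u & ev t (pg hy) v].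
Proof.
move=> U pu pv; have [T [t [x [y [k [m [m1 [m2 [hx [hy [xy _ ex ey [sl s1 s2]]]]]]]]]]]] := glue2 pu pv.
rewrite !size_map in sl s1 s2.
have [|g] := @fc_ex _ _ (a :: d1 ++ l ++ d2) (k :: m1 ++ m ++ m2) k U.
  by rewrite /= !size_cat sl s1 s2.
rewrite /= !map_cat => -[Ec] /cat_inj [|E1 /cat_inj [|El E2]]; rewrite ?size_map //.
by subst k m1 m m2; exists T, t, x, y, g, hx, hy.
Qed.

Lemma Xlaw_side (T : tree) (t : X T) (x : vertex T) (g : nat -> edge T) p p' n (s : 'S_n)
    (hx : listing x (map g p)) u u' : ev t (pg hx) u -> actR s u u' ->
  n = size p -> permute s p = p' -> exists hx' : listing x (map g p'), ev t (pg hx') u'.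
Proof.
move=> eu a sp <-; have sz : size (map g p) = n by rewrite size_map.
have hx' := listing_permute s sz hx; rewrite -map_permute in hx'.
by exists hx'; apply: (ev_act eu _ a); apply: gen_act' => //; rewrite map_permute.
Qed.

Lemma Xlaw_equiv (f : nat -> X eta) (a : nat) (l d1 d2 l' d1' d2' : seq nat)
      (n1 n2 n3 : nat) (s : 'S_n1) (t : 'S_n2) (r : 'S_n3) (u v u' v' z z' : Zop X) :
    uniq (a :: d1 ++ l ++ d2) ->
    permute s (rcons l a) = rcons l' a ->
    permute t (d1 ++ a :: d2) = d1' ++ a :: d2' ->
    permute r (d1 ++ l ++ d2) = d1' ++ l' ++ d2' ->
    prof u = rcons (map f l) (f a) -> prof v = map f d1 ++ f a :: map f d2 ->
    n1 = size (rcons l a) -> n2 = size (d1 ++ a :: d2) -> n3 = size (d1 ++ l ++ d2) ->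
    actR s u u' -> actR t v v' -> compR (size l) (size d1) u v z ->
    compR (size l') (size d1') u' v' z' -> actR r z z'.
Proof.
move=> U Hs Ht Hr pu pv e1 e2 e3 au av Cz Cz'.
have [T [t0 [x [y [g [hx [hy [xy ex ey]]]]]]]] := Xlaw_label U pu pv.
have Er : permute r (map g d1 ++ map g l ++ map g d2) = map g d1' ++ map g l' ++ map g d2'.
  by rewrite -!map_cat -map_permute Hr !map_cat.
have [hx' ex'] : exists hx' : listing x (rcons (map g l') (g a)), ev t0 (pg hx') u'.
  by move: hx ex; rewrite -!map_rcons => hx ex; apply: Xlaw_side ex au e1 Hs.
have [hy' ey'] : exists hy' : listing y (map g d1' ++ g a :: map g d2'), ev t0 (pg hy') v'.
  by move: hy ey; rewrite -!map_cons -!map_cat => hy ey; apply: Xlaw_side ey av e2 Ht.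
have [W C] := comp_pg hx hy; have [W' C'] := comp_pg hx' hy'.
have aW : IsAct r W W'.
  by apply: (comp_relist xy _ Er C C'); rewrite -!map_cat size_map.
have [w ew] := ev_ex t0 (rz_comp xy C); have [w' ew'] := ev_ex t0 (rz_comp xy C').
have Ez : z = w.
  apply: (compR_fun Q Cz); exists T, t0, x, y, (g a), (map g l), (map g d1), (map g d2), hx, hy, W.
  by rewrite !size_map.
have Ez' : z' = w'.
  apply: (compR_fun Q Cz'); exists T, t0, x, y, (g a), (map g l'), (map g d1'), (map g d2'), hx', hy', W'.
  by rewrite !size_map.
by rewrite Ez Ez'; apply: ev_actR ew aW ew'.
Qed.

Lemma Xlaw_exchange (f : nat -> X eta) (a : nat) (l d1 d2 d' l1' l2' : seq nat)
      (n1 n2 n3 : nat) (s : 'S_n1) (t : 'S_n2) (r : 'S_n3) (u v u' v' z z' : Zop X) :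
    uniq (a :: d1 ++ l ++ d2) ->
    permute s (rcons l a) = l1' ++ a :: l2' ->
    permute t (d1 ++ a :: d2) = rcons d' a ->
    permute r (d1 ++ l ++ d2) = l1' ++ d' ++ l2' ->
    prof u = rcons (map f l) (f a) -> prof v = map f d1 ++ f a :: map f d2 ->
    n1 = size (rcons l a) -> n2 = size (d1 ++ a :: d2) -> n3 = size (d1 ++ l ++ d2) ->
    actR s u u' -> actR t v v' -> compR (size l) (size d1) u v z ->
    compR (size d') (size l1') v' u' z' -> actR r z z'.
Proof.
move=> U Hs Ht Hr pu pv e1 e2 e3 au av Cz Cz'.
have [T [t0 [x [y [g [hx [hy [xy ex ey]]]]]]]] := Xlaw_label U pu pv.
have Er : permute r (map g d1 ++ map g l ++ map g d2) = map g l1' ++ map g d' ++ map g l2'.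
  by rewrite -!map_cat -map_permute Hr !map_cat.
have [hx' ex'] : exists hx' : listing x (map g l1' ++ g a :: map g l2'), ev t0 (pg hx') u'.
  by move: hx ex; rewrite -map_rcons -map_cons -map_cat => hx ex; apply: Xlaw_side ex au e1 Hs.
have [hy' ey'] : exists hy' : listing y (rcons (map g d') (g a)), ev t0 (pg hy') v'.
  by move: hy ey; rewrite -map_rcons -map_cons -map_cat => hy ey; apply: Xlaw_side ey av e2 Ht.
have [W C] := comp_pg hx hy; have [W' C'] := comp_pg hy' hx'.
have aW : IsAct r W W'.
  by apply: (comp_swap xy _ Er C C'); rewrite -!map_cat size_map.
have yx : y != x by rewrite eq_sym.
have [w ew] := ev_ex t0 (rz_comp xy C); have [w' ew'] := ev_ex t0 (rz_comp yx C').
have Ez : z = w.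
  apply: (compR_fun Q Cz); exists T, t0, x, y, (g a), (map g l), (map g d1), (map g d2), hx, hy, W.
  by rewrite !size_map.
have Ez' : z' = w'.
  apply: (compR_fun Q Cz'); exists T, t0, y, x, (g a), (map g d'), (map g l1'), (map g l2'), hy', hx', W'.
  by rewrite !size_map.
by rewrite Ez Ez'; apply: ev_actR ew aW ew'.
Qed.

(** A two-vertex tree is mapped to the corolla with its second vertex going to an identity and its
    composite to the generator. Restricting [z] along this codegeneracy exhibits [z] as its own
    composite with an identity. *)
Lemma Xlaw_unitr (z : Zop X) c x : prof z = rcons c x -> compR (size c) 0 z (idZ x) z.
Proof.
move=> pz; case: z pz => n t pz; have [L [i [Ei EL Ex]]] := map_rcons_inv pz.
have [S [a [b [k [l [m1 [m2 [[ab tV] ha hb [sl s1 s2]]]]]]]]] := T2_ex (size c) 0 1.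
case: m1 s1 hb => // _ hb; case: m2 s2 hb => [|e []] // _ hb.
have pG : pr (gcor n) = rcons L i by [].
have [|||f [fa fb fk fl [_ f2]]] := @T2_mor _ _ _ _ _ _ _ ab tV ha hb _ (gcor n)
   (pid (i : col (treeOp (Cor n)))) L i [::] [:: i] pG erefl => //.
  by rewrite -EL size_map in sl; rewrite sl.
(* [codegeneracyI] expects the edge shared with [a] as second edge of the bivalent vertex; relisting
   is harmless since identities are symmetric. *)
have hb' : listing b [:: e; k].
  by apply: (perm_trans _ hb); apply: (permEl (perm_catC [:: e] [:: k])).
have fb' : pfop f (pg hb') = pid (i : col (treeOp (Cor n))).
  have [s Es] := listing_perm hb hb'.
  have := pfop_act f (gen_act' hb hb' erefl Es); rewrite fb; exact: lact_id.
have fm : map (fcol f) (rcons l k) = enum 'I_n by rewrite map_rcons fl fk Ei.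
have hn : listing (cv n) (map (fcol f) (rcons l k)) by rewrite fm; apply: cor_listing.
have F : is_tree_map f.
  have ba : b != a by rewrite eq_sym.
  have tV' : twoV b a by move=> w; case: (tV w); auto.
  apply: (@codegeneracyI S (Cor n) b a (cv n) f e k i (rcons l k) ba tV' (@cvE n) hb' ha hn) => //.
    by rewrite -(mem_listing ha) mem_rcons mem_head.
  by rewrite fa; apply: pg_eq; rewrite // fm.
have [W C] := comp_pg ha hb.
have EW : pfop f W = gcor n.
  have := pfop_comp f C; rewrite fa fb fl fk f2; exact: lunitr.
rewrite -sl; apply: (compR_intro (f := TMap F) (t := t) ab C) => /=.
- by rewrite fa; exact: ev_self (existT _ n t).
- by rewrite fb -Ex; apply: ev_id.
- by rewrite EW; exact: ev_self (existT _ n t).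
Qed.

Lemma Xlaw_unitl (z : Zop X) x d1 d2 : prof z = d1 ++ x :: d2 -> compR 1 (size d1) (idZ x) z z.
Proof.
move=> pz; case: z pz => n t pz; have [D1 [i [D2 [Ei E1 Ex E2]]]] := map_cat_inv pz.
have [S [a [b [k [l [m1 [m2 [[ab tV] ha hb [sl s1 s2]]]]]]]]] := T2_ex 1 (size d1) (size d2).
case: l sl ha => [|e []] // _ ha.
have pG : pr (gcor n) = D1 ++ i :: D2 by [].
have [|||f [fa fb fk fl [f1 f2]]] := @T2_mor _ _ _ _ _ _ _ ab tV ha hb _ 
   (pid (i : col (treeOp (Cor n)))) (gcor n) [:: i] i D1 D2 erefl pG => //.
- by rewrite -E1 size_map in s1; rewrite s1.
- by rewrite -E2 size_map in s2; rewrite s2.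
have fm : map (fcol f) (m1 ++ k :: m2) = enum 'I_n by rewrite map_cat /= f1 f2 fk Ei.
have hn : listing (cv n) (map (fcol f) (m1 ++ k :: m2)) by rewrite fm; apply: cor_listing.
have F : is_tree_map f.
  apply: (@codegeneracyI S (Cor n) a b (cv n) f e k i (m1 ++ k :: m2) ab tV (@cvE n) ha hb hn) => //.
    by rewrite -(mem_listing hb) mem_cat mem_head orbT.
  by rewrite fb; apply: pg_eq; rewrite // fm.
have [W C] := comp_pg ha hb.
have EW : pfop f W = gcor n.
  have := pfop_comp f C; rewrite fa fb fl fk f1 f2; exact: lunitl.
rewrite -s1; apply: (compR_intro (f := TMap F) (t := t) ab C) => /=.
- by rewrite fa -Ex; apply: ev_id.
- by rewrite fb; exact: ev_self (existT _ n t).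
- by rewrite EW; exact: ev_self (existT _ n t).
Qed.
End OperadOf.

(** The hypotheses are the multiplicities of one edge in the three listings and the constraints of
    the tree: [x] and [y] share only [k], [y] and [z] only [m], and [x] and [z] nothing. *)
Lemma T3_count_arith (kb mb xb yb zb : bool) (c d1 d2 g1 g2 : nat) :
  c + kb = xb -> d1 + kb + d2 + mb = yb -> g1 + mb + g2 = zb ->
  xb && yb ==> kb -> yb && zb ==> mb -> xb && zb = false ->
  kb + (mb + (c + (d1 + (d2 + (g1 + g2))))) <= 1.
Proof. by case: kb; case: mb; case: xb; case: yb; case: zb => //=; lia. Qed.

Lemma uniq_T3_perm (A : eqType) (k m : A) C D1 D2 G1 G2 :
  uniq (k :: m :: C ++ D1 ++ D2 ++ G1 ++ G2) ->
  uniq (m :: G1 ++ (D1 ++ C ++ D2) ++ G2) /\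
  uniq (k :: (G1 ++ D1) ++ C ++ (D2 ++ G2)).
Proof.
move=> U; split; apply: uniq_count => i;
  have := count_uniq_mem i U; rewrite /= !count_cat;
  by case: (i \in _); move: (count_mem i C) (count_mem i D1) (count_mem i D2)
    (count_mem i G1) (count_mem i G2); case: (k == i); case: (m == i) => /=; clear; lia.
Qed.

Section ThreeVertices.
Variables (T : tree) (x y z : vertex T) (k m : edge T).
Variables (C D1 D2 G1 G2 : seq (edge T)).
Hypotheses (xy : x != y) (yz : y != z) (xz : x != z).
Variables (hx : listing x (rcons C k)) (hy : listing y (D1 ++ k :: rcons D2 m))
  (hz : listing z (G1 ++ m :: G2)).

Lemma T3_count e : count_mem e (k :: m :: C ++ D1 ++ D2 ++ G1 ++ G2) <= 1.
Proof.
have cx : count_mem e C + (k == e) = adj x e.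
  by rewrite -(mem_listing hx) -(count_uniq_mem _ (listing_uniq hx)) -cats1 count_cat /= addn0.
have cy : count_mem e D1 + (k == e) + count_mem e D2 + (m == e) = adj y e.
  rewrite -(mem_listing hy) -(count_uniq_mem _ (listing_uniq hy)) -cats1 count_cat /= count_cat /=.
  by rewrite addn0 !addnA.
have cz : count_mem e G1 + (m == e) + count_mem e G2 = adj z e.
  by rewrite -(mem_listing hz) -(count_uniq_mem _ (listing_uniq hz)) count_cat /= addnA.
have xk : adj x k by rewrite -(mem_listing hx) mem_rcons mem_head.
have yk : adj y k by rewrite -(mem_listing hy) mem_cat mem_head orbT.
have ym : adj y m by rewrite -(mem_listing hy) mem_cat inE mem_rcons mem_head !orbT.
have zm : adj z m by rewrite -(mem_listing hz) mem_cat mem_head orbT.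
have exy : adj x e && adj y e ==> (k == e).
  by apply/implyP => /andP [xe ye]; apply/eqP; apply: (two_common xy).
have eyz : adj y e && adj z e ==> (m == e).
  by apply/implyP => /andP [xe ye]; apply/eqP; apply: (two_common yz).
have exz : adj x e && adj z e = false.
  apply/negP => /andP [xe ze]; exact: (no_triangle xy yz xz xk yk ym zm xe ze).
by rewrite /= !count_cat; apply: T3_count_arith cx cy cz exy eyz exz.
Qed.

Lemma T3_uniq : uniq (k :: m :: C ++ D1 ++ D2 ++ G1 ++ G2).
Proof. exact: uniq_count T3_count. Qed.
End ThreeVertices.

Section OperadOf.
Variable X : astroidal.
Hypothesis Q : qinj X.
Hypothesis G2' : glue_twoV X.
Hypothesis G3 : glue_threeV X.

(** The three operations are glued to one element [t] on a chain of three vertices. Both bracketings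
    are restrictions of [t], along operations of A(T) that are equal by associativity there. Each
    outer composition involves a vertex that is already a composite, so it is realised in the face
    where the edge composed first is contracted. *)
Lemma Xlaw_assoc (u v w z1 z2 z1' z2' : Zop X) c x d1 d2 y g1 g2 :
  prof u = rcons c x -> prof v = d1 ++ x :: rcons d2 y -> prof w = g1 ++ y :: g2 ->
  compR (size c) (size d1) u v z1 -> compR (size (d1 ++ c ++ d2)) (size g1) z1 w z2 ->
  compR (size (d1 ++ x :: d2)) (size g1) v w z1' ->
  compR (size c) (size (g1 ++ d1)) u z1' z2' -> z2 = z2'.
Proof.
move=> pu pv pw c1 c2 c3 c4.
have [T [a [b [e [k [m [C [D1 [D2 [G1 [G2 [[ab be ae V3] ha hb he [sC sD1 sD2 sG1 sG2]]]]]]]]]]]]] :=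
  T3_ex (size c) (size d1) (size d2) (size g1) (size g2).
have U := T3_uniq ab be ae ha hb he.
have Jk : joins k a b.
  by apply/joinsP; rewrite -(mem_listing ha) -(mem_listing hb) mem_rcons mem_head mem_cat mem_head orbT.
have Jm : joins m b e.
  apply/joinsP; rewrite -(mem_listing hb) -(mem_listing he).
  by rewrite !mem_cat !inE mem_rcons !inE eqxx !orbT.
have [|cl] := @fc_ex _ _ (k :: m :: C ++ D1 ++ D2 ++ G1 ++ G2) (x :: y :: c ++ d1 ++ d2 ++ g1 ++ g2) x U.
  by rewrite /= !size_cat sC sD1 sD2 sG1 sG2.
rewrite /= !map_cat => -[Ek Em] /cat_inj [|EC /cat_inj [|E1 /cat_inj [|E2 /cat_inj [|E3 E4]]]];
  rewrite ?size_map //.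
have [ba eb ea] : [/\ b == a = false, e == b = false & e == a = false].
  by rewrite (eq_sym b a) (eq_sym e b) (eq_sym e a); split; apply/negbTE.
pose L w := if w == a then rcons C k else if w == b then D1 ++ k :: rcons D2 m else G1 ++ m :: G2.
have hL w' : listing w' (L w').
  rewrite /L; case: (V3 w') => ->; rewrite ?eqxx ?ba ?ea ?eb //.
have [|t et] := @G3 T a b e k m ab be ae V3 Jk Jm (fun w' => if w' == a then u else if w' == b then v else w) L hL cl.
  move=> w'; rewrite /L; case: eqP => _; last case: eqP => _.
  - by rewrite pu map_rcons EC Ek.
  - by rewrite pv map_cat /= map_rcons E1 Ek E2 Em.
  - by rewrite pw map_cat /= E3 Em E4.
have ea' : ev t (pg ha) u.
  have := et a; rewrite eqxx; congr (ev _ _ _); apply: pg_eq => //; by rewrite /L eqxx.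
have eb' : ev t (pg hb) v.
  have := et b; rewrite eqxx ba; congr (ev _ _ _); apply: pg_eq => //; by rewrite /L eqxx ba.
have ee' : ev t (pg he) w.
  have := et e; rewrite ea eb; congr (ev _ _ _); apply: pg_eq => //; by rewrite /L ea eb.
have [P CP] := comp_pg ha hb.
have [_ _ pP] := IsComp_pr CP.
have pP' : pr P = rcons (D1 ++ C ++ D2) m by rewrite pP -!cats1 -!catA.
have [QQ CQ] : exists QQ, @IsComp (treeOp T) (D1 ++ C ++ D2) m G1 G2 P (pg he) QQ.
  by apply: IsComp_ex.
have hb2 : listing b (rcons (D1 ++ k :: D2) m) by rewrite -cats1 -catA /= cats1.
have Ehb : pg hb2 = pg hb by apply: pg_eq; rewrite // -cats1 -catA /= cats1.
have [P' CP'] := comp_pg hb2 he.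
have [_ _ pPP] := IsComp_pr CP'.
have pPP' : pr P' = (G1 ++ D1) ++ k :: (D2 ++ G2) by rewrite pPP -!catA.
have [Q' CQ'] : exists Q', @IsComp (treeOp T) C k (G1 ++ D1) (D2 ++ G2) (pg ha) P' Q'.
  by apply: IsComp_ex.
have EQ : QQ = Q'.
  by apply: (lassoc CP CQ _ CQ'); rewrite -Ehb.
have [y1 ey1] := ev_ex t (rz_comp ab CP).
have Ez1 : z1 = y1.
  apply: (compR_fun Q c1); exists T, t, a, b, k, C, D1, (rcons D2 m), ha, hb, P.
  by split.
have [y1' ey1'] := ev_ex t (rz_comp be CP').
have Ez1' : z1' = y1'.
  apply: (compR_fun Q c3); exists T, t, b, e, m, (D1 ++ k :: D2), G1, G2, hb2, he, P'.
  split=> //; last by rewrite Ehb.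
  by split=> //; rewrite !size_cat /= sD1 sD2.
(* The face contracting [k]: its vertex [p] is the composite of [a] and [b]. *)
have [y2 [ey2 cy2]] : exists y2, ev t QQ y2 /\ compR (size (d1 ++ c ++ d2)) (size g1) y1 w y2.
  have [S [p [q [r [l [m1 [m2 [[pq tV] hp hq [sl s1 s2]]]]]]]]] :=
    T2_ex (size (D1 ++ C ++ D2)) (size G1) (size G2).
  have [f [fp fq fr fl [f1 f2]]] := @T2_mor _ _ _ _ _ _ _ pq tV hp hq _ P (pg he)
     _ _ _ _ pP' erefl (esym sl) (esym s1) (esym s2).
  have fI : injective (fcol f).
    apply: (T2_inj pq tV hp hq); rewrite map_cons !map_cat fr fl f1 f2.
    by case: (uniq_T3_perm U).
  have qp : q != p by rewrite eq_sym.
  have tV' : twoV q p by move=> i; case: (tV i); auto.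
  have F : inner_coface f k.
    apply: (@face3 T S e a b q p f k C D1 (rcons D2 m) _ _ _ ha hb he hq hp P) => //.
    - by rewrite ea.
    - by rewrite eb.
    - by move=> i; case: (V3 i) => ->; [apply: Or32|apply: Or33|apply: Or31].
  have [R CR] := comp_pg hp hq.
  have ER : pfop f R = QQ.
    by have := pfop_comp f CR; rewrite fp fq fr fl f1 f2 => /IsComp_fun /(_ CQ).
  have [y2 ey2] := ev_ex (amap X (TMap (tm_inner F)) t) (rz_comp pq CR).
  have ey2' := ev_map ey2; rewrite /= ER in ey2'.
  exists y2; split=> //.
  have -> : size (d1 ++ c ++ d2) = size l by rewrite sl !size_cat sC sD1 sD2.
  rewrite -sG1 -s1; apply: (compR_intro (f := TMap (tm_inner F)) (t := t) pq CR).
  - by rewrite /= fp.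
  - by rewrite /= fq.
  - by rewrite /= ER.
(* The face contracting [m]: its vertex [q] is the composite of [b] and [e]. *)
have [y2' [ey2' cy2']] : exists y2', ev t Q' y2' /\ compR (size c) (size (g1 ++ d1)) u y1' y2'.
  have [S [p [q [r [l [m1 [m2 [[pq tV] hp hq [sl s1 s2]]]]]]]]] :=
    T2_ex (size C) (size (G1 ++ D1)) (size (D2 ++ G2)).
  have [f [fp fq fr fl [f1 f2]]] := @T2_mor _ _ _ _ _ _ _ pq tV hp hq _ (pg ha) P'
     _ _ _ _ erefl pPP' (esym sl) (esym s1) (esym s2).
  have fI : injective (fcol f).
    apply: (T2_inj pq tV hp hq); rewrite map_cons !map_cat fr fl f1 f2.
    by case: (uniq_T3_perm U).
  have F : inner_coface f m.
    exact: (@face3 T S a b e p q f m (D1 ++ k :: D2) G1 G2 _ _ _ hb2 he ha hp hq P').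
  have [R CR] := comp_pg hp hq.
  have ER : pfop f R = Q'.
    by have := pfop_comp f CR; rewrite fp fq fr fl f1 f2 => /IsComp_fun /(_ CQ').
  have [y2' ey2'] := ev_ex (amap X (TMap (tm_inner F)) t) (rz_comp pq CR).
  have ey3 := ev_map ey2'; rewrite /= ER in ey3.
  exists y2'; split=> //.
  have -> : size (g1 ++ d1) = size m1 by rewrite s1 !size_cat sG1 sD1.
  rewrite -sC -sl; apply: (compR_intro (f := TMap (tm_inner F)) (t := t) pq CR).
  - by rewrite /= fp.
  - by rewrite /= fq.
  - by rewrite /= ER.
rewrite Ez1 in c2; rewrite Ez1' in c4.
rewrite (compR_fun Q c2 cy2) (compR_fun Q c4 cy2').
by rewrite EQ in ey2; apply: ev_fun ey2 ey2'.
Qed.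

Notation XD := (Xdata G2').
Notation val := (@zv X G2' _).

Lemma Xlaws : cycLaws (D := XD) (fun _ x y => x = y).
Proof.
split.
- move=> n c h e x; apply: zv_inj; rewrite zv_cst.
  exact: actR1 (zv_act _ h x).
- move=> n s t c h h' e x; apply: zv_inj; rewrite zv_cst.
  apply: (actR_fun (actRM (zv_act s h x) (zv_act t h' (act s h x)))).
  exact: (zv_act (t * s)%g h x).
- move=> c x e u; apply: zv_inj; rewrite zv_cst.
  apply: (compR_fun Q (zv_comp (d1 := [::]) (d2 := [:: x]) u (idop (D := XD) x))).
  exact: Xlaw_unitr (zv_prof u).
- move=> x d1 d2 u; apply: zv_inj.
  apply: (compR_fun Q (zv_comp (c := [:: x]) (idop (D := XD) x) u)).
  exact: Xlaw_unitl (zv_prof u).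
- move=> c x d1 d2 y g1 g2 u v w e1 e2 e3 e4; apply: zv_inj; rewrite zv_cst.
  have c1 := zv_comp (d2 := rcons d2 y) u v.
  have c2 := zv_comp (cst e1 (comp d1 (rcons d2 y) u v)) w.
  have c3 := zv_comp (cst e2 v) w.
  have c4 := zv_comp (d1 := g1 ++ d1) (d2 := d2 ++ g2) u (cst e3 (comp g1 g2 (cst e2 v) w)).
  rewrite !zv_cst in c2 c3 c4.
  exact: Xlaw_assoc (zv_prof u) (zv_prof v) (zv_prof w) c1 c2 c3 c4.
- move=> f a l d1 d2 l' d1' d2' n1 n2 n3 s t r U Hs Ht Hr u v h1 h2 h3 e1 e2 e3.
  apply: zv_inj; rewrite zv_cst.
  have au := zv_act s h1 u; have av := zv_act t h2 v.
  have c1 := zv_comp u v.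
  have c2 := zv_comp (cst e1 (act s h1 u)) (cst e2 (act t h2 v)).
  have ar := zv_act r h3 (comp (map f d1) (map f d2) u v).
  rewrite !zv_cst !size_map in c1 c2.
  apply: (actR_fun _ ar).
  apply: (Xlaw_equiv Q G2' U Hs Ht Hr (zv_prof u) (zv_prof v) _ _ _ au av c1 c2).
  + by rewrite -h1 !size_rcons size_map.
  + by rewrite -h2 !size_cat /= !size_map.
  + by rewrite -h3 !size_cat /= !size_map.
- move=> f a l d1 d2 d' l1' l2' n1 n2 n3 s t r U Hs Ht Hr u v h1 h2 h3 e1 e2 e3.
  apply: zv_inj; rewrite zv_cst.
  have au := zv_act s h1 u; have av := zv_act t h2 v.
  have c1 := zv_comp u v.
  have c2 := zv_comp (cst e2 (act t h2 v)) (cst e1 (act s h1 u)).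
  have ar := zv_act r h3 (comp (map f d1) (map f d2) u v).
  rewrite !zv_cst !size_map in c1 c2.
  apply: (actR_fun _ ar).
  apply: (Xlaw_exchange Q G2' U Hs Ht Hr (zv_prof u) (zv_prof v) _ _ _ au av c1 c2).
  + by rewrite -h1 !size_rcons size_map.
  + by rewrite -h2 !size_cat /= !size_map.
  + by rewrite -h3 !size_cat /= !size_map.
Qed.

Definition XC : cycOperad := CycOperad Xlaws.
End OperadOf.

(** * The comparison map from X to the nerve *)

Section Comparison.
Variable X : astroidal.
Hypothesis Q : qinj X.
Hypothesis G2 : glue_twoV X.
Hypothesis G3 : glue_threeV X.
Notation C := (XC Q G2 G3).

Definition pzv (U : pop C) : Zop X := @zv X G2 _ (projT2 U).
Definition zp (z : Zop X) : pop C := @pk C (prof z) (exist _ z erefl).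

Lemma pzv_zp z : pzv (zp z) = z. Proof. by []. Qed.

Lemma prof_pzv U : prof (pzv U) = pr U.
Proof. exact: zv_prof. Qed.

Lemma pzv_inj : injective pzv.
Proof.
move=> U V E; have p : pr U = pr V by rewrite -!prof_pzv E.
case: U V E p => c x [d y] E /= p; case: d / p y E => y E.
by apply: (congr1 (@pk C c)); apply: zv_inj E.
Qed.

Lemma pzv_act n (s : 'S_n) U W : IsAct s U W -> actR s (pzv U) (pzv W).
Proof. by move=> [c [h [x [-> ->]]]]; apply: zv_act. Qed.

Lemma pzv_comp c x d1 d2 U V W : @IsComp C c x d1 d2 U V W ->
  compR (size c) (size d1) (pzv U) (pzv V) (pzv W).
Proof. by move=> [u [v [-> -> ->]]]; apply: zv_comp. Qed.

Lemma nm_ex (T : tree) (t : X T) : exists f : cycMor (treeOp T) C,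
  (forall e, fcol f e = ecol t e) /\
  forall v l (h : listing v l) z, ev t (pg h) z -> pzv (pfop f (pg h)) = z.
Proof.
have ex (v : vertex T) : exists z, ev t (pg (listing_enum v)) z := ev_ex t (rz_gen _).
pose G v := zp (sval (cid (ex v))).
have [|f [fE fG]] := @free_ex T C (ecol t) _ (@listing_enum T) G.
  by move=> v; rewrite /G; case: (cid _) => z e; rewrite /= (ev_prof e).
exists f; split=> // v l h z ez.
have [s Es] := listing_perm (listing_enum v) h.
have a := gen_act' (listing_enum v) h erefl Es.
have := pzv_act (pfop_act f a); rewrite fG /G pzv_zp => b.
exact: ev_fun (ev_act (svalP (cid (ex v))) a b) ez.
Qed.

Definition nm (T : tree) (t : X T) : cycMor (treeOp T) C := sval (cid (nm_ex t)).

Lemma nm_col (T : tree) (t : X T) e : fcol (nm t) e = ecol t e.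
Proof. by rewrite /nm; case: cid => f []. Qed.

(** Evaluation in the operad of X matches restriction in X. For generators this is built into [nm];
    for other operations it has to be proved. *)
Definition agrees (T : tree) (t : X T) (W : pop (treeOp T)) :=
  forall z, ev t W z -> pzv (pfop (nm t) W) = z.

Lemma agrees_gen (T : tree) (t : X T) v l (h : listing v l) : agrees t (pg h).
Proof. by move=> z; exact: (proj2 (svalP (cid (nm_ex t)))). Qed.

Lemma agrees_id (T : tree) (t : X T) (e : edge T) : agrees t (pid (e : col (treeOp T))).
Proof. by move=> z /(ev_fun (ev_id t e)) <-; rewrite pfop_id nm_col. Qed.

Lemma agrees_comp (T : tree) (t : X T) (x y : vertex T) c l d1 d2
    (hx : listing x (rcons l c)) (hy : listing y (d1 ++ c :: d2)) (W : pop (treeOp T)) :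
  x != y -> @IsComp (treeOp T) l c d1 d2 (pg hx) (pg hy) W -> agrees t W.
Proof.
move=> xy CW z ez; have := pzv_comp (pfop_comp (nm t) CW).
have [u eu] := ev_ex t (rz_gen hx); have [v ev_] := ev_ex t (rz_gen hy).
rewrite (agrees_gen eu) (agrees_gen ev_) !size_map => c1.
apply: (compR_fun Q c1); exists T, t, x, y, c, l, d1, d2, hx, hy, W.
by split.
Qed.

(** Both sides are operad morphisms out of a free operad, so naturality is tested on generators. *)
Lemma nm_natural_gen (S T : tree) (f : tmap S T) (t : X T) :
  (forall v, exists l (h : listing v l), agrees t (pfop f (pg h))) ->
  nm (amap X f t) = compMor (nm t) f.
Proof.
move=> H; apply: tree_ext => [e|v]; first by rewrite /= !nm_col ecol_map.
have [l [h a]] := H v; exists l, h; apply: pzv_inj; rewrite pfop_compMor.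
have [z ez] := ev_ex (amap X f t) (rz_gen h).
by rewrite (agrees_gen ez) (a _ (ev_map ez)).
Qed.

(** By induction on the generation of tree maps: under a generating map a vertex goes to a
    generator, to an identity or to a composite of two adjacent generators, and [nm t] is known on
    all of these. *)
Lemma nm_natural (S T : tree) (f : tmap S T) (t : X T) :
  nm (amap X f t) = compMor (nm t) f.
Proof.
(* The proof [F] that the map is a tree map is kept separate from the one that is eliminated, so
   that the statement still makes sense during the induction. *)
case: f => f F; have : is_tree_map f := F; move=> I0; move: F t.
elim: {S T f} I0 => [S T f If|S T f c If|S T f If|S T f If|R S T g f Ig IHg If IHf] F t /=.
- apply: nm_natural_gen => v /=; have [j [_ fm]] := If.
  have [h E] := maps_vertex_pg (listing_enum v) (fm v).
  by exists _, (listing_enum v); rewrite E; apply: agrees_gen.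
- apply: nm_natural_gen => s /=.
  have [[v mv]|[x [y [l1 [l2 [hx [hy [l [h [xy CW]]]]]]]]]] := inner_vertex s If.
    have [h E] := maps_vertex_pg (listing_enum s) mv.
    by exists _, (listing_enum s); rewrite E; apply: agrees_gen.
  by exists l, h; apply: agrees_comp xy CW.
- apply: nm_natural_gen => v /=; have [[_ [u [j [_ fm]]]]|[_ [S0 _]]] := If.
    have [h E] := maps_vertex_pg (listing_enum v) (fm v).
    by exists _, (listing_enum v); rewrite E; apply: agrees_gen.
  by have := card0_eq S0 v.
- apply: nm_natural_gen => v /=; have [c [v0 [c1 [c2 [j [sub fm fC]]]]]] := If.
  have [[w _ mv]|[_ [l [h E]]]] := degen_vertex v sub fm fC.
    have [h E] := maps_vertex_pg (listing_enum v) mv.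
    by exists _, (listing_enum v); rewrite E; apply: agrees_gen.
  by exists l, h; rewrite E; apply: agrees_id.
- have -> : amap X (TMap F) t = amap X (TMap If) (amap X (TMap Ig) t).
    by rewrite -amap_comp; congr (amap X _ t); apply: tmap_eq.
  by rewrite (IHf If) (IHg Ig) compMorA.
Qed.

(** A realisable operation is the image of the generator of a corolla, and naturality reduces the
    claim to that generator. *)
Lemma agreesP (T : tree) (t : X T) W : agrees t W.
Proof.
move=> z [n [f [<- ->]]]; rewrite -pfop_compMor -nm_natural.
exact: agrees_gen (ev_self (existT _ n (amap X f t))).
Qed.

Definition nmHom : hom X (nerve C) :=
  @Hom X (nerve C) nm (fun S T f t => nm_natural f t).

Lemma nm_inj (T : tree) : injective (@nm T).
Proof.
move=> t t' E; apply: Q => [e|v]; first by rewrite -!nm_col E.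
have [z ez] := ev_ex t (rz_gen (listing_enum v)).
have [z' ez'] := ev_ex t' (rz_gen (listing_enum v)).
exists _, (listing_enum v), z; split=> //.
by rewrite -(agrees_gen ez) E (agrees_gen ez').
Qed.

(** The relation [K] evaluates operations through [y]. It has solutions on the members of [P] by the
    first hypothesis, they extend to [t] by the second, and [nm t] equals [y] because the corollas
    lie in [P]. *)
Lemma nm_surj (T : tree) (P : subrep T) (y : cycMor (treeOp T) C) (v0 : vertex T) :
  (forall R (f : tmap R T), P R f -> exists x : X R, nm x = compMor y f) ->
  (forall b : hom (subrep_astroidal P) X, exists t : X T,
     forall R (f : sub_ob P R), amap X (sval f) t = hmap b f) ->
  (forall v, exists l (h : listing v l) n (f : tmap (Cor n) T), P _ f /\ pfop f (gcor n) = pg h) ->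
  exists t : X T, nm t = y.
Proof.
move=> H1 H2 H3; pose K W z := z = pzv (pfop y W).
have [||b bg] := @glueK X Q T K P.
- by move=> W z z' -> ->.
- move=> R f /H1 [x E]; exists x => W z ez.
  by rewrite /K -pfop_compMor -E (agreesP ez).
have [t tE] := H2 b; exists t.
have main v : exists l (h : listing v l), pfop (nm t) (pg h) = pfop y (pg h).
  have [l [h [n [f [Pf fE]]]]] := H3 v; exists l, h; apply: pzv_inj.
  have et : ev t (pg h) (existT _ n (amap X f t)) by exists n, f.
  rewrite (agrees_gen et).
  have := bg _ (exist _ f Pf) _ _ (ev_self (existT _ n (hmap b (exist _ f Pf : sub_ob P _)))).
  by rewrite -(tE _ (exist _ f Pf)) /K /= fE.
apply: tree_ext => // e; have [v ve] := edge_vertex v0 e.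
have [l [h /(congr1 (@pr _)) /eq_in_map E]] := main v; apply: E.
by rewrite (mem_listing h).
Qed.
End Comparison.

(** * Horns and Segal cores *)

Lemma cor_corolla (T : tree) (v : vertex T) l (h : listing v l) n (f : tmap (Cor n) T) :
  pfop f (gcor n) = pg h -> corolla_incl v f.
Proof.
move=> E; have pE : map (fcol f) (enum 'I_n) = l := congr1 (@pr _) E.
split; first exact: card_cor.
exists (cv n); split; last exact: maps_vertexI E.
- have U := listing_uniq h; rewrite -pE in U => e e' Ee.
  by apply: (map_uniq_inj U) => //; rewrite mem_enum.
- move=> e; rewrite -(mem_listing h) -pE; split=> [[e' <-]|/mapP [e' _ ->]].
    by rewrite map_f // mem_enum.
  by exists e'.
Qed.

Lemma corolla_core (T : tree) (v : vertex T) l (h : listing v l) n (f : tmap (Cor n) T) :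
  pfop f (gcor n) = pg h -> segal_core T _ f.
Proof.
move=> E; exists v, (Cor n), f; split; first exact: cor_corolla E.
by exists (tid_map _); rewrite tcomp_map1.
Qed.

Lemma cor_factor (T : tree) (v : vertex T) l l' (h : listing v l) (h' : listing v l')
    n m (f : tmap (Cor n) T) (f' : tmap (Cor m) T) :
  pfop f (gcor n) = pg h -> pfop f' (gcor m) = pg h' ->
  exists s : tmap (Cor m) (Cor n), f' = tcomp_map f s.
Proof.
move=> E E'; have sl : size l = n by rewrite -(size_pfop_gcor f) E.
have sl' : size l' = m by rewrite -(size_pfop_gcor f') E'.
have [s Es] := listing_perm h h'.
have a := gen_act' h h' erefl Es; rewrite -E -E' in a.
have sg : size (pr (gcor n)) = size l by rewrite size_gcor.
have b := gen_act' (cor_listing n) (listing_permute s sg (cor_listing n)) sg erefl.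
have sm : size (permute s (enum 'I_n)) = m.
  by apply: (etrans (size_permute s sg)); rewrite -sl' -Es size_permute.
have [t tE] := cor_tmap (@listing_permute (Cor n) (cv n) _ _ s sg (cor_listing n)) sm.
exists t; apply: tmap_eq; apply: cor_ext; rewrite /= pfop_compMor tE.
exact: IsAct_fun a (pfop_act f b).
Qed.

(** The inverse of the inclusion of the corolla, which hits every edge when [v] is the only
    vertex. *)
Lemma cor_inv (S : tree) (v : vertex S) l n (h : listing v l) : (forall w, w = v) ->
  size l = n -> exists s : tmap S (Cor n), pfop s (pg h) = gcor n.
Proof.
move=> S1 sl; have [c cE] := cor_tmap h sl.
have cmap : map (fcol c) (enum 'I_n) = l := congr1 (@pr _) cE.
have [_ [w [cI _ _]]] := cor_corolla cE.
have ex e : exists i, fcol c i = e.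
  have [w' we] := edge_vertex v e; rewrite (S1 w') -(mem_listing h) -cmap in we.
  by case/mapP: we => i _ ->; exists i.
pose fc e := sval (cid (ex e)).
have fcK e : fcol c (fc e) = e by rewrite /fc; case: cid.
have fcl : map fc l = enum 'I_n.
  by rewrite -cmap -map_comp -[RHS]map_id; apply: eq_map => i; apply: cI; rewrite fcK.
have hL u : listing u l by rewrite (S1 u).
have [|f [fE fg]] := @free_ex S (treeOp (Cor n)) fc (fun=> l) hL (fun=> gcor n).
  by move=> u; rewrite fcl.
have fv : pfop f (pg h) = gcor n by rewrite -(fg v); congr pfop; apply: pg_eq.
suff F : is_tree_map f by exists (TMap F).
apply: (@iso_is_tree_map S _ f (fun=> cv n) v).
- by move=> e e'; rewrite !fE => E; rewrite -(fcK e) E fcK.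
- by move=> u u' _; rewrite (S1 u) (S1 u').
- by move=> u; rewrite (S1 u); apply: maps_vertexI fv.
- by move=> u; exists v; rewrite [RHS]cvE.
Qed.

Lemma noV_eta (S : tree) (e : edge S) : (vertex S -> False) ->
  exists s : tmap S eta, tcomp_map (em e) s = tid_map S.
Proof.
move=> nV.
have eE e' : e' = e.
  have /connectP [[|[v|//] p] //= P L] := tree_connected (inr e : vertex S + edge S) (inr e').
  by case: L.
have [|f [fE _]] := @free_ex S (treeOp eta) (fun=> tt) _ (@listing_enum S)
    (fun v => match nV v with end).
  by move=> v; case: (nV v).
have F : is_tree_map f.
  apply: tm_iso; exists (fun v => match nV v with end); split; last by move=> v; case: (nV v).
  split; last by move=> v; case: (nV v).
  - apply: inj_surj_bij => [e1 e2 _|[]]; first by rewrite (eE e1) (eE e2).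
    by exists e; rewrite fE.
  - by apply: inj_surj_bij => [v|[]]; case: (nV v).
exists (TMap F); apply: tmap_eq; apply: tree_ext => [e'|v]; last by case: (nV v).
by rewrite /= (eE e'); case: (fcol f e); rewrite emE.
Qed.

(** The subtree avoids [u], so [factor] lifts it to the tree with [u] deleted. This is how small
    subtrees are shown to belong to horns. *)
Lemma factor_tmap (K T : tree) (u w : vertex T) (f : tmap K T) (jk : vertex K -> vertex T)
    (x y : vertex K) (ou : outer u) (wu : w != u) :
  injective (fcol f) -> injective jk -> (forall v, maps_vertex f v (jk v)) ->
  (x = y \/ exists c, joins c x y) -> (forall v, v = x \/ v = y) ->
  (forall v, jk v != u) ->
  exists (S : tree) (a : tmap S T), outer_coface a /\ in_image a f.
Proof.
move=> fI jI fm xy Vxy ju; have [a [ao aI am]] := del_map wu ou.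
have [|k' [jk' [kE k'm jk'E]]] := factor aI am fm _ x.
  by move=> v; exists (exist _ (jk v) (ju v)).
exists (delTree wu ou), a; split=> //.
suff F : is_tree_map k' by exists (TMap F); apply: tmap_eq.
apply: (@incl_is_tree_map _ K _ k' jk' x y (leqnn _)) => //.
- by move=> e e' E; apply: fI; rewrite kE /= E.
- by move=> v v' E; apply: jI; rewrite -!jk'E E.
Qed.

Section Determined.
Variable X : astroidal.

Lemma size_prof (z : Zop X) : size (prof z) = projT1 z.
Proof. by rewrite /prof size_map; apply: size_gcor. Qed.

Lemma ev_cor (T : tree) (t : X T) n (f : tmap (Cor n) T) W (x : X (Cor n)) :
  pfop f (gcor n) = W -> ev t W (existT (fun n => X (Cor n) : Type) n x) -> x = amap X f t.
Proof.
move=> E e; have e' : ev t W (existT (fun n => X (Cor n) : Type) n (amap X f t)) by exists n, f.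
exact: eq_from_Tagged (ev_fun e e').
Qed.

Lemma single_eq (S : tree) (v : vertex S) (t t' : X S) l (h : listing v l) z :
  (forall w, w = v) -> ev t (pg h) z -> ev t' (pg h) z -> t = t'.
Proof.
move=> S1; have [s sE] := cor_inv h S1 erefl; have [c cE] := cor_tmap h erefl.
have K : tcomp_map c s = tid_map S.
  apply: tmap_eq; apply: tree_ext => [e|w].
    have [w we] := edge_vertex v e; rewrite (S1 w) -(mem_listing h) in we.
    have /eq_in_map : map (fcol c \o fcol s) l = map id l.
      rewrite map_comp map_id; have -> : map (fcol s) l = pr (gcor (size l)) by rewrite -sE.
      exact: (congr1 (@pr (treeOp S)) cE).
    by move/(_ e we).
  exists l; rewrite (S1 w); exists h.
  by rewrite /= pfop_compMor sE cE pfop_idMor.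
move=> e1 e2; rewrite -(amap_id t) -(amap_id t') -K !amap_comp.
have [z0 e0] : exists x, ev t (pg h) (existT (fun n => X (Cor n) : Type) (size l) x).
  by exists (amap X c t), (size l), c.
by rewrite -(ev_cor cE e0); rewrite (ev_fun e1 e0) in e2; rewrite -(ev_cor cE e2).
Qed.

Lemma single_ex (S : tree) (v : vertex S) l (h : listing v l) (z : Zop X) :
  (forall w, w = v) -> size (prof z) = size l -> exists t : X S, ev t (pg h) z.
Proof.
move=> S1 sz; have {sz} sl : size l = projT1 z by rewrite -sz size_prof.
have [s sE] := cor_inv h S1 sl; exists (amap X s (projT2 z)).
apply: ev_map'; first exact: rz_gen.
by rewrite sE; apply: ev_self.
Qed.

Lemma noV_eq (S : tree) (t t' : X S) : (vertex S -> False) ->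
  (forall e, ecol t e = ecol t' e) -> t = t'.
Proof.
move=> nV H; have /card_gt0P [[v|e] _] := tree_nonempty S; first by case: (nV v).
have [s K] := noV_eta e nV.
by rewrite -(amap_id t) -(amap_id t') -K !amap_comp -!/(ecol _ _) H.
Qed.

Lemma noV_ex (S : tree) (e : edge S) (a : X eta) : (vertex S -> False) ->
  exists t : X S, ecol t e = a.
Proof.
move=> nV; have [s K] := noV_eta e nV; exists (amap X s a).
rewrite ecol_map -[RHS]ecol_eta.
by case: (fcol s e).
Qed.

Definition qinjT (T : tree) := forall t t' : X T,
  (forall v, exists l (h : listing v l) z, ev t (pg h) z /\ ev t' (pg h) z) -> t = t'.

Lemma qinj_of : (forall T, vertex T -> qinjT T) -> qinj X.
Proof.
move=> H T t t' Hc Hg; have [[v _]|nV] := pselect (exists v : vertex T, true).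
  exact: H v _ _ Hg.
by apply: noV_eq => // v; apply: nV; exists v.
Qed.

(** Permutations act bijectively on the operations of X, so gluing may be tested on listings adapted
    to the composites at hand. *)
Lemma glue_relist (T : tree) (L : vertex T -> seq (edge T)) (hL : forall v, listing v (L v)) :
  (forall (uu : vertex T -> Zop X) (cl : edge T -> X eta),
     (forall v, prof (uu v) = map cl (L v)) ->
     exists t : X T, forall v, ev t (pg (hL v)) (uu v)) -> glue X T.
Proof.
move=> H uu M hM cl pu.
have ex v : exists s : 'S_(size (M v)), permute s (M v) = L v := listing_perm (hM v) (hL v).
pose s v := sval (cid (ex v)); have sE v : permute (s v) (M v) = L v := svalP (cid (ex v)).
have sz v : size (prof (uu v)) = size (M v) by rewrite pu size_map.
have [|t et] := H (fun v => sval (cid (actR_ex (s v) (sz v)))) cl.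
  by move=> v; rewrite (actR_prof (svalP (cid (actR_ex (s v) (sz v))))) pu -map_permute sE.
exists t => v; have := et v; have := svalP (cid (actR_ex (s v) (sz v))).
move: (sval _) => z a e.
have [z0 e0] := ev_ex t (rz_gen (hM v)).
have b := gen_act' (hM v) (hL v) erefl (sE v).
have a0 := ev_actR e0 b e.
have e1 := ev_self z0; have e2 := ev_self (uu v).
(* The action of [s v] is invertible, so agreement after relisting gives agreement before. *)
have inv (y y' : Zop X) : actR (s v) y y' -> actR ((s v)^-1)%g y' y.
  move=> r; have sy : size (prof y') = size (M v).
    rewrite (actR_prof r) size_permute //; case: r => W aW _.
    by rewrite size_prof; have := IsAct_size aW; rewrite size_gcor.
  have [y'' r'] := actR_ex ((s v)^-1)%g sy.
  have := actRM r r'; rewrite mulVg => /actR1 E1.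
  by rewrite E1 in r'.
by rewrite (actR_fun (inv _ _ a) (inv _ _ a0)).
Qed.
End Determined.

(** * Agreement of an element with a map on a subpresheaf *)

Section Agree.
Variables (X : astroidal) (T : tree) (P : subrep T).
Variables (a : hom (subrep_astroidal P) X) (t : X T).

Definition agr (R : tree) (f : tmap R T) : Prop :=
  exists Pf : P R f, amap X f t = hmap a (exist _ f Pf : sub_ob P R).

Lemma agr_pre (R S : tree) (f : tmap S T) (g : tmap R S) : agr f -> agr (tcomp_map f g).
Proof.
move=> [Pf E]; exists (smem_closed g Pf); rewrite amap_comp E.
apply: etrans (esym (hmap_nat a g (exist _ f Pf : sub_ob P S))) _.
by congr (hmap a _); apply: sub_ob_eq.
Qed.

Lemma agrE (R : tree) (f : sub_ob P R) : agr (sval f) -> amap X (sval f) t = hmap a f.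
Proof. by case: f => f Pf [Pf' E]; rewrite /= E; congr hmap; apply: sub_ob_eq. Qed.

Lemma agr_cor (v : vertex T) l l' (h : listing v l) (h' : listing v l') n m
    (f : tmap (Cor n) T) (f' : tmap (Cor m) T) :
  pfop f (gcor n) = pg h -> pfop f' (gcor m) = pg h' -> agr f -> agr f'.
Proof. by move=> E E' A; have [s ->] := cor_factor E E'; apply: agr_pre. Qed.

(** Both sides are elements over [S], where elements are determined on corollas, so agreement is
    tested there. *)
Lemma agr_tree (S : tree) (f : tmap S T) : P S f -> qinjT X S ->
  (forall v, exists l (h : listing v l) n (g : tmap (Cor n) S),
     pfop g (gcor n) = pg h /\ agr (tcomp_map f g)) ->
  agr f.
Proof.
move=> Pf QS H; exists Pf; apply: QS => v; have [l [h [n [g [gE [Pfg E]]]]]] := H v.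
exists l, h, (existT _ n (amap X g (amap X f t))); split; first by exists n, g.
exists n, g; split=> //; rewrite -amap_comp E.
have := hmap_nat a g (exist _ f Pf : sub_ob P S) => /= <-.
suff -> : sub_map g (exist _ f Pf : sub_ob P S) = exist _ _ Pfg by [].
exact: sub_ob_eq.
Qed.
End Agree.

Section HornFacts.
Variables (T : tree) (k : edge T).
Hypothesis ik : inner k.

(** An inner edge provides a second vertex, hence an outer vertex other than [v]; the corolla of [v]
    lies in the face deleting it. *)
Lemma horn_corolla (v : vertex T) l (h : listing v l) n (f : tmap (Cor n) T) :
  pfop f (gcor n) = pg h -> horn k _ f.
Proof.
move=> E; have [w wv] : exists w, w != v.
  have /existsP [x /existsP [y /joinsP [xy _ _]]] := ik.
  have [Ex|nx] := eqVneq x v; last by exists x.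
  by exists y; rewrite -Ex eq_sym.
have [u [ou uv]] := outer_avoid1 wv; rewrite eq_sym in uv.
have [Sc [w0 [cI _ cm]]] := cor_corolla E.
have [|||||S [a [ao ai]]] := @factor_tmap (Cor n) T u v f (fun=> v) (cv n) (cv n) ou uv cI.
- by move=> w1 w2 _; rewrite (cvE w1) (cvE w2).
- by move=> w1; rewrite (cvE w1) -(cvE w0).
- by left.
- by move=> w1; left; apply: cvE.
- by [].
by exists S, a; split=> //; left.
Qed.

(** Otherwise the ends of [k] would be [x] and [y], forcing [k] and [c] to coincide. *)
Lemma inner_third (c : edge T) (x y : vertex T) : joins c x y -> c <> k ->
  exists w, w != x /\ w != y.
Proof.
move=> /joinsP [xy xc yc] ck.
have /existsP [p /existsP [q /joinsP [pq pk qk]]] := ik.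
apply: contrapT => H.
have all v : v = x \/ v = y.
  have [->|nx] := eqVneq v x; first by left.
  by have [->|ny] := eqVneq v y; [right|case: H; exists v].
case: ck; case: (all p) (all q) => Ep [] Eq; subst p q; rewrite ?eqxx // in pq.
  exact: two_common xy xc yc pk qk.
exact: two_common xy xc yc qk pk.
Qed.

(** An edge other than [k] leaves room for an outer vertex away from its ends, and the subtree on
    these ends lies in the corresponding outer face. *)
Lemma horn_sub2 (c : edge T) (x y : vertex T) (S : tree) (x' y' : vertex S) (c' : edge S) l' d1' d2'
    l d1 d2 (hx' : listing x' (rcons l' c')) (hy' : listing y' (d1' ++ c' :: d2'))
    (hx : listing x (rcons l c)) (hy : listing y (d1 ++ c :: d2)) (f : tmap S T) :
  x' != y' -> twoV x' y' -> x != y -> c <> k ->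
  pfop f (pg hx') = pg hx -> pfop f (pg hy') = pg hy -> fcol f c' = c ->
  map (fcol f) l' = l -> map (fcol f) d1' = d1 -> map (fcol f) d2' = d2 ->
  horn k _ f.
Proof.
move=> xy' tV xy ck fx fy fc fl f1 f2.
have xc : adj x c by rewrite -(mem_listing hx) mem_rcons mem_head.
have yc : adj y c by rewrite -(mem_listing hy) mem_cat mem_head orbT.
have J : joins c x y by apply/joinsP.
have [w [wx wy]] := inner_third J ck.
have [u [ou ux uy]] := outer_avoid2 J wx wy.
have xu : x != u by rewrite eq_sym.
have yu : y != u by rewrite eq_sym.
have [fI [jk [jI jm jE J']]] := sub2_emb xy' tV xy fx fy fc fl f1 f2.
have [||R [a [ao ai]]] := @factor_tmap S T u x f jk x' y' ou xu fI jI jm (or_intror J').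
- exact: tV.
- by move=> v; case: (jE v) => ->.
by exists R, a; split=> //; left.
Qed.

(** This permits induction on the number of vertices. The vertices of an outer face omit [u], and
    those of an inner face embed by a section of [Q] that misses [y]. *)
Lemma coface_card (S : tree) (a : tmap S T) : coface_but k a ->
  0 < #|vertex S| < #|vertex T|.
Proof.
have /existsP [p /existsP [q /joinsP [pq pk qk]]] := ik.
have T2 : 1 < #|vertex T| by apply/card_gt1P; exists p, q.
case=> [[[_ [u [j [[_ _ [jI jim] _] _]]]]|[T1 _]]|[c ck [x [y [Q [con fm _]]]]]].
- have [v vu] : exists v, v <> u.
    have [Ep|np] := eqVneq p u; last by exists p; apply/eqP.
    by exists q; rewrite -Ep; apply/eqP; rewrite eq_sym.
  have [v' _] : exists v', j v' = v by apply/jim.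
  apply/andP; split; first by apply/card_gt0P; exists v'.
  rewrite -(card_codom jI); apply: (@leq_ltn_trans #|[set~ u]|).
    apply: subset_leq_card; apply/subsetP => w /codomP [w' ->]; rewrite !inE.
    by apply/eqP/jim; exists w'.
  by rewrite cardsC1; case: #|_| T2.
- by rewrite /single_vertex in T1; rewrite T1 in T2.
- have [/joinsP [xy xc yc] _ [qs qe] _ _] := con.
  apply/andP; split; first by apply/card_gt0P; exists (Q x).
  pose sec w := if w == Q x then x else sval (cid (qs w)).
  have secK w : Q (sec w) = w.
    by rewrite /sec; case: eqP => [->//|_]; case: cid.
  have secI : injective sec by move=> w w' E; rewrite -(secK w) E secK.
  rewrite -(card_codom secI); apply: (@leq_ltn_trans #|[set~ y]|).
    apply: subset_leq_card; apply/subsetP => w /codomP [w' ->]; rewrite !inE.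
    apply/eqP => E; have Ey : Q y = Q x by apply/qe; right; right.
    have Ew : w' = Q x by rewrite -(secK w') E.
    by move: E; rewrite /sec Ew eqxx => /eqP; rewrite (negbTE xy).
  by rewrite cardsC1; case: #|_| T2.
Qed.
End HornFacts.

(* On an inner face [T/c], the merged vertex is a face of the subtree on the
   two ends of [c], which lies in an outer face since [c] is not [k]. *)
Lemma horn_agree (X : astroidal) (T : tree) (k : edge T) (a : hom (subrep_astroidal (horn k)) X)
    (t : X T) : inner k ->
  (forall v, exists l (h : listing v l) n (f : tmap (Cor n) T),
     pfop f (gcor n) = pg h /\ agr a t f) ->
  (forall S : tree, vertex S -> #|vertex S| < #|vertex T| -> qinjT X S) ->
  restrict (horn k) (yo t) = a.
Proof.
move=> ik Hc HQ.
have cor (v : vertex T) l (h : listing v l) n (f : tmap (Cor n) T) : pfop f (gcor n) = pg h -> agr a t f.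
  by move=> E; have [l' [h' [m [g [E' A]]]]] := Hc v; apply: agr_cor E' E A.
have gen (S : tree) (f : tmap S T) v v' : maps_vertex f v v' ->
    exists l (h : listing v l) n (g : tmap (Cor n) S), pfop g (gcor n) = pg h /\ agr a t (tcomp_map f g).
  move=> m; have [h E] := maps_vertex_pg (listing_enum v) m.
  have [g gE] := cor_tmap (listing_enum v) erefl.
  exists _, (listing_enum v), _, g; split=> //; apply: (cor _ _ h).
  by rewrite /= pfop_compMor gE.
suff face (S : tree) (f : tmap S T) : coface_but k f -> agr a t f.
  apply: hom_eq => R [f Pf] /=; rewrite (@agrE X T (horn k) a t R (exist _ f Pf)) //=.
  by have [S [g [/face A [r ->]]]] := Pf; apply: agr_pre.
move=> Cf; have /andP [/card_gt0P [v0 _] lt] := coface_card ik Cf.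
have Pf : horn k S f by exists S, f; split=> //; exists (tid_map _); rewrite tcomp_map1.
apply: (agr_tree Pf (HQ _ v0 lt)) => v.
case: Cf => [[[_ [u [j [_ fm]]]]|[T1 _]]|[c ck If]].
- exact: gen (fm v).
- have /existsP [p /existsP [q /joinsP [pq _ _]]] := ik.
  have : 1 < #|vertex T| by apply/card_gt1P; exists p, q.
  by rewrite T1.
have [[w mv]|[x [y [l1 [l2 [xl [yl [l [h [xy C]]]]]]]]]] := inner_vertex v If; first exact: gen mv.
have [g gE] := cor_tmap h erefl.
exists l, h, (size l), g; split=> //.
have [S2 [x' [y' [c' [l' [m1 [m2 [[xy' tV] hx' hy' [sl s1 s2]]]]]]]]] :=
  T2_ex (size l1) 0 (size l2).
case: m1 s1 hy' => // _ hy'.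
have [i [ix iy ic il [_ i2]]] := sub2_tmap hx' hy' xl yl xy' tV xy (esym sl) erefl (esym s2).
have [W2 C2] := comp_pg hx' hy'.
have EW : pfop i W2 = pfop f (pg h).
  by have := pfop_comp i C2; rewrite ix iy ic il i2 => /IsComp_fun /(_ C).
have sW : size l = size (pr W2).
  by have := congr1 (fun W => size (pr W)) EW; rewrite /= !size_map.
have [d dE] := cor_face xy' tV C2 sW.
(* The same operation on a corolla is realised once through the inner face and once through the
   subtree on the ends of [c]. *)
have -> : tcomp_map f g = tcomp_map i d.
  by apply: tmap_eq; apply: cor_ext; rewrite /= !pfop_compMor gE dE EW.
apply: agr_pre.
have Pi : horn k S2 i by apply: (horn_sub2 ik xy' tV xy ck ix iy ic il erefl i2).
apply: (agr_tree Pi); last first.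
  move=> v1; case: (tV v1) => ->.
    exact: gen (maps_vertexI ix).
  exact: gen (maps_vertexI iy).
apply: (HQ _ x').
(* A third vertex makes the two-vertex subtree strictly smaller than [T], as [HQ] requires. *)
have J : joins c x y.
  by apply/joinsP; rewrite -(mem_listing xl) -(mem_listing yl) mem_rcons !mem_head.
have [z [zx zy]] := inner_third ik J ck.
apply: (@leq_trans #|[set x; y; z]|); last exact: max_card.
apply: (@leq_ltn_trans #|[set x'; y']|).
  by apply: subset_leq_card; apply/subsetP => v1 _; rewrite !inE; case: (tV v1) => ->; rewrite eqxx ?orbT.
rewrite cards2 xy' setUC cardsU1 cards2 xy !inE negb_or zx zy.
by [].
Qed.

(** * Nerves *)

Lemma maps_listing (S T : tree) (f : cycMor (treeOp S) (treeOp T)) v w L (hL : listing w L) :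
  maps_vertex f v w -> exists l (h : listing v l), map (fcol f) l = L /\ pfop f (pg h) = pg hL.
Proof.
move=> m; have [h0 E0] := maps_vertex_pg (listing_enum v) m.
have [s Es] := listing_perm h0 hL.
have sz : size (enum (adj v)) = size (map (fcol f) (enum (adj v))) by rewrite size_map.
have h := listing_permute s sz (listing_enum v).
exists _, h; split; first by rewrite map_permute.
have a := pfop_act f (gen_act (listing_enum v) h sz); rewrite E0 in a.
exact: IsAct_fun a (gen_act' h0 hL erefl Es).
Qed.

Lemma single_all (S : tree) : single_vertex S -> forall w w' : vertex S, w = w'.
Proof.
rewrite /single_vertex => S1 w w'.
by have /card_le1_eqP : #|vertex S| <= 1; [rewrite S1|apply].
Qed.

Section NerveSegal.
Variables (X : astroidal) (C : cycOperad) (a : hom X (nerve C)).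
Hypothesis ab : forall T : tree, bijective (@hmap X (nerve C) a T).

Definition az (z : Zop X) : pop C := pfop (hmap a (projT2 z) : cycMor _ _) (gcor (projT1 z)).

Lemma az_ev (T : tree) (t : X T) W z : ev t W z -> az z = pfop (hmap a t : cycMor _ _) W.
Proof. by move=> [n [f [<- ->]]]; rewrite /az /= hmap_nat /= pfop_compMor. Qed.

Definition acol (x : X eta) : col C := fcol (hmap a x : cycMor (treeOp eta) C) tt.

Lemma acol_ecol (T : tree) (t : X T) e : acol (ecol t e) = fcol (hmap a t : cycMor _ _) e.
Proof. by rewrite /acol /ecol hmap_nat /= emE. Qed.

Lemma nerve_qinj : qinj X.
Proof.
move=> T t t' Hc Hg; apply: (bij_inj (ab T)); apply: tree_ext => [e|v].
  by rewrite -!acol_ecol Hc.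
have [l [h [z [e1 e2]]]] := Hg v; exists l, h.
by rewrite -(az_ev e1) -(az_ev e2).
Qed.

(** The values at the vertices are carried to the nerve, where freeness of A(T) extends any matching
    choice, and the result comes back along the bijection [ab]. *)
Lemma nerve_glue (T : tree) : glue X T.
Proof.
move=> uu L hL cl pu.
have prz z : pr (az z) = map acol (prof z).
  by rewrite /az pr_pfop /prof -map_comp; apply: eq_map => i /=; rewrite acol_ecol.
have [|f [_ fg]] := @free_ex T C (acol \o cl) L hL (fun v => az (uu v)).
  by move=> v; rewrite prz pu -map_comp.
have [b bK Kb] := ab T; exists (b f) => v.
have sz : size (L v) = projT1 (uu v) by rewrite -size_prof pu size_map.
have [c cE] := cor_tmap (hL v) sz.
exists (projT1 (uu v)), c; split=> //.
have := fg v; case: (uu v) c cE => n u /= c cE E; congr existT.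
apply: (bij_inj (ab (Cor n))); rewrite hmap_nat Kb /=; apply: cor_ext.
by rewrite pfop_compMor cE E.
Qed.
End NerveSegal.

Lemma em_core (X : astroidal) (T : tree) (P : subrep T) (v0 : vertex T) :
  (forall v l (h : listing v l) n (f : tmap (Cor n) T), pfop f (gcor n) = pg h -> P _ f) ->
  forall e : edge T, P _ (em e).
Proof.
move=> HP e; have [v ve] := edge_vertex v0 e; have h := listing_enum v.
have [c cE] := cor_tmap h erefl; have pE : map (fcol c) (enum 'I_(size (enum (adj v)))) = enum (adj v) := congr1 (@pr _) cE.
have : e \in map (fcol c) (enum 'I_(size (enum (adj v)))) by rewrite pE mem_enum.
case/mapP => i _ Ei; have -> : em e = tcomp_map c (em i).
  by apply/esym/em_eq; rewrite /= emE -Ei.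
by apply: smem_closed; exact: (HP _ _ _ _ _ cE).
Qed.

(** A map on [P] has values on all corollas, and these match along edges because the inclusions of
    edges belong to [P] as well ([em_core]). *)
Lemma glue_hom (X : astroidal) (T : tree) (P : subrep T) (v0 : vertex T)
    (a : hom (subrep_astroidal P) X) :
  (forall v l (h : listing v l) n (f : tmap (Cor n) T), pfop f (gcor n) = pg h -> P _ f) ->
  glue X T -> exists t : X T, forall v, exists l (h : listing v l) n (f : tmap (Cor n) T),
    pfop f (gcor n) = pg h /\ agr a t f.
Proof.
move=> HP G; have Pe := em_core X v0 HP.
pose cl e := hmap a (exist _ (em e) (Pe e) : sub_ob P eta).
have exc v : exists c : tmap (Cor (size (enum (adj v)))) T, pfop c (gcor _) = pg (listing_enum v).
  exact: cor_tmap.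
pose c v := sval (cid (exc v)); have cE v : pfop (c v) (gcor _) = pg (listing_enum v) := svalP (cid (exc v)).
pose u v := hmap a (exist _ (c v) (HP _ _ _ _ _ (cE v)) : sub_ob P _).
have [|t et] := G (fun v => existT (fun n => X (Cor n) : Type) _ (u v)) _ (@listing_enum T) cl.
  move=> v; have pE : map (fcol (c v)) (enum 'I_(size (enum (adj v)))) = enum (adj v) := congr1 (@pr _) (cE v).
  rewrite /prof /= -[X in map cl X]pE -[RHS]map_comp.
  apply: eq_map => i /=; rewrite /ecol /u -hmap_nat /cl; congr (hmap a _).
  by apply: sub_ob_eq; apply: em_eq; rewrite /= emE.
exists t => v; exists _, (listing_enum v), _, (c v); split=> //.
exists (HP _ _ _ _ _ (cE v)).
by rewrite -(ev_cor (cE v) (et v)).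
Qed.

Section SegalKan.
Variable X : astroidal.
Hypothesis Q : qinj X.
Hypothesis G : forall T, vertex T -> glue X T.

Lemma qinj_T (T : tree) : vertex T -> qinjT X T.
Proof. by move=> v0 t t' H; apply: (qinj_gen Q v0). Qed.

(** Injectivity comes from [Q] and surjectivity from gluing; a member of the core factors through a
    corolla, where agreement holds by construction. *)
Lemma seg_segal : segal_condition X.
Proof.
move=> T /card_gt0P [v0 _]; apply: inj_surj_bij => [b b'|a].
  rewrite (yoK b) (yoK b'); move: (hmap _ _) (hmap _ _) => t' t E.
  congr yo; apply: (qinj_T v0) => v; have h := listing_enum v.
  have [c cE] := cor_tmap h erefl.
  exists _, h, (existT (fun n => X (Cor n) : Type) _ (amap X c t)); split; first by exists (size (enum (adj v))), c.
  exists (size (enum (adj v))), c; split=> //; congr existT.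
  have := congr1 (fun g : hom (subrep_astroidal (segal_core T)) X =>
    hmap g (exist _ c (corolla_core cE) : sub_ob (segal_core T) _)) E.
  by [].
have HP v l (h : listing v l) n (f : tmap (Cor n) T) : pfop f (gcor n) = pg h -> segal_core T _ f.
  exact: corolla_core.
have [t tA] := glue_hom v0 a HP (G v0); exists (yo t).
apply: hom_eq => R [f Pf] /=; rewrite (@agrE X T (segal_core T) a t R (exist _ f Pf)) //=.
have [v [S [c [[S1 [w [cI cim cm]]] [g ->]]]]] := Pf; apply: agr_pre.
have SE (w' : vertex S) : w' = w := single_all S1 w' w.
have Pc : segal_core T _ c.
  by exists v, S, c; split; [split=> //; exists w|exists (tid_map _); rewrite tcomp_map1].
apply: (agr_tree Pc (qinj_T w)) => w'; rewrite (SE w').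
have h := listing_enum w; have [d gE] := cor_tmap h erefl.
have [h' E] := maps_vertex_pg h cm.
exists _, h, _, d; split=> //; have [l2 [h2 [n2 [f2 [E2 A]]]]] := tA v.
have E3 : pfop (tcomp_map c d) (gcor _) = pg h' by rewrite /= pfop_compMor gE E.
exact: agr_cor E2 E3 A.
Qed.

Lemma seg_kan : strict_inner_kan X.
Proof.
move=> T k ik a; have /existsP [v0 _] := ik.
have [t tA] := glue_hom v0 a (horn_corolla ik) (G v0).
exists (yo t); split.
  by apply: horn_agree => // S w _; apply: qinj_T.
move=> b; rewrite (yoK b); move: (hmap b _) => t' E; congr yo.
apply: (qinj_T v0) => v; have [l [h [n [f [fE [Pf fA]]]]]] := tA v.
exists l, h, (existT (fun n => X (Cor n) : Type) n (amap X f t)); split; first by exists n, f.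
exists n, f; split=> //; rewrite fA; congr existT.
by rewrite -E.
Qed.
End SegalKan.

(** * Relations generated by prescribed values *)

Section Family.
Variables (X : astroidal) (T : tree) (cl : edge T -> X eta).
Variable fam : pop (treeOp T) -> Zop X -> Prop.

(** The closure of the prescribed values [fam] under identities and permutations, to be used as the
    relation [K] of [glueK]. *)
Definition KF (W : pop (treeOp T)) (z : Zop X) : Prop :=
  (exists2 e : edge T, W = pid (e : col (treeOp T)) & z = idZ (cl e)) \/
  exists O y n (s : 'S_n), [/\ fam O y, IsAct s O W & actR s y z].

Hypothesis fam_uniq : forall O y, fam O y -> uniq (pr O : seq (edge T)) /\ 0 < tot O.
Hypothesis fam_inj : forall O y O' y', fam O y -> fam O' y' ->
  (forall v, cntv v O = cntv v O') -> O = O' /\ y = y'.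

(** Counts are invariant under permutation, so they single out the member of [fam] from which an
    operation comes; its profile being duplicate free, the permutation is determined too. Members
    use some vertex, which keeps them apart from identities. *)
Lemma KF_fun W z z' : KF W z -> KF W z' -> z = z'.
Proof.
case=> [[e -> ->]|[O [y [n [s [fO a r]]]]]] [[e' E E']|[O' [y' [n' [s' [fO' a' r']]]]]].
- by have [-> ] := congr1 (@pr _) E; rewrite E'.
- have [_] := fam_uniq fO'; by rewrite /tot -(cnt_act _ a') cnt_id.
- have [_] := fam_uniq fO; by rewrite /tot -(cnt_act _ a) E cnt_id.
have [EO Ey] : O = O' /\ y = y'.
  by apply: (fam_inj fO fO') => v; rewrite /cntv -(cnt_act _ a) -(cnt_act _ a').
subst O' y'; have En : n = n' by rewrite -(IsAct_size a) (IsAct_size a').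
case: n' / En s' a' r' => s' a' r'.
have [U _] := fam_uniq fO.
have Es : s = s' by apply: (permute_inj (IsAct_size a) U); rewrite -(IsAct_pr a) (IsAct_pr a').
by rewrite -Es in r'; apply: actR_fun r r'.
Qed.

Lemma actR_idZ n (s : 'S_n) (x : X eta) z : actR s (idZ x) z -> z = idZ x.
Proof.
move=> r; have e := ev_id x (tt : edge eta); rewrite ecol_eta in e.
have sz : size (pr (pid (tt : col (treeOp eta)))) = n.
  by case: r => W a _; have := IsAct_size a; rewrite size_gcor.
have [W a] := IsAct_ex s sz.
have := ev_act e a r; rewrite (lact_id a) => e'; exact: ev_fun e' e.
Qed.

Lemma KF_act n (s : 'S_n) W W' z z' : KF W z -> IsAct s W W' -> actR s z z' -> KF W' z'.
Proof.
case=> [[e -> ->] a r|[O [y [m [t [fO a0 r0]]]]] a r].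
  by left; exists e; [apply: lact_id a|apply: actR_idZ r].
have E : n = m by rewrite -(IsAct_size a) (IsAct_pr a0) size_permute // (IsAct_size a0).
case: m / E t a0 r0 => t a0 r0.
right; exists O, y, n, (s * t)%g; split=> //; first exact: lactM a0 a.
exact: actRM r0 r.
Qed.

Lemma KF_fam O y : fam O y -> size (prof y) = size (pr O) -> KF O y.
Proof.
move=> fO sz; have [W a] := IsAct_ex (1%g : 'S_(size (pr O))) erefl.
have [z r] := actR_ex (1%g : 'S_(size (pr O))) sz.
have EW := lact1 a; have Ez := actR1 r; subst W z.
by right; exists O, y, (size (pr O)), 1%g.
Qed.

Section Good.
Variables (S : tree) (f : tmap S T) (s : X S).

Lemma good_KF :
  (forall e, ecol s e = cl (fcol f e)) ->
  (forall v, exists l (h : listing v l) z, ev s (pg h) z /\ KF (pfop f (pg h)) z) ->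
  (forall W, rz W -> [\/ exists e : edge S, W = pid (e : col (treeOp S)),
     exists v l (h : listing v l), W = pg h |
     exists W0 z0 n (r : 'S_n), [/\ IsAct r W0 W, ev s W0 z0 & KF (pfop f W0) z0]]) ->
  good KF f s.
Proof.
move=> Hc Hg HW W z ez; have [[e E]|[v [l [h E]]]|[W0 [z0 [n [r [a e0 K0]]]]]] := HW W (ev_rz ez).
- left; exists (fcol f e); first by rewrite E pfop_id.
  by rewrite E in ez; rewrite (ev_fun ez (ev_id s e)) Hc.
- have [l0 [h0 [z0 [e0 K0]]]] := Hg v; have [r Er] := listing_perm h0 h.
  have a := gen_act' h0 h erefl Er; rewrite E in ez *.
  exact: KF_act K0 (pfop_act f a) (ev_actR e0 a ez).
- exact: KF_act K0 (pfop_act f a) (ev_actR e0 a ez).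
Qed.

Lemma ecol_of (v : vertex S) l (h : listing v l) z : ev s (pg h) z ->
  prof z = map cl (map (fcol f) l) -> forall e, adj v e -> ecol s e = cl (fcol f e).
Proof.
move=> /ev_prof ->; rewrite -map_comp => /eq_in_map E e ve; apply: E.
by rewrite (mem_listing h).
Qed.
End Good.

Lemma single_good (S : tree) (f : tmap S T) (w : vertex S) (v : vertex T) L (hL : listing v L) z :
  (forall w', w' = w) -> maps_vertex f w v -> fam (pg hL) z -> prof z = map cl L ->
  exists s, good KF f s.
Proof.
move=> S1 fm fz pz; have [l [h [El E]]] := maps_listing hL fm.
have sz : size (prof z) = size l by rewrite pz -El !size_map.
have [s es] := single_ex h S1 sz; exists s.
have Kz : KF (pfop f (pg h)) z by rewrite E; apply: KF_fam => //; rewrite pz size_map.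
apply: good_KF.
- move=> e; have [w' we] := edge_vertex w e; rewrite (S1 w') in we.
  by apply: (ecol_of es) => //; rewrite pz El.
- by move=> w'; rewrite (S1 w'); exists l, h, z.
(* On a single-vertex tree a realisable operation uses the vertex at most once, so [tot0_id] and
   [tot1_gen] classify it. *)
- move=> W rW; have : tot W <= 1.
    rewrite tot_sum (bigD1 w) //= big1 ?addn0; first exact: rz_cnt.
    by move=> w'; rewrite (S1 w') eqxx.
  case E1 : (tot W) => [|[|]] // _; first by apply: Or31; apply: tot0_id.
  by apply: Or32; apply: tot1_gen.
Qed.

(** Gluing on two vertices produces [s]. Besides identities and generators, [op2P] leaves only the
    permuted composite, whose value is right because [z0] is the composite of [za] and [zb]. *)
Lemma face_good (G2 : glue_twoV X) (Q : qinj X) (S : tree) (f : tmap S T) (a b : vertex S)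
    c l r (ha : listing a (rcons l c)) (hb : listing b ([::] ++ c :: r)) za zb z0 W0 :
  a != b -> twoV a b -> @IsComp (treeOp S) l c [::] r (pg ha) (pg hb) W0 ->
  KF (pfop f (pg ha)) za -> KF (pfop f (pg hb)) zb -> KF (pfop f W0) z0 ->
  compR (size l) 0 za zb z0 ->
  prof za = map cl (map (fcol f) (rcons l c)) -> prof zb = map cl (map (fcol f) (c :: r)) ->
  exists s, good KF f s.
Proof.
move=> ab tV C Ka Kb K0 cR pa pb.
have [||s [ea eb]] := @glue_pair _ S a b _ _ ha hb za zb (cl \o fcol f) (G2 _ _ _ ab tV) ab tV.
- by rewrite pa -[LHS]map_comp.
- by rewrite pb -[LHS]map_comp.
have [z1 e1] := ev_ex s (rz_comp ab C).
have E1 : z0 = z1.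
  by apply: (compR_fun Q cR); exists S, s, a, b, c, l, [::], r, ha, hb, W0.
subst z1; exists s; apply: good_KF.
- move=> e; have [w we] := edge_vertex a e; case: (tV w) => E; subst w.
    exact: ecol_of ea pa _ we.
  exact: ecol_of eb pb _ we.
- by move=> w; case: (tV w) => ->; [exists _, ha, za|exists _, hb, zb].
- move=> W rW; have := op2P ab tV C (rz_cnt a rW) (rz_cnt b rW).
  case=> [e E|v m h E|n t aW].
  + by apply: Or31; exists e.
  + by apply: Or32; exists v, m, h.
  + by apply: Or33; exists W0, z0, n, t.
Qed.

Lemma KF_ev (P : subrep T) (b : hom (subrep_astroidal P) X) (t : X T) :
  (forall R (f : sub_ob P R), good KF (sval f) (hmap b f)) ->
  (forall v l (h : listing v l) n (f : tmap (Cor n) T), pfop f (gcor n) = pg h -> P _ f) ->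
  restrict P (yo t) = b ->
  forall v l (h : listing v l) z, fam (pg h) z -> size (prof z) = size l -> ev t (pg h) z.
Proof.
move=> bg HP tb v l h z fz sz; have [c cE] := cor_tmap h erefl.
have Pc : P _ c := HP _ _ _ _ _ cE.
pose fc : sub_ob P _ := exist _ c Pc.
have K1 := bg _ fc _ _ (ev_self (existT (fun n => X (Cor n) : Type) _ (hmap b fc))).
rewrite /= cE in K1; rewrite (KF_fun (KF_fam fz sz) K1).
by exists (size l), c; split=> //; rewrite -tb.
Qed.
End Family.

(** A generator is recognised by the vertex that it counts. *)
Lemma genfam_ok (X : astroidal) (T : tree) (uu : vertex T -> Zop X) L (hL : forall v, listing v (L v)) :
  let fam O y := exists v : vertex T, O = pg (hL v) /\ y = uu v in
  (forall O y, fam O y -> uniq (pr O : seq (edge T)) /\ 0 < tot O) /\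
  (forall O y O' y', fam O y -> fam O' y' ->
    (forall v, cntv v O = cntv v O') -> O = O' /\ y = y').
Proof.
move=> fam; split=> [O y [v [-> _]]|O y O' y' [v [-> ->]] [v' [-> ->]] E].
  by split; [apply: (listing_uniq (hL v))|rewrite /tot cnt_gen].
have := E v; rewrite /cntv !cnt_gen eqxx; case: eqP => // ->.
by [].
Qed.

(** * Determination and gluing from the Segal condition *)

Section SegalToSeg.
Variable X : astroidal.
Hypothesis SX : segal_condition X.

Lemma segal_qinj : qinj X.
Proof.
apply: qinj_of => T v0 t t' H.
have T0 : 0 < #|vertex T| by apply/card_gt0P; exists v0.
suff E : restrict (segal_core T) (yo t) = restrict (segal_core T) (yo t').
  have := bij_inj (SX T0) E => /(congr1 (fun b : hom (representable T) X => hmap b (tid_map T))) /=.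
  by rewrite !amap_id.
apply: hom_eq => R [f Pf] /=.
have [v [S [c [[S1 [w [cI cim cm]]] [g ->]]]]] := Pf; rewrite !amap_comp; congr (amap X g _).
have [l [h [z [e1 e2]]]] := H v.
have [m [hm [Em E]]] := maps_listing h cm.
apply: (@single_eq X S w _ _ m hm z (fun w' => single_all S1 w' w)).
  by apply: ev_map'; [apply: rz_gen|rewrite E].
by apply: ev_map'; [apply: rz_gen|rewrite E].
Qed.

(** Members of the core factor through corollas, so matching values at the vertices already define a
    map on the core, which the Segal condition extends. *)
Lemma segal_glue (T : tree) : vertex T -> glue X T.
Proof.
move=> v0 uu L hL cl pu; pose fam O y := exists v : vertex T, O = pg (hL v) /\ y = uu v.
have [fu fi] := genfam_ok uu hL; have Kf := KF_fun (cl := cl) fu fi.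
have [|b bg] := @glueK X segal_qinj T (KF cl fam) (segal_core T) Kf.
  move=> R f [v [S [c [[S1 [w [cI cim cm]]] [g ->]]]]].
  have [||s sg] := @single_good X T cl fam S c w v (L v) (hL v) (uu v) (fun w' => single_all S1 w' w) cm.
  - by exists v.
  - exact: pu.
  by exists (amap X g s); apply: good_map.
have T0 : 0 < #|vertex T| by apply/card_gt0P; exists v0.
have [r _ rK] := SX T0; exists (hmap (r b) (tid_map T)) => v.
have E : restrict (segal_core T) (yo (hmap (r b) (tid_map T))) = b by rewrite -yoK.
apply: (KF_ev fu fi bg _ E); last by rewrite pu size_map.
- by move=> v' l h n f; apply: corolla_core.
- by exists v.
Qed.
End SegalToSeg.

(** * Determination and gluing from the Kan condition *)

Section Kan.
Variable X : astroidal.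
Hypothesis KX : strict_inner_kan X.

Lemma kan_ext (T : tree) (k : edge T) (ik : inner k) (b : hom (subrep_astroidal (horn k)) X) :
  exists t : X T, restrict (horn k) (yo t) = b.
Proof. by have [c [cE _]] := KX ik b; exists (hmap c (tid_map T)); rewrite -yoK. Qed.

Lemma kan_inj (T : tree) (k : edge T) (ik : inner k) (t t' : X T) :
  restrict (horn k) (yo t) = restrict (horn k) (yo t') -> t = t'.
Proof.
move=> E; have [c [_ cU]] := KX ik (restrict (horn k) (yo t')).
have := etrans (esym (cU _ E)) (cU _ erefl).
move=> /(congr1 (fun b : hom (representable T) X => hmap b (tid_map T))) /=.
by rewrite !amap_id.
Qed.

(** Agreement on corollas gives agreement on the horn by [horn_agree], whose use of smaller trees is
    covered by induction. A tree with a single vertex has no inner edge and is treated directly. *)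
Lemma kan_qinjT n (T : tree) : #|vertex T| <= n -> vertex T -> qinjT X T.
Proof.
elim: n T => [|n IH] T le v0.
  have : 0 < #|vertex T| by apply/card_gt0P; exists v0.
  by rewrite ltnNge le.
move=> t t' H; have [S1|] := pselect (forall w, w = v0).
  by have [l [h [z [e1 e2]]]] := H v0; apply: (single_eq S1 e1 e2).
move=> /existsNP [w /eqP wv]; rewrite eq_sym in wv.
have [k [y J]] := inner_at wv; have ik := innerI J.
apply: (kan_inj ik); apply: horn_agree => //.
- move=> v; have [l [h [z [e1 e2]]]] := H v.
  have [f fE] := cor_tmap h erefl; exists l, h, _, f; split=> //.
  exists (horn_corolla ik fE) => /=.
  have e0 : ev t (pg h) (existT (fun n => X (Cor n) : Type) _ (amap X f t)) by exists (size l), f.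
  by rewrite (ev_fun e1 e0) in e2; apply: ev_cor fE e2.
- by move=> S s lt; apply: IH => //; rewrite -ltnS; apply: leq_trans lt le.
Qed.

Lemma kan_qinj : qinj X.
Proof. by apply: qinj_of => T v0; apply: (kan_qinjT (leqnn _) v0). Qed.

Let Q := kan_qinj.

(** The only inner edge is the one whose face is omitted, so the horn consists of the two corollas,
    and values with matching colours define a map on it. *)
Lemma kan_G2 : glue_twoV X.
Proof.
move=> T x y xy tV uu L hL cl pu; pose fam O z := exists v : vertex T, O = pg (hL v) /\ z = uu v.
have [fu fi] := genfam_ok uu hL; have Kf := KF_fun (cl := cl) fu fi.
have [c [y' J]] := inner_at xy; have ik := innerI J.
have Jxy : joins c x y.
  by have [E|<- //] := tV y'; case/joinsP: J => + _ _; rewrite E eqxx.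
have [|b bg] := @glueK X Q T (KF cl fam) (horn c) Kf.
  move=> R f [S [a [Ca [g ->]]]].
  suff [s sg] : exists s, good (KF cl fam) a s by exists (amap X g s); apply: good_map.
  have /andP [/card_gt0P [w _] _] := coface_card ik Ca.
  case: Ca => [[[_ [u [j [[_ _ [jI jim] _] jm]]]]|[T1 _]]|[c' cc' [x0 [y0 [q [con _ _]]]]]].
  - apply: (@single_good X T cl fam S a w (j w) (L (j w)) (hL (j w)) (uu (j w))) => //.
    + move=> w'; apply: jI; have n1 : j w' <> u by apply/jim; exists w'.
      have n2 : j w <> u by apply/jim; exists w.
      by case: (tV u) n1 n2 => ->; case: (tV (j w)) => ->; case: (tV (j w')) => ->.
    + by exists (j w).
  - by case/eqP: xy; apply: single_all.
  (* An inner face along another edge is impossible, since two vertices share only one edge. *)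
  - have [/joinsP [xy0 xc yc] _ _ _ _] := con.
    case: cc'; case/joinsP: Jxy => _ xc' yc'.
    case: (tV x0) (tV y0) => E [] E'; subst x0 y0; rewrite ?eqxx // in xy0.
      exact: two_common xy xc yc xc' yc'.
    exact: two_common xy yc xc xc' yc'.
have [t tE] := kan_ext ik b; exists t => v.
apply: (KF_ev fu fi bg _ tE); last by rewrite pu size_map.
- exact: horn_corolla.
- by exists v.
Qed.

Section Face.
Variables (T : tree) (cl : edge T -> X eta) (fam : pop (treeOp T) -> Zop X -> Prop).

(** Applies [face_good] to a two-vertex face whose generators and composite all go to operations in
    [fam]. Every face in the three-vertex horn below is of this kind. *)
Lemma face_fam (S : tree) (f : tmap S T) (a b : vertex S) la lb (ha : listing a la)
    (hb : listing b lb) k l r Oa Ob Oab za zb zab :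
  injective (fcol f) -> a != b -> twoV a b ->
  map (fcol f) la = rcons l k -> map (fcol f) lb = k :: r ->
  pfop f (pg ha) = Oa -> pfop f (pg hb) = Ob ->
  @IsComp (treeOp T) l k [::] r Oa Ob Oab ->
  fam Oa za -> fam Ob zb -> fam Oab zab -> compR (size l) 0 za zb zab ->
  prof za = map cl (pr Oa) -> prof zb = map cl (pr Ob) -> prof zab = map cl (pr Oab) ->
  exists s, good (KF cl fam) f s.
Proof.
move=> fI ab tV Ea Eb fa fb C famA famB famAB cR pa pb pab.
have [l' [c [El fl fc]]] := map_rcons_inv Ea.
case: lb hb Eb fb => // c' r' hb [fc' fr] fb.
have Ec : c' = c by apply: fI; rewrite fc fc'.
subst la c'.
have [W0 C0] := comp_pg ha (hb : listing b ([::] ++ c :: r')).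
have EW : pfop f W0 = Oab.
  by have := pfop_comp f C0; rewrite fa fb fl fc fr => /IsComp_fun /(_ C).
have KA : KF cl fam (pfop f (pg ha)) za by rewrite fa; apply: KF_fam => //; rewrite pa size_map.
have KB : KF cl fam (pfop f (pg hb)) zb by rewrite fb; apply: KF_fam => //; rewrite pb size_map.
have KAB : KF cl fam (pfop f W0) zab by rewrite EW; apply: KF_fam => //; rewrite pab size_map.
have sl : size l = size l' by rewrite -fl size_map.
rewrite sl in cR.
apply: (face_good kan_G2 Q ab tV C0 KA KB KAB cR).
  by rewrite pa -fa.
by rewrite pb -fb.
Qed.
End Face.

(** In the chain [x], [y], [z] the horn at [k] has three faces: deleting [x], deleting [z], and
    contracting [m]. A map on it needs, besides the given values, composites of [x] with [y], of [y]
    with [z], and of [x] with the latter; two-vertex gluing provides them. *)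
Lemma kan_G3 : glue_threeV X.
Proof.
move=> T x y z k m xy yz xz V3 Jk Jm.
have /joinsP [_ xk yk] := Jk; have /joinsP [_ ym zm] := Jm.
have km : k != m.
  apply/eqP => E; subst m; have [E|E] := adj_third xy xk yk zm; first by rewrite E eqxx in xz.
  by rewrite E eqxx in yz.
have ik := innerI Jk.
have [_ hx] := listing_rem xk; set lx := rem k _ in hx.
have [h1 _] := listing_rem zm; set lz := rem m _ in h1.
have [h2 _] := listing_rem yk; set ly := rem k _ in h2.
have hyA : listing y ([::] ++ k :: rcons (rem m ly) m).
  apply: (perm_trans _ h2); rewrite perm_cons perm_rcons perm_sym; apply: perm_to_rem.
  by have := ym; rewrite -(mem_listing h2) inE eq_sym (negbTE km).
set my := rem m ly in hyA.
(* Listing [k] first and [m] last makes [hyA] and [hyB] convertible, so one listing of [y] serves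
   for the second factor along [k] and for the first factor along [m]. *)
pose hyB : listing y (rcons (k :: my) m) := hyA.
have hzA : listing z ([::] ++ m :: lz) := h1.
have [yx zx zy] : [/\ (y == x) = false, (z == x) = false & (z == y) = false].
  by rewrite (eq_sym y) (eq_sym z x) (eq_sym z y); split; apply/negbTE.
pose L v := if v == x then rcons lx k else if v == y then k :: rcons my m else m :: lz.
have hL v : listing v (L v) by rewrite /L; case: (V3 v) => ->; rewrite ?eqxx ?yx ?zx ?zy.
apply: (glue_relist (hL := hL)) => uu cl pu.
have Lx : L x = rcons lx k by rewrite /L eqxx.
have Ly : L y = k :: rcons my m by rewrite /L yx eqxx.
have Lz : L z = m :: lz by rewrite /L zx zy.
have Gx : pg (hL x) = pg hx by apply: pg_eq.
have Gy : pg (hL y) = pg hyA by apply: pg_eq.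
have Gz : pg (hL z) = pg hzA by apply: pg_eq.
have px : prof (uu x) = rcons (map cl lx) (cl k) by rewrite pu Lx map_rcons.
have py : prof (uu y) = cl k :: rcons (map cl my) (cl m) by rewrite pu Ly /= map_rcons.
have pz : prof (uu z) = cl m :: map cl lz by rewrite pu Lz.
have [Oxy Cxy] := comp_pg hx hyA; have [Oyz Cyz] := comp_pg hyB hzA.
have [_ _ pOxy] := IsComp_pr Cxy; have [_ _ pOyz] := IsComp_pr Cyz.
have [Oxyz Cxyz] : exists W, @IsComp (treeOp T) lx k [::] (my ++ lz) (pg hx) Oyz W.
  by apply: IsComp_ex.
have [_ _ pOxyz] := IsComp_pr Cxyz.
have [zxy cxy] := compR_ex (d1 := [::]) kan_G2 px py.
have pxy := compR_prof (d1 := [::]) px py cxy.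
have [zyz cyz] := compR_ex (d1 := [::]) kan_G2 (c := cl k :: map cl my) py pz.
have pyz := compR_prof (d1 := [::]) (c := cl k :: map cl my) py pz cyz.
have [zxyz cxyz] := compR_ex (d1 := [::]) kan_G2 px pyz.
have pxyz := compR_prof (d1 := [::]) px pyz cxyz.
have U := T3_uniq (D1 := [::]) (D2 := my) (G1 := [::]) (G2 := lz) xy yz xz hx hyA hzA.
(* The flags tell which vertices an operation uses; [x] and [z] without [y] are not connected, and
   no flag at all would mean an identity. *)
pose o (bx by_ bz : bool) : option (pop (treeOp T) * Zop X) :=
  match bx, by_, bz with
  | true, false, false => Some (pg hx, uu x)
  | false, true, false => Some (pg hyA, uu y)
  | false, false, true => Some (pg hzA, uu z)
  | true, true, false => Some (Oxy, zxy)
  | false, true, true => Some (Oyz, zyz)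
  | true, true, true => Some (Oxyz, zxyz)
  | _, _, _ => None
  end.
pose fam O w := exists bx by_ bz, o bx by_ bz = Some (O, w).
have ocnt bx by_ bz O w : o bx by_ bz = Some (O, w) ->
    [/\ cntv x O = bx, cntv y O = by_ & cntv z O = bz].
  have cy v : cntv v Oyz = (y == v) + (z == v) by rewrite /cntv (cnt_comp _ Cyz) !cnt_gen.
  have cA v : cntv v Oxy = (x == v) + (y == v) by rewrite /cntv (cnt_comp _ Cxy) !cnt_gen.
  have cB v : cntv v Oxyz = (x == v) + ((y == v) + (z == v)).
    by rewrite /cntv (cnt_comp _ Cxyz) cnt_gen -cy.
  have cg v v' l (h : listing v l) : cntv v' (pg h) = (v == v') by rewrite /cntv cnt_gen.
  by case: bx; case: by_; case: bz => //= -[<- _];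
    rewrite ?cy ?cA ?cB ?cg !eqxx ?yx ?zx ?zy ?(negbTE xy) ?(negbTE yz) ?(negbTE xz).
have fi O w O' w' : fam O w -> fam O' w' -> (forall v, cntv v O = cntv v O') -> O = O' /\ w = w'.
  move=> [bx [by_ [bz E]]] [bx' [by' [bz' E']]] H.
  have [e1 e2 e3] := ocnt _ _ _ _ _ E; have [e1' e2' e3'] := ocnt _ _ _ _ _ E'.
  have nb (b b' : bool) : b = b' :> nat -> b = b' by case: b; case: b'.
  have Ex : bx = bx' by apply: nb; rewrite -e1 -e1'.
  have Ey : by_ = by' by apply: nb; rewrite -e2 -e2'.
  have Ez : bz = bz' by apply: nb; rewrite -e3 -e3'.
  by move: E; rewrite Ex Ey Ez E' => -[-> ->].
have fu O w : fam O w -> uniq (pr O : seq (edge T)) /\ 0 < tot O.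
  move=> [bx [by_ [bz E]]]; split; last first.
    have [e1 e2 e3] := ocnt _ _ _ _ _ E.
    have ge v : cntv v O <= tot O by rewrite tot_sum (bigD1 v) //= leq_addr.
    have := ge x; have := ge y; have := ge z; rewrite e1 e2 e3.
    by case: bx E {e1}; case: by_ {e2}; case: bz {e3}.
  have Ux : uniq (rcons lx k) := listing_uniq hx.
  have Uy : uniq (k :: rcons my m) := listing_uniq hyA.
  have Uz : uniq (m :: lz) := listing_uniq hzA.
  have Uxy : uniq (pr Oxy : seq (edge T)).
    by rewrite pOxy; have := listing_common xy hx hyA; rewrite cons_uniq => /andP [].
  have Uyz : uniq (pr Oyz : seq (edge T)).
    by rewrite pOyz; have := listing_common yz hyB hzA; rewrite cons_uniq => /andP [].
  have Uxyz : uniq (pr Oxyz : seq (edge T)).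
    by rewrite pOxyz; move: U; rewrite !cons_uniq => /and3P [].
  by case: bx E; case: by_; case: bz => //= -[<- _].
have f1 : fam (pg hx) (uu x) by exists true, false, false.
have f2 : fam (pg hyA) (uu y) by exists false, true, false.
have f3 : fam (pg hzA) (uu z) by exists false, false, true.
have f4 : fam Oxy zxy by exists true, true, false.
have f5 : fam Oyz zyz by exists false, true, true.
have f6 : fam Oxyz zxyz by exists true, true, true.
have q1 : prof (uu x) = map cl (pr (pg hx)) by rewrite px /= map_rcons.
have q2 : prof (uu y) = map cl (pr (pg hyA)) by rewrite py /= map_rcons.
have q3 : prof (uu z) = map cl (pr (pg hzA)) by rewrite pz.
have q4 : prof zxy = map cl (pr Oxy) by rewrite pxy pOxy !map_cat map_rcons.
have q5 : prof zyz = map cl (pr Oyz) by rewrite pyz pOyz !map_cat.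
have q6 : prof zxyz = map cl (pr Oxyz) by rewrite pxyz pOxyz !map_cat.
rewrite !size_map in cxy cxyz; rewrite /= size_map in cyz.
have [|b bg] := @glueK X Q T (KF cl fam) (horn k) (KF_fun fu fi).
  move=> R f [S [a [Ca [g ->]]]].
  suff [s sg] : exists s, good (KF cl fam) a s by exists (amap X g s); apply: good_map.
  case: Ca => [[[_ [u [j [[ou [aI _] [jI jim] _] jm]]]]|[T1 _]]|[c ck [x0 [y0 [q [con fm fC]]]]]].
  - have juE v : j v <> u by apply/jim; exists v.
    have pre v : v <> u -> exists v', j v' = v by move=> /jim.
    (* An outer face deletes [x] or [z]; the middle vertex [y] has two inner edges. *)
    case: (V3 u) => Eu; subst u.
    + have [y' Ey] : exists y', j y' = y by apply: pre; apply/eqP; rewrite eq_sym.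
      have [z' Ez] : exists z', j z' = z by apply: pre; apply/eqP; rewrite eq_sym.
      have jy := jm y'; have jz := jm z'; rewrite Ey in jy; rewrite Ez in jz.
      have [la [ha [Ea fa]]] := maps_listing hyB jy.
      have [lb [hb [Eb fb]]] := maps_listing hzA jz.
      apply: (face_fam aI _ _ Ea Eb fa fb Cyz f2 f3 f5 cyz q2 q3 q5).
        by apply: contraNneq yz => E; rewrite -Ey -Ez E.
      move=> v; case: (V3 (j v)) => E; first by case: (juE v).
        by left; apply: jI; rewrite E.
      by right; apply: jI; rewrite E.
    + move: ou; rewrite /outer leqNgt => /negP; case.
      by apply/card_gt1P; exists k, m; rewrite !inE yk ym ik (innerI Jm).
    + have [x' Ex] : exists x', j x' = x by apply: pre; apply/eqP.
      have [y' Ey] : exists y', j y' = y by apply: pre; apply/eqP.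
      have jx := jm x'; have jy := jm y'; rewrite Ey in jy; rewrite Ex in jx.
      have [la [ha [Ea fa]]] := maps_listing hx jx.
      have [lb [hb [Eb fb]]] := maps_listing hyA jy.
      apply: (face_fam aI _ _ Ea Eb fa fb Cxy f1 f2 f4 cxy q1 q2 q4).
        by apply: contraNneq xy => E; rewrite -Ex -Ey E.
      move=> v; case: (V3 (j v)) => E; last by case: (juE v).
        by left; apply: jI; rewrite E.
      by right; apply: jI; rewrite E.
  - by case/eqP: xy; apply: single_all.
  - have [/joinsP [xy0 x0c y0c] [aI _] [qs qe] _ _] := con.
    (* An inner face other than the omitted one contracts [m], with its ends in either order. *)
    have [Ec Exy0] : c = m /\ ((x0 = y /\ y0 = z) \/ (x0 = z /\ y0 = y)).
      case: (V3 x0) (V3 y0) => E [] E'; subst x0 y0; rewrite ?eqxx // in xy0.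
      + by case: ck; apply: (two_common xy).
      + by case: (no_triangle xy yz xz xk yk ym zm x0c y0c).
      + by case: ck; apply: (two_common xy).
      + by split; [apply: (two_common yz)|left].
      + by case: (no_triangle xy yz xz xk yk ym zm y0c x0c).
      + by split; [apply: (two_common yz)|right].
    subst c; have [l [h C]] := inner_comp con fC hyB (hzA : listing z (m :: lz)) yz.
    have EO : pfop a (pg h) = Oyz := IsComp_fun C Cyz.
    have nx0 : x <> x0 by case: Exy0 => [[-> _]|[-> _]]; apply/eqP.
    have ny0 : x <> y0 by case: Exy0 => [[_ ->]|[_ ->]]; apply/eqP.
    have [la [ha [Ea fa]]] := maps_listing hx (fm x nx0 ny0).
    have El : map (fcol a) l = k :: (my ++ lz).
      by have := congr1 (@pr _) EO; rewrite pOyz.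
    apply: (face_fam aI _ _ Ea El fa EO Cxyz f1 f5 f6 cxyz q1 q5 q6).
      by apply/eqP => /qe [E|[[E _]|[E _]]]; [case: nx0|case: nx0|case: ny0].
    have qy : q y = q x0 by apply/qe; case: Exy0 => [[-> ->]|[-> ->]]; auto.
    have qz : q z = q x0 by apply/qe; case: Exy0 => [[-> ->]|[-> ->]]; auto.
    move=> s; have [v <-] := qs s; case: (V3 v) => ->; rewrite ?qy ?qz; auto.
have [t tE] := kan_ext ik b; exists t.
have main v l (h : listing v l) w : fam (pg h) w -> size (prof w) = size l -> ev t (pg h) w.
  by apply: (KF_ev fu fi bg _ tE); apply: horn_corolla.
move=> v; case: (V3 v) => ->.
- by rewrite Gx; apply: main => //; rewrite q1 size_map.
- by rewrite Gy; apply: main => //; rewrite q2 size_map.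
- by rewrite Gz; apply: main => //; rewrite q3 size_map.
Qed.
End Kan.

Lemma single_glue (X : astroidal) (T : tree) (v : vertex T) : (forall w, w = v) -> glue X T.
Proof.
move=> S1 uu L hL cl pu; have [|t et] := single_ex (hL v) S1 (z := uu v).
  by rewrite pu size_map.
by exists t => w; rewrite (S1 w).
Qed.

(** * Surjectivity of the comparison map *)

Section Surjectivity.
Variable X : astroidal.
Hypothesis Q : qinj X.
Hypothesis G2 : glue_twoV X.
Hypothesis G3 : glue_threeV X.
Notation C := (XC Q G2 G3).
Notation nm := (@nm X Q G2 G3 _).

Lemma nm_glue (T : tree) (y : cycMor (treeOp T) C) : vertex T -> glue X T ->
  exists t : X T, nm t = y.
Proof.
move=> v0 G.
have [|t et] := G (fun v => pzv (pfop y (pg (listing_enum v)))) _ (@listing_enum T) (fcol y).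
  by move=> v; rewrite prof_pzv.
have main v : pfop (nm t) (pg (listing_enum v)) = pfop y (pg (listing_enum v)).
  by apply: pzv_inj; apply: agrees_gen.
exists t; apply: tree_ext => [e|v]; last by exists _, (listing_enum v).
have [v ve] := edge_vertex v0 e.
have /eq_in_map E := congr1 (@pr _) (main v); apply: E.
by rewrite mem_enum.
Qed.

Lemma nm_noV (T : tree) (y : cycMor (treeOp T) C) : (vertex T -> False) ->
  exists t : X T, nm t = y.
Proof.
move=> nV; have /card_gt0P [[v|e] _] := tree_nonempty T; first by case: (nV v).
have [t Et] := noV_ex e (fcol y e) nV; exists t.
apply: tree_ext => [e'|v]; last by case: (nV v).
have [s K] := noV_eta e nV.
have -> : e' = e.
  have := congr1 (fun f : tmap T T => fcol f e') K; rewrite /=; case: (fcol s e').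
  by rewrite emE.
by rewrite nm_col Et.
Qed.

Lemma nm_isomorphic : (forall T (y : cycMor (treeOp T) C), exists t : X T, nm t = y) ->
  isomorphic X (nerve C).
Proof.
move=> H; exists (nmHom Q G2 G3) => T; apply: inj_surj_bij; first exact: nm_inj.
exact: H.
Qed.

(** Faces have fewer vertices, so by induction the restriction of [y] to each face of a horn comes
    from X, and [nm_surj] assembles these preimages by a Kan extension. Trees with at most one
    vertex have no inner edge and are treated directly. *)
Lemma kan_surj (KX : strict_inner_kan X) (T : tree) (y : cycMor (treeOp T) C) :
  exists t : X T, nm t = y.
Proof.
have [n le] : exists n, #|vertex T| <= n by exists #|vertex T|.
elim: n T le y => [|n IH] T le y.
  apply: nm_noV => v; have : 0 < #|vertex T| by apply/card_gt0P; exists v.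
  by rewrite ltnNge le.
have [[v0 _]|nV] := pselect (exists v : vertex T, true); last first.
  by apply: nm_noV => v; apply: nV; exists v.
have [S1|] := pselect (forall w, w = v0).
  exact: nm_glue v0 (single_glue S1).
move=> /existsNP [w /eqP wv]; rewrite eq_sym in wv.
have [k [z J]] := inner_at wv; have ik := innerI J.
apply: (@nm_surj X Q G2 G3 T (horn k) y v0).
- move=> R f [S [a [Ca [g ->]]]].
  have /andP [_ lt] := coface_card ik Ca.
  have [|x xE] := IH S _ (compMor y a); first by rewrite -ltnS; apply: leq_trans lt le.
  by exists (amap X g x); rewrite nm_natural xE compMorA.
- move=> b; have [t tE] := kan_ext KX ik b; exists t => R f.
  by rewrite -tE.
- move=> v; have h := listing_enum v; have [f fE] := cor_tmap h erefl.
  by exists _, h, _, f; split=> //; apply: horn_corolla fE.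
Qed.
End Surjectivity.

Theorem theoremA17 (X : astroidal) :
  ((exists C : cycOperad, isomorphic X (nerve C)) <-> segal_condition X) /\
  (segal_condition X <-> strict_inner_kan X).
Proof.
(* Nerves have both [qinj] and [glue], which imply the other two conditions; conversely each of
   these yields what the construction of the operad requires. All implications thus pass through the
   nerve. *)
have nerve_seg : (exists C : cycOperad, isomorphic X (nerve C)) ->
    qinj X /\ forall T, vertex T -> glue X T.
  move=> [C [a ab]]; split; first exact: nerve_qinj ab.
  by move=> T _; apply: nerve_glue ab T.
have seg_nerve : segal_condition X -> exists C : cycOperad, isomorphic X (nerve C).
  move=> SX; have G := segal_glue SX.
  have G2 : glue_twoV X by move=> T x y _ _; apply: G.
  have G3 : glue_threeV X by move=> T x y z k m *; apply: G.
  exists (XC (segal_qinj SX) G2 G3); apply: nm_isomorphic => T y.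
  have [[v0 _]|nV] := pselect (exists v : vertex T, true).
    exact: nm_glue v0 (G _ v0).
  by apply: nm_noV => v; apply: nV; exists v.
have kan_nerve : strict_inner_kan X -> exists C : cycOperad, isomorphic X (nerve C).
  move=> KX; exists (XC (kan_qinj KX) (kan_G2 KX) (kan_G3 KX)).
  by apply: nm_isomorphic; apply: kan_surj.
split; split=> //.
- by move=> /nerve_seg [Q G]; apply: seg_segal.
- by move=> /seg_nerve /nerve_seg [Q G]; apply: seg_kan.
- by move=> /kan_nerve /nerve_seg [Q G]; apply: seg_segal.
Qed.
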